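(* Let $n\ge 3$ be an integer. If a prime graph has an induced path of length $\lceil 6.75 n^7\rceil$, then it has a vertex-minor isomorphic to the cycle $C_n$ of length $n$.
   Context: All graphs are finite, simple and undirected. The length of a path is its number of edges. For a vertex $v$ of $G$, the local complementation $G*v$ replaces the subgraph induced on the neighborhood of $v$ by its complement. A graph $H$ is a vertex-minor of $G$ if $H$ is an induced subgraph of a graph obtained from $G$ by a sequence of local complementations. A split of $G$ is a partition $(A,B)$ of $V(G)$ with $|A|,|B|\ge 2$ such that there are $A'\subseteq A$, $B'\subseteq B$ with $a\in A$ adjacent to $b\in B$ iff $a\in A'$ and $b\in B'$; $G$ is prime if it has no split. *)

(* Defs.v *)
From mathcomp Require Import all_boot.
Set Implicit Arguments. Unset Strict Implicit. Unset Printing Implicit Defensive.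

Definition simple_graph (T : finType) (g : rel T) : Prop :=
  symmetric g /\ irreflexive g.

Definition local_comp (T : finType) (g : rel T) (v : T) : rel T :=
  fun x y => if [&& g v x, g v y & x != y] then ~~ g x y else g x y.

Definition local_comps (T : finType) (g : rel T) (vs : seq T) : rel T :=
  foldl (@local_comp T) g vs.

Definition has_vertex_minor (T U : finType) (g : rel T) (h : rel U) : Prop :=
  exists (vs : seq T) (f : U -> T),
    injective f /\ forall x y, h x y = local_comps g vs (f x) (f y).

Definition is_split (T : finType) (g : rel T) (A : {set T}) : Prop :=
  [/\ 2 <= #|A|, 2 <= #|~: A| &
   exists A' B' : {set T},
     [/\ A' \subset A, B' \subset ~: A &
      forall a b, a \in A -> b \in ~: A -> g a b = (a \in A') && (b \in B')]].

Definition prime_graph (T : finType) (g : rel T) : Prop :=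
  forall A : {set T}, ~ is_split g A.

Definition has_induced_path (T : finType) (g : rel T) (L : nat) : Prop :=
  exists f : 'I_L.+1 -> T,
    injective f /\
    forall i j : 'I_L.+1, g (f i) (f j) = (i.+1 == j :> nat) || (j.+1 == i :> nat).

(* The cycle C_n on vertex set 'I_n (meaningful for n >= 3). *)
Definition cycle_graph (n : nat) : rel 'I_n :=
  fun i j => (i.+1 %% n == j) || (j.+1 %% n == i).

(* ceil(6.75 * n^7) = ceil(27 n^7 / 4) *)
Definition path_bound (n : nat) : nat := (27 * n ^ 7 + 3) %/ 4.

(* Main.v *)
Require Import Defs.
From HB Require Import structures.
From mathcomp Require Import all_boot all_algebra zify.
From Stdlib Require Import Classical FunctionalExtensionality ClassicalEpsilon.
Set Implicit Arguments. Unset Strict Implicit. Unset Printing Implicit Defensive.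

(* Ranks of cuts are over GF(2).  Up to deleting vertices and local complementation, keep
   a long induced path whose ends are linked, meaning that no cut of rank at most one
   separates them, and minimise the number of other non-isolated vertices.  One of G - v
   and G * v - v still links the ends, so an off-path vertex v is critical: deleting it
   leaves a cut of rank one that crosses the path once.  Unless a hub together with a piece
   of path already yields C_n, the neighbours of v on the path, and this crossing, lie in
   a short interval.  Critical vertices x_0, x_1, ... chosen far apart thus form a strip
   with nested cuts T_k of rank two whose rank drops when x_k is deleted.

   For each k some vector supported in T_k is mapped by the adjacency matrix to the unit
   vector at x_k, up to an error at the left end of the strip.  Vector and error have one of
   16 values there, and a symplectic form in these values computes the coordinate of the
   l-th vector at x_k.  By the pigeonhole principle the strip contains a long sequence of
   x_k's along which two values of symplectic product one alternate.  Eliminating the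
   vertices between them turns this sequence into an induced path without further
   neighbours, whose ends are connected through the two ends of the strip; a shortest
   connection closes it to a long induced cycle. *)

(** * Local complementation, deletion and cuts of rank one *)

(** Primality need not survive the removal of a vertex, so only linkedness of the two ends is
    carried along. Each end has two vertices because a cut with a single vertex on one side always
    has rank at most one. Eliminating the vertices between chosen x_k's is a Schur complement over
    GF(2): the new row of x_k is the image of a vector that contains x_k, no other survivor, and has
    zero image on the eliminated set. Sums of two strip vectors with equal values at the left end
    are such vectors, since their errors cancel. The 16 values are four bits: vector and image at
    two vertices. The obstacle is that the eliminated block may have corank one. Then one vertex of
    it survives and disturbs at most two consecutive positions of the path; a stretch half as long
    avoids it. The ends must stay connected under local complementations that are not known in
    advance, and a dimension count excludes that they fall into different components. The length
    required is cubic in n, well below the bound for n at least 4; for n = 3 a path of length two is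
    enough. *)

Section Basics.
Variable T : finType.
Implicit Types (g h : rel T) (v x y : T) (Q X Y : {set T}).

(** A deleted vertex stays in [T] as an isolated one, so that all graphs of the argument share one
    vertex type. *)
Definition del g v : rel T := fun x y => [&& g x y, x != v & y != v].

Lemma lcE g v x y :
  local_comp g v x y = g x y (+) [&& g v x, g v y & x != y].
Proof. by rewrite /local_comp; case: ifP => _; rewrite ?addbT ?addbF. Qed.

Lemma simple_lc g v : simple_graph g -> simple_graph (local_comp g v).
Proof.
case=> gs gi; split=> [x y|x]; rewrite !lcE; last by rewrite gi eqxx !andbF.
by rewrite (gs x y) (eq_sym x y) andbCA.
Qed.

Lemma simple_del g v : simple_graph g -> simple_graph (del g v).
Proof.
by case=> gs gi; split=> [x y|x]; rewrite /del ?gi // gs; congr andb; rewrite andbC.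
Qed.

Lemma simple_lcs g vs : simple_graph g -> simple_graph (local_comps g vs).
Proof. by elim: vs g => //= v vs IH g /simple_lc - /(_ v); apply: IH. Qed.

Lemma rel_ext g h : g =2 h -> g = h.
Proof. by move=> gh; do 2!apply: functional_extensionality=> ?; apply: gh. Qed.

Lemma del_del g u v : del (del g u) v = del (del g v) u.
Proof.
apply: rel_ext => a b; rewrite /del.
by case: (g a b) (a == u) (a == v) (b == u) (b == v) => [] [] [] [] [].
Qed.

Lemma lc_del g v x : v != x -> local_comp (del g x) v = del (local_comp g v) x.
Proof.
move=> vx; apply: rel_ext => y z; rewrite /del !lcE vx /=.
by case: (y == x) (z == x) => [] []; rewrite ?andbF ?andbT.
Qed.

Lemma lc_isolated g v : (forall y, g v y = false) -> local_comp g v = g.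
Proof. by move=> gv; apply: rel_ext => y z; rewrite lcE !gv addbF. Qed.

Inductive reach g : rel T -> Prop :=
| reach_refl : reach g g
| reach_lc h v : reach g h -> reach g (local_comp h v)
| reach_del h v : reach g h -> reach g (del h v).

Lemma reach_trans g h k : reach g h -> reach h k -> reach g k.
Proof. by move=> gh; elim=> // [? v _|? v _]; [apply: reach_lc|apply: reach_del]. Qed.

Lemma reach_lcs g h vs : reach g h -> reach g (local_comps h vs).
Proof. by elim: vs h => //= v vs IH h gh; apply/IH/reach_lc. Qed.

Lemma simple_reach g h : simple_graph g -> reach g h -> simple_graph h.
Proof. by move=> gg; elim=> // [? v _|? v _]; [apply: simple_lc|apply: simple_del]. Qed.

Lemma local_comps_rcons g vs v :
  local_comps g (rcons vs v) = local_comp (local_comps g vs) v.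
Proof. by rewrite /local_comps foldl_rcons. Qed.

(** Deletions can be postponed: they commute with local complementation at another vertex, and local
    complementation at a deleted vertex does nothing. *)
Lemma reach_repr g h : reach g h ->
  exists vs (D : {set T}),
    h = fun x y => [&& local_comps g vs x y, x \notin D & y \notin D].
Proof.
elim=> [|{}h v _ [vs [D ->]]|{}h v _ [vs [D ->]]].
- by exists [::], set0; apply: rel_ext => x y /=; rewrite !inE !andbT.
- case: (boolP (v \in D)) => vD.
    exists vs, D; rewrite lc_isolated // => y.
    by rewrite vD andbF.
  exists (rcons vs v), D; apply: rel_ext => x y.
  rewrite local_comps_rcons !lcE vD /=.
  by case: (x \in D) (y \in D) => [] []; rewrite ?andbF ?andbT.
exists vs, (v |: D); apply: rel_ext => x y; rewrite /del !inE !negb_or.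
by case: (x == v) (y == v) (x \in D) (y \in D) => [] [] [] []; rewrite ?andbF ?andbT.
Qed.

Lemma local_comps_del g vs x : (forall v, v \in vs -> v != x) ->
  local_comps (del g x) vs = del (local_comps g vs) x.
Proof.
elim: vs g => //= v vs IH g vx; rewrite lc_del ?IH //; last by rewrite vx ?mem_head.
by move=> u uv; rewrite vx // inE uv orbT.
Qed.

Lemma alive_lcs g vs (P : T -> bool) :
  symmetric g -> (forall u w, g u w -> P u) -> forall u w, local_comps g vs u w -> P u.
Proof.
elim: vs g => //= v vs IH g gs gP; apply: IH => u w; rewrite !lcE.
  by rewrite (gs u w) (eq_sym u w) andbCA.
case: (boolP (g u w)) => [/gP//|_ /= /and3P[]].
by rewrite gs => /gP.
Qed.

Lemma reach_avoid g h (D : {set T}) : reach g h ->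
  reach g (fun u w => [&& h u w, u \notin D & w \notin D]).
Proof.
move=> gh; have -> : (fun u w => [&& h u w, u \notin D & w \notin D]) =
    (fun u w => [&& h u w, u \notin enum D & w \notin enum D]).
  by apply: rel_ext => u w; rewrite !mem_enum.
elim: (enum D) => [|v s IH].
  suff <- : h = (fun u w => [&& h u w, u \notin [::] & w \notin [::]]) by [].
  by apply: rel_ext => u w; rewrite /= !andbT.
have -> : (fun u w => [&& h u w, u \notin v :: s & w \notin v :: s]) =
    del (fun u w => [&& h u w, u \notin s & w \notin s]) v; last exact: reach_del.
apply: rel_ext => u w; rewrite /del !inE !negb_or.
by case: (u == v) (w == v) (u \in s) (w \in s) => [] [] [] []; rewrite ?andbF ?andbT.
Qed.

(* Cut-rank at most one over GF(2). *)
Definition cutle1 g Q : Prop :=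
  exists A B : T -> bool, forall a b, a \in Q -> b \notin Q -> g a b = A a && B b.

Lemma prime_cut g Q : prime_graph g -> 2 <= #|Q| -> 2 <= #|~: Q| -> ~ cutle1 g Q.
Proof.
move=> pg Q1 Q2 [A [B AB]]; apply: (pg Q); split=> //.
exists [set a in Q | A a], [set b in ~: Q | B b]; split.
- by apply/subsetP=> a; rewrite inE => /andP[].
- by apply/subsetP=> a; rewrite inE => /andP[].
by move=> a b aQ; rewrite !inE => bQ; rewrite aQ bQ /= AB.
Qed.

(** For [v] in [Q] the row of [v] is added to the rows of its neighbours in [Q]; otherwise the same
    happens to columns. Neither raises the rank. *)
Lemma cutle1_lc g v Q : simple_graph g -> cutle1 g Q -> cutle1 (local_comp g v) Q.
Proof.
move=> [gs _] [A [B AB]]; case: (boolP (v \in Q)) => vQ.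
  exists (fun a => A a (+) (g v a && A v)), B => a b aQ bQ.
  have -> : local_comp g v a b = g a b (+) (g v a && g v b).
    by rewrite lcE; case: eqP aQ bQ => [->->|] //; rewrite ?andbT.
  by rewrite (AB a b) // (AB v b) //; case: (A a) (B b) (g v a) (A v) => [] [] [] [].
exists A, (fun b => B b (+) (g v b && B v)) => a b aQ bQ.
have ab : a != b by apply: contraNneq bQ => <-.
rewrite lcE ab andbT.
by rewrite (gs v a) (AB a b) // (AB a v) //; case: (A a) (B b) (g v b) (B v) => [] [] [] [].
Qed.

Lemma cutle1_del g v Q : cutle1 g Q -> cutle1 (del g v) Q.
Proof.
move=> [A [B AB]]; exists (fun a => A a && (a != v)), (fun b => B b && (b != v)) => a b aQ bQ.
by rewrite /del AB //; case: (A a) (B b) (a != v) (b != v) => [] [] [] [].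
Qed.

Lemma cutle1_lcs g vs Q : simple_graph g -> cutle1 g Q -> cutle1 (local_comps g vs) Q.
Proof.
by elim: vs g => //= v vs IH g sg /(cutle1_lc v sg); apply: IH; apply: simple_lc.
Qed.

Lemma lc_lc g v : simple_graph g -> local_comp (local_comp g v) v = g.
Proof.
case=> gs gi; apply: rel_ext => x y; rewrite !lcE gi /= !addbF.
by rewrite -addbA addbb addbF.
Qed.

Lemma cutle1_lcI g v Q : simple_graph g -> cutle1 (local_comp g v) Q -> cutle1 g Q.
Proof. by move=> sg /(cutle1_lc v (simple_lc v sg)); rewrite lc_lc. Qed.

(** Isolated vertices give zero rows or columns, so a cut may be changed on them freely. *)
Lemma cutle1_alive g Q Q' : simple_graph g ->
  (forall x y, g x y -> (x \in Q) = (x \in Q')) -> cutle1 g Q -> cutle1 g Q'.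
Proof.
move=> [gs gi] QQ [A [B AB]].
exists (fun a => A a && [exists y, g a y]), (fun b => B b && [exists y, g b y]) => a b aQ bQ.
case: existsP => [[y ay]|na]; last first.
  by rewrite andbF; apply/negP => ab; case: na; exists b.
case: existsP => [[z bz]|nb]; last first.
  by rewrite !andbF; apply/negP => ab; case: nb; exists a; rewrite gs.
by rewrite !andbT AB ?(QQ _ _ ay) ?(QQ _ _ bz).
Qed.

Definition linked g X Y : Prop :=
  forall Q, X \subset Q -> (forall y, y \in Y -> y \notin Q) -> ~ cutle1 g Q.

Lemma linked_lc g v X Y : simple_graph g -> linked g X Y -> linked (local_comp g v) X Y.
Proof. by move=> sg gXY Q XQ YQ /(cutle1_lcI sg); apply: gXY. Qed.

Lemma linked_lcs g vs X Y : simple_graph g -> linked g X Y -> linked (local_comps g vs) X Y.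
Proof.
by elim: vs g => //= v vs IH g sg /(linked_lc (v:=v) sg); apply: IH; apply: simple_lc.
Qed.

Lemma linked_mono g X Y X' Y' :
  X \subset X' -> Y \subset Y' -> linked g X Y -> linked g X' Y'.
Proof.
move=> XX YY gXY Q XQ YQ; apply: gXY; first exact: subset_trans XQ.
by move=> y yY; apply: YQ; apply: (subsetP YY).
Qed.

End Basics.

(** * Removing a vertex while keeping two sets linked *)

Section Removal.
Variable T : finType.
Implicit Types (g : rel T) (v x y : T) (Q X Y : {set T}).
Import GRing.Theory.
Local Open Scope ring_scope.
Local Notation V := {ffun T -> bool^o}.

Definition dlt x : V := [ffun y => y == x].

Definition supp_fun Q (R : V) : V := [ffun u => if u \in Q then 0 else R u].
Lemma supp_fun_lin Q : linear (supp_fun Q).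
Proof. by move=> a R S; apply/ffunP=> u; rewrite !ffunE; case: ifP; rewrite ?scaler0 ?addr0. Qed.
HB.instance Definition _ Q := GRing.isLinear.Build bool V V _ (supp_fun Q) (supp_fun_lin Q).
Definition supp Q : {vspace V} := lker (linfun (supp_fun Q)).

Lemma memv_supp Q (R : V) : reflect (forall u, u \notin Q -> R u = false) (R \in supp Q).
Proof.
rewrite memv_ker lfunE /=; apply: (iffP eqP) => [/ffunP e u uQ|e].
  by have := e u; rewrite !ffunE (negbTE uQ).
by apply/ffunP => u; rewrite !ffunE; case: ifPn => // /e ->.
Qed.

Definition weight (A : T -> bool) (R : V) : bool^o := \sum_r R r * A r.
Lemma weight_lin A : linear (weight A).
Proof.
move=> a R S; rewrite /weight scaler_sumr -big_split /=; apply: eq_bigr => r _.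
by rewrite !ffunE mulrDl scalerAl.
Qed.
HB.instance Definition _ A := GRing.isLinear.Build bool V bool^o _ (weight A) (weight_lin A).

Definition cpar g Q (R : V) : V :=
  [ffun u => if u \in Q then 0 else weight (g^~ u) R].
Lemma cpar_lin g Q : linear (cpar g Q).
Proof.
move=> a R S; apply/ffunP=> u; rewrite !ffunE; case: ifP; rewrite ?scaler0 ?addr0 // => _.
by rewrite linearP.
Qed.
HB.instance Definition _ g Q := GRing.isLinear.Build bool V V _ (cpar g Q) (cpar_lin g Q).

Lemma memv_cpar g Q (R : V) :
  reflect (forall u, u \notin Q -> weight (g^~ u) R = 0) (R \in lker (linfun (cpar g Q))).
Proof.
rewrite memv_ker lfunE /=; apply: (iffP eqP) => [/ffunP e u uQ|e].
  by have := e u; rewrite !ffunE (negbTE uQ).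
by apply/ffunP => u; rewrite !ffunE; case: ifPn => // /e ->.
Qed.

Lemma weight_dlt A x : weight A (dlt x) = A x.
Proof.
rewrite /weight (bigD1 x) //= big1 ?addr0 ?ffunE ?eqxx ?mul1r // => y yx.
by rewrite ffunE (negbTE yx) mul0r.
Qed.

Lemma dim_supp Q : \dim (supp Q) = #|Q|.
Proof.
pose X := [tuple dlt (enum_val i) | i < #|Q|].
have Xi (i : 'I_#|Q|) : X`_i = dlt (enum_val i) by rewrite -tnth_nth tnth_mktuple.
suff fX : free X.
  suff -> : supp Q = <<X>>%VS by rewrite (eqnP fX) size_tuple.
  apply/vspaceP => R; apply/memv_supp/idP => [RQ|/coord_span -> u uQ].
    have -> : R = \sum_(i < #|Q|) R (enum_val i) *: X`_i.
      apply/ffunP => u; rewrite sum_ffunE; case: (boolP (u \in Q)) => uQ.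
        rewrite (bigD1 (enum_rank_in uQ u)) //= Xi !ffunE enum_rankK_in // eqxx.
        rewrite [X in _ + X]big1 ?addr0 => [|i ni]; first by rewrite [RHS]mulr1.
        rewrite Xi !ffunE; have /negbTE -> : u != enum_val i; last exact: scaler0.
        by apply: contraNneq ni => ue; apply/eqP/enum_val_inj; rewrite enum_rankK_in.
      rewrite RQ // big1 // => i _; rewrite Xi !ffunE; case: eqP => [uE|_].
        by move: uQ; rewrite uE enum_valP.
      exact: scaler0.
    by rewrite rpred_sum // => i _; rewrite rpredZ // memv_span // mem_nth ?size_tuple.
  rewrite sum_ffunE big1 // => i _; rewrite Xi !ffunE; case: eqP => [uE|_].
    by move: uQ; rewrite uE enum_valP.
  exact: scaler0.
apply/freeP => k /ffunP k0 i; have := k0 (enum_val i).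
rewrite sum_ffunE ffunE (bigD1 i) //= Xi !ffunE eqxx [X in _ + X]big1 ?addr0 => [|j ni].
  by move=> <-; rewrite [RHS]mulr1.
rewrite Xi !ffunE; case: eqP => [/enum_val_inj ij|_]; first by rewrite ij eqxx in ni.
exact: scaler0.
Qed.

Lemma dim_weight_ker Q A : (#|Q| <= \dim (supp Q :&: lker (linfun (weight A))) + 1)%N.
Proof.
rewrite -(dim_supp Q) -(limg_ker_dim (linfun (weight A)) (supp Q)) leq_add2l.
by apply: leq_trans (dimvS (subvf _)) _; rewrite dimvf.
Qed.

(** By rank-nullity the cut matrix maps [supp Q] into a line; a generator of this line is the column
    factor of the cut. *)
Lemma cut_of_dim g Q (L : {vspace V}) :
  (L <= supp Q :&: lker (linfun (cpar g Q)))%VS -> (#|Q| <= \dim L + 1)%N -> cutle1 g Q.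
Proof.
set f := linfun _ => /dimvS dL dQ.
have : (\dim (f @: supp Q) <= 1)%N.
  rewrite -(leq_add2l (\dim (supp Q :&: lker f))) limg_ker_dim dim_supp.
  by apply: leq_trans dQ _; rewrite leq_add2r.
set U := (f @: supp Q)%VS => dU.
have UE : (U <= <[vpick U]>)%VS.
  case: (eqVneq U 0%VS) => [->|U0]; first exact: sub0v.
  suff /eqP {1}-> : U == <[vpick U]>%VS by [].
  by rewrite eq_sym eqEdim -memvE memv_pick dim_vline vpick0 U0.
exists (fun a => f (dlt a) != 0), (fun b => vpick U b) => a b aQ bQ.
have fab : f (dlt a) b = g a b :> bool.
  by rewrite lfunE /= ffunE (negbTE bQ) weight_dlt.
have : f (dlt a) \in U.
  apply: memv_img; apply/memv_supp => u uQ; rewrite ffunE.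
  by apply: contraNF uQ => /eqP->.
move/(subvP UE)/vlineP => [[] fE]; rewrite -fab; last first.
  by rewrite fE scale0r eqxx ffunE.
rewrite fE scale1r; case: eqP => // ->.
by rewrite ffunE.
Qed.

(* Otherwise there are cuts Q1 and Q2 of rank one in the two graphs; by submodularity one of
   Q1 :&: Q2 and v |: (Q1 :|: Q2) has rank one in g. *)
Lemma linked_removal g X Y v : simple_graph g -> linked g X Y -> v \notin X -> v \notin Y ->
  linked (del g v) X Y \/ linked (del (local_comp g v) v) X Y.
Proof.
move=> sg gXY vX vY; apply: NNPP => /not_or_and [n1 n2].
have getQ h : simple_graph h -> (forall y, h v y = false) -> ~ linked h X Y ->
  exists Q, [/\ X \subset Q, (forall y, y \in Y -> y \notin Q), v \notin Q & cutle1 h Q].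
  move=> sh hv nl; apply: NNPP => nQ; apply: nl => Q XQ YQ cQ; apply: nQ.
  exists (Q :\ v); split.
  - by apply/subsetP => x xX; rewrite !inE (subsetP XQ) // andbT; apply: contraNneq vX => <-.
  - by move=> y yY; rewrite !inE negb_and YQ ?orbT.
  - by rewrite !inE eqxx.
  apply: cutle1_alive cQ => // x y hxy; rewrite !inE.
  by case: eqP hxy => [->|] //; rewrite hv.
have [] := getQ _ (simple_del v sg) _ n1; first by move=> y; rewrite /del eqxx andbF.
move=> Q1 [XQ1 YQ1 vQ1 [A1 [B1 AB1]]].
have [] := getQ _ (simple_del v (simple_lc v sg)) _ n2; first by move=> y; rewrite /del eqxx andbF.
move=> Q2 [XQ2 YQ2 vQ2 [A2 [B2 AB2]]].
have neqv Q x : v \notin Q -> x \in Q -> x != v by move=> vQ xQ; apply: contraNneq vQ => <-.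
have gs := sg.1.
pose I := Q1 :&: Q2; pose W := v |: (Q1 :|: Q2).
have nI : ~ cutle1 g I.
  apply: gXY; first by rewrite subsetI XQ1.
  by move=> y yY; rewrite inE (negbTE (YQ1 _ yY)).
have nW : ~ cutle1 g W.
  apply: gXY; first by apply: subset_trans XQ1 _; apply/subsetP => x xQ; rewrite !inE xQ orbT.
  move=> y yY; rewrite !inE (negbTE (YQ1 _ yY)) (negbTE (YQ2 _ yY)) !orbF.
  by apply: contraNneq vY => <-.
have c1 (R : V) u : R \in (supp Q1 :&: lker (linfun (weight A1)))%VS -> u \notin Q1 -> u != v ->
    weight (g^~ u) R = 0.
  move=> /memv_capP[/memv_supp RQ]; rewrite memv_ker lfunE /= => /eqP R0 uQ uv.
  rewrite -[RHS](mul0r (B1 u : bool)) -R0 /weight mulr_suml; apply: eq_bigr => r _.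
  case: (boolP (r \in Q1)) => rQ; last by rewrite RQ // !mul0r.
  by rewrite -mulrA -[_ * B1 u]AB1 // /del uv (neqv _ _ vQ1) //= andbT.
(* [Q2] is a cut of the graph complemented at [v]; back in [g], a multiple of the row of [v] is left
   as an error. *)
have c2 (R : V) u : R \in (supp Q2 :&: lker (linfun (weight A2)))%VS -> u \notin Q2 -> u != v ->
    weight (g^~ u) R = weight (g^~ v) R * g v u.
  move=> /memv_capP[/memv_supp RQ]; rewrite memv_ker lfunE /= => /eqP R0 uQ uv.
  apply/eqP; rewrite -subr_eq0 -[0](mul0r (B2 u : bool)) -R0 /weight !mulr_suml -sumrB.
  apply/eqP/eq_bigr => r _.
  case: (boolP (r \in Q2)) => rQ; last by rewrite RQ // !mul0r subr0.
  rewrite -!mulrA -mulrBr -[_ * B2 u]AB2 //; congr (_ * _).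
  rewrite /del uv (neqv _ _ vQ2) //= andbT lcE (gs v r).
  have -> : r != u by apply: contraNneq uQ => <-.
  by case: (g r u) (g r v) (g v u) => [] [] [].
(* Adding [v] to the vectors with odd parity at [v] cancels this error. *)
pose th (R : V) : V := R + weight (g^~ v) R *: dlt v.
have th_lin : linear th.
  move=> a R S; apply/ffunP => u; rewrite !ffunE linearP /=.
  by case: a (R u) (S u) (weight _ R) (weight _ S) (u == v) => [] [] [] [] [] [].
pose thL : {linear V -> V} := HB.pack th (GRing.isLinear.Build bool V V _ th th_lin).
have thE (R : V) u : th R u = R u + weight (g^~ v) R * (u == v) by rewrite !ffunE.
pose E1 := (supp Q1 :&: lker (linfun (weight A1)))%VS.
pose F2 := (supp Q2 :&: lker (linfun (weight A2)))%VS.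
pose E2 := (linfun thL @: F2)%VS.
have dE2 : \dim E2 = \dim F2.
  apply: limg_dim_eq; apply/eqP; rewrite -subv0; apply/subvP => R /memv_capP[RF].
  rewrite memv_ker lfunE memv0 /= => /eqP/ffunP tR; apply/eqP/ffunP => u.
  have /memv_capP[/memv_supp RQ _] := RF.
  have := tR u; rewrite thE !ffunE; case: eqP => [-> _|_]; first by rewrite RQ.
  by rewrite mulr0 addr0.
have E2P R : R \in E2 -> exists2 S, S \in F2 & R = th S.
  by case/memv_imgP => S SF ->; exists S => //; rewrite lfunE.
have W1 : (E1 + E2 <= supp W :&: lker (linfun (cpar g W)))%VS.
  rewrite subv_add; apply/andP; split; apply/subvP => R RE.
    have /memv_capP[/memv_supp RQ _] := RE.
    apply/memv_capP; split; [apply/memv_supp|apply/memv_cpar] => u; rewrite !inE !negb_or.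
      by case/and3P => _ uQ _; apply: RQ.
    by case/and3P => uv uQ _; apply: c1.
  have [S SF ->] := E2P _ RE; have /memv_capP[/memv_supp SQ _] := SF.
  apply/memv_capP; split; [apply/memv_supp|apply/memv_cpar] => u; rewrite !inE !negb_or.
    by case/and3P => /negbTE uv _ uQ; rewrite thE uv SQ // mulr0.
  case/and3P => uv _ uQ; rewrite /th linearD linearZ /= weight_dlt c2 //.
  by case: (weight _ _) (g v u) => [] [].
have I1 : (E1 :&: E2 <= supp I :&: lker (linfun (cpar g I)))%VS.
  apply/subvP => R /memv_capP[RE /E2P[S SF RS]].
  have /memv_capP[/memv_supp RQ _] := RE; have /memv_capP[/memv_supp SQ _] := SF.
  have w0 : weight (g^~ v) S = 0.
    by have := RQ v vQ1; rewrite RS thE eqxx mulr1 SQ // add0r.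
  have {}RS : R = S by rewrite RS /th w0 scale0r addr0.
  apply/memv_capP; split; [apply/memv_supp|apply/memv_cpar] => u; rewrite !inE negb_and.
    by case/orP => uQ; [apply: RQ|rewrite RS; apply: SQ].
  case: (eqVneq u v) => [-> _|uv]; first by rewrite RS.
  by case/orP => uQ; [apply: c1|rewrite RS c2 // w0 mul0r].
have d1 : (\dim (E1 + E2) + 1 < #|W|)%N.
  by rewrite ltnNge; apply/negP => /(cut_of_dim W1).
have d2 : (\dim (E1 :&: E2) + 1 < #|I|)%N.
  by rewrite ltnNge; apply/negP => /(cut_of_dim I1).
(* Each of [E1] and [E2] loses at most one dimension, while [W] and [I] together have one element
   more than [Q1] and [Q2]; so not both [W] and [I] can be short by two. *)
have := dimv_sum_cap E1 E2; rewrite dE2.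
have := dim_weight_ker Q1 A1; have := dim_weight_ker Q2 A2.
have : #|W| = #|Q1 :|: Q2|.+1 by rewrite cardsU1 !inE negb_or vQ1 vQ2.
have := cardsUI Q1 Q2; rewrite -/E1 -/F2 -/I; lia.
Qed.

End Removal.

(** * A hub and a path *)

Section Fan.
Variable T : finType.
Implicit Types (g h : rel T) (v x y : T) (w : seq bool).

(** The word [w] of adjacencies between hub and path determines the configuration, and contracting
    the path acts on this word alone. *)
Definition fan_at h v (p : nat -> T) w :=
  [/\ forall i j, i < size w -> j < size w -> p i = p j -> i = j,
      forall i j, i < size w -> j < size w ->
        h (p i) (p j) = (i.+1 == j) || (j.+1 == i),
      forall i, i < size w -> p i != v
    & forall i, i < size w -> h v (p i) = nth false w i].

Definition fan g w := exists h v p, reach g h /\ fan_at h v p w.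

Lemma fan_infix g w1 w2 w3 : fan g (w1 ++ w2 ++ w3) -> fan g w2.
Proof.
case=> h [v [p [gh [inj adj nv bits]]]]; exists h, v, (fun i => p (size w1 + i)).
have lt i : i < size w2 -> size w1 + i < size (w1 ++ w2 ++ w3).
  by rewrite !size_cat; lia.
split=> //; split=> [i j /lt li /lt lj|i j /lt li /lt lj|i /lt li|i iw].
- by move/(inj _ _ li lj); lia.
- by rewrite adj //; lia.
- exact: nv.
by rewrite bits ?lt // nth_cat ltnNge leq_addr /= addKn nth_cat iw.
Qed.

(* Local complementation at the middle vertex makes its two path neighbours adjacent. *)
Lemma fan_contract g w1 a b c w2 : simple_graph g ->
  fan g (w1 ++ [:: a, b, c & w2]) -> fan g (w1 ++ [:: a (+) b, c (+) b & w2]).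
Proof.
move=> sg [h [v [p [gh [inj adj nv bits]]]]].
have [hs hi] := simple_reach sg gh.
set k := size w1; set x := p k.+1.
exists (local_comp h x), v, (fun i => p (if i <= k then i else i.+1)).
split; first exact: reach_lc.
have szo : size (w1 ++ [:: a, b, c & w2]) = k + (size w2).+3 by rewrite size_cat.
have szn : size (w1 ++ [:: a (+) b, c (+) b & w2]) = k + (size w2).+2 by rewrite size_cat.
move: inj adj nv bits; rewrite /fan_at !szo !szn => inj adj nv bits.
have sg_lt i : i < k + (size w2).+2 -> (if i <= k then i else i.+1) < k + (size w2).+3.
  by case: ifP; lia.
have xp i : i < k + (size w2).+2 -> h x (p (if i <= k then i else i.+1)) = (i == k) || (i == k.+1).
  by move=> li; rewrite adj ?sg_lt //; [case: ifP; lia|lia].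
have hxv : h x v = b.
  rewrite hs bits; last by lia.
  by rewrite nth_cat -/k ltnNge leqnSn /= subSnn.
split=> [i j li lj|i j li lj|i li|i li].
- by move/(inj _ _ (sg_lt _ li) (sg_lt _ lj)); do 2 case: ifP; lia.
- rewrite lcE !xp // adj ?sg_lt //.
  have -> : (p (if i <= k then i else i.+1) != p (if j <= k then j else j.+1)) = (i != j).
    case: (eqVneq i j) => [->|ij]; first by rewrite eqxx.
    apply/eqP => /(inj _ _ (sg_lt _ li) (sg_lt _ lj)); move: ij.
    by do 2 case: ifP; lia.
  by do 2 case: ifP; lia.
- exact/nv/sg_lt.
rewrite lcE hxv xp // (eq_sym v) nv ?sg_lt // andbT bits ?sg_lt //.
rewrite !nth_cat -/k; case: (ltngtP i k) => ik.
- by rewrite ik; case: eqP; try lia; rewrite andbF addbF.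
- have -> : (i.+1 < k) = false by lia.
  have -> : i.+1 - k = (i - k).+1 by lia.
  case: (eqVneq i k.+1) => [->|ik1]; first by rewrite subSnn /= andbT.
  have -> : i - k = (i - k).-2.+2 by lia.
  by rewrite /= andbF addbF.
by rewrite ik ltnn subnn /= andbT.
Qed.

(** Contracting at a nonneighbour of the hub changes no other bit; at an end of the path the vertex
    is just cut off. *)
Lemma fan_drop0 g w1 w2 : simple_graph g -> fan g (w1 ++ false :: w2) -> fan g (w1 ++ w2).
Proof.
move=> sg; case/lastP: w1 => [|w1 a].
  by rewrite -[false :: w2]/([:: false] ++ w2) => f; apply: (@fan_infix g [:: false] w2 [::]); rewrite cats0.
case: w2 => [|c w2]; first by rewrite cats0 -[_ ++ _]/([::] ++ _ ++ _) => /fan_infix.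
rewrite !cat_rcons => /(fan_contract sg).
by rewrite !addbF.
Qed.

Lemma fan_ones g w : simple_graph g -> fan g w -> fan g (nseq (count id w) true).
Proof.
move=> sg; suff main w1 : fan g (w1 ++ w) -> fan g (w1 ++ nseq (count id w) true) by apply: (main [::]).
elim: w w1 => [|[] w IH] w1 //=; last by move/(fan_drop0 sg)/IH.
by rewrite -cat_rcons => /IH; rewrite cat_rcons.
Qed.

(** Contracting the middle of three ones leaves two zeros. The outermost ones are spared. *)
Lemma fan_zeros g t : simple_graph g -> fan g (nseq (3 * t + 2) true) ->
  fan g (true :: nseq (2 * t) false ++ [:: true]).
Proof.
move=> sg ft.
suff main s : s <= t -> fan g (true :: nseq (2 * s) false ++ nseq (3 * (t - s)) true ++ [:: true]).
  by have := main t (leqnn t); rewrite subnn.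
elim: s => [_|s IH st].
  rewrite subn0 /=; suff <- : nseq (3 * t + 2) true = true :: nseq (3 * t) true ++ [:: true] by [].
  by rewrite addn2 -addn1 /= nseqD.
have -> : true :: nseq (2 * s.+1) false ++ nseq (3 * (t - s.+1)) true ++ [:: true]
  = (true :: nseq (2 * s) false) ++ [:: true (+) true, true (+) true & nseq (3 * (t - s.+1)) true ++ [:: true]].
  by rewrite mulnS addnC nseqD /= -!catA.
apply: fan_contract => //; have := IH (ltnW st).
by have -> : 3 * (t - s) = 3 + 3 * (t - s.+1) by lia.
Qed.

(** Surplus zeros are contracted away, and hub and path form the cycle. None of its vertices is
    isolated, so all of them escaped the deletions and induce the cycle in a graph locally
    equivalent to [g]. *)
Lemma fan_cycle g k n : simple_graph g -> fan g (true :: nseq k false ++ [:: true]) ->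
  3 <= n <= k + 3 -> has_vertex_minor g (@cycle_graph n).
Proof.
move=> sg fk /andP[n3 nk].
have {fk nk} : fan g (true :: nseq (n - 3) false ++ [:: true]).
  have : n - 3 <= k by lia.
  elim: k fk {nk} => [|k IH] fk nk; first by have -> : n - 3 = 0 by lia.
  case: (eqVneq (n - 3) k.+1) => [->|neq] //; apply: IH; last by lia.
  exact: (@fan_drop0 g [:: true]).
case=> h [v [p [gh [inj adj nv bits]]]].
have [hs hi] := simple_reach sg gh.
have szw : size (true :: nseq (n - 3) false ++ [:: true]) = n.-1.
  by rewrite /= size_cat size_nseq /=; lia.
move: inj adj nv bits; rewrite !szw => inj adj nv bits.
have {}bits i : i < n.-1 -> h v (p i) = (i == 0) || (i == n.-2).
  move=> li; rewrite bits //; case: i li => [|i] li //=.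
  rewrite nth_cat size_nseq; case: ltnP => ltk; first by rewrite nth_nseq ltk; lia.
  have -> : i - (n - 3) = 0 by lia.
  by rewrite /=; lia.
pose F i : T := if i == 0 then v else p i.-1.
have Fh i j : i < n -> j < n -> h (F i) (F j) =
    ((if i.+1 == n then 0 else i.+1) == j) || ((if j.+1 == n then 0 else j.+1) == i).
  rewrite /F => li lj; case: (eqVneq i 0) => i0; case: (eqVneq j 0) => j0.
  - by rewrite hi i0 j0; case: ifP; lia.
  - by rewrite bits ?i0; [do 2 case: ifP; lia|lia].
  - by rewrite hs bits ?j0; [do 2 case: ifP; lia|lia].
  - by rewrite adj; [do 2 case: ifP; lia|lia|lia].
pose f (i : 'I_n) : T := F i.
have modE (i : 'I_n) : i.+1 %% n = if i.+1 == n then 0 else i.+1.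
  case: eqP => [->|ne]; first exact: modnn.
  by rewrite modn_small //; have := ltn_ord i; lia.
have fh (i j : 'I_n) : h (f i) (f j) = cycle_graph i j by rewrite /cycle_graph !modE Fh.
have [vs [D hE]] := reach_repr gh.
have fD i : f i \notin D.
  have : [exists j, h (f i) (f j)].
    have lt : (i.+1 %% n) < n by rewrite ltn_mod; lia.
    by apply/existsP; exists (Ordinal lt); rewrite fh /cycle_graph /= eqxx.
  by case/existsP => j; rewrite hE => /and3P[].
exists vs, f; split=> [i j|i j].
  move: (ltn_ord i) (ltn_ord j) => li lj; rewrite /f /F.
  case: (eqVneq (i : nat) 0) => i0; case: (eqVneq (j : nat) 0) => j0.
  - by move=> _; apply: val_inj; rewrite /= i0 j0.
  - by move=> e; case/eqP: (nv j.-1 ltac:(lia)).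
  - by move=> e; case/eqP: (nv i.-1 ltac:(lia)).
  - by move/inj => e; apply: val_inj => /=; have := e ltac:(lia) ltac:(lia); lia.
by rewrite -fh hE !fD !andbT.
Qed.

End Fan.

(** * Parity vectors *)

Section Pivot.
Variable T : finType.
Implicit Types (g h : rel T) (u v w x y : T) (D : {set T}) (R S U L : T -> bool).

(* Vectors over GF(2) are predicates; [par g R] is the product of R with the adjacency matrix. *)
Definition par g R u := \big[addb/false]_r (R r && g r u).

Lemma par_add g R S u : par g (fun x => R x (+) S x) u = par g R u (+) par g S u.
Proof. by rewrite /par -big_split /=; apply: eq_bigr => r _; rewrite andb_addl. Qed.

Lemma par_ext g R S : R =1 S -> par g R =1 par g S.
Proof. by move=> RS u; apply: eq_bigr => r _; rewrite RS. Qed.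

Lemma big_addb1 R x : (forall y, y != x -> R y = false) -> \big[addb/false]_r R r = R x.
Proof. by move=> R0; rewrite (bigD1 x) //= big1 ?addbF. Qed.

Lemma par1 g c x u : par g (fun y => (y == x) && c) u = c && g x u.
Proof. by rewrite /par (@big_addb1 _ x) ?eqxx // => y /negbTE->. Qed.

Lemma par_dot g R S : symmetric g ->
  \big[addb/false]_u (par g R u && S u) = \big[addb/false]_u (par g S u && R u).
Proof.
move=> gs; rewrite /par; under eq_bigr do rewrite big_distrl /=.
rewrite exchange_big /=; apply: eq_bigr => r _; rewrite big_distrl /=.
by apply: eq_bigr => u _; rewrite (gs u r); case: (R r) (S u) (g r u) => [] [] [].
Qed.

(** The pairs of a vector and its image form a Lagrangian space (an isotropic system). Local
    complementation acts on single coordinates: at [v] the image is added to the vector, at the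
    neighbours of [v] the vector is added to the image. *)
Lemma par_lc g v R u : simple_graph g ->
  par (local_comp g v) (fun x => R x (+) ((x == v) && par g R v)) u =
    par g R u (+) (R u && g v u).
Proof.
move=> [gs gi]; rewrite par_add par1 lcE gi /= addbF.
have -> : par (local_comp g v) R u = par g R u (+) (par g R v && g v u) (+) (R u && g v u).
  have -> : R u && g v u = \big[addb/false]_r ((R r && g v u) && (r == u)).
    by rewrite (@big_addb1 _ u) ?eqxx ?andbT // => y /negbTE->; rewrite andbF.
  rewrite /par big_distrl -!big_split /=; apply: eq_bigr => r _.
  rewrite lcE (gs v r); case: (eqVneq r u) => [->|_].
    by rewrite (gs u v); case: (R u) (g u u) (g v u) => [] [] [].
  by case: (R r) (g r u) (g r v) (g v u) => [] [] [] [].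
by case: (par g R u) (par g R v) (R u) (g v u) => [] [] [] [].
Qed.

Lemma par_lcK g v S u : simple_graph g ->
  par g (fun x => S x (+) ((x == v) && par (local_comp g v) S v)) u =
    par (local_comp g v) S u (+) (S u && g v u).
Proof.
move=> sg; have := par_lc v S u (simple_lc v sg).
by rewrite lc_lc // => ->; rewrite lcE sg.2 addbF.
Qed.

(* [L u] records which of two Pauli bases is measured at u: the vectors surviving the
   measurement of D are those with vanishing (L = 0) or self-equal (L = 1) parity on D. *)
Definition kills g D L R := forall u, u \in D -> par g R u = L u && R u.

Definition nonsing g D L := forall R,
  (forall x, x \notin D -> R x = false) -> kills g D L R -> forall x, R x = false.

Lemma pivot_out g D L : simple_graph g -> nonsing g D L ->
  exists vs d, (forall v, v \in vs -> v \in D) /\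
    forall U, (forall x, x \in D -> U x = false) ->
      exists R, [/\ forall x, x \notin D -> R x = U x, kills g D L R &
        forall w, w \notin D -> par (local_comps g vs) U w = par g R w (+) (d w && U w)].
Proof.
have [n] := ubnP #|D|; elim: n => // n IH in g D L * => Dn sg ns.
(* A vertex with label one is eliminated by a single local complementation, which flips the labels
   of its neighbours. *)
have stepA g' L' u : simple_graph g' -> nonsing g' D L' -> u \in D -> L' u ->
  exists vs d, (forall v, v \in vs -> v \in D) /\
    forall U, (forall x, x \in D -> U x = false) ->
      exists R, [/\ forall x, x \notin D -> R x = U x, kills g' D L' R &
        forall w, w \notin D -> par (local_comps g' vs) U w = par g' R w (+) (d w && U w)].
  move=> {sg ns} sg ns uD Lu; pose g1 := local_comp g' u.
  have back S : S u = false -> kills g1 (D :\ u) (fun x => L' x (+) g' u x) S ->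
      kills g' D L' (fun x => S x (+) ((x == u) && par g1 S u)).
    move=> Su kS x xD; rewrite par_lcK //; case: (eqVneq x u) => [->|xu] /=.
      by rewrite Su Lu sg.2 addbF.
    by rewrite kS ?inE ?xu //= addbF; case: (L' x) (S x) (g' u x) => [] [] [].
  have [|||vs [d [vsD H]]] := IH g1 (D :\ u) (fun x => L' x (+) g' u x).
  - by rewrite [#|D|](cardsD1 u) uD in Dn; lia.
  - exact: simple_lc.
  - move=> S S0 kS x; have Su : S u = false by rewrite S0 // !inE eqxx.
    have R0 := ns _ _ (back S Su kS).
    have {R0} := R0 _ x; case: (eqVneq x u) => [->|xu]; first by rewrite Su.
    rewrite /= addbF; apply=> y yD; rewrite S0 ?inE ?negb_and ?yD ?orbT //.
    by case: eqP yD => // ->; rewrite uD.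
  exists (u :: vs), (fun w => d w (+) g' u w); split=> [v|U UD].
    by rewrite inE => /predU1P[->//|/vsD]; rewrite inE => /andP[].
  have [|S [SU kS E]] := H U; first by move=> x; rewrite inE => /andP[_]; apply: UD.
  have Su : S u = false by rewrite SU ?inE ?eqxx // UD.
  exists (fun x => S x (+) ((x == u) && par g1 S u)); split=> [x xD||w wD].
  - have xu : x != u by apply: contraNneq xD => ->.
    by rewrite (negbTE xu) addbF SU // inE negb_and xD orbT.
  - exact: back.
  have wD1 : w \notin D :\ u by rewrite inE negb_and wD orbT.
  rewrite /= E // par_lcK // SU //.
  by case: (par _ _ _) (d w) (U w) (g' u w) => [] [] [] [].
case: (boolP [exists u in D, L u]) => [/exists_inP[u uD Lu]|/exists_inPn nL].
  exact: (stepA g L u).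
have {}nL u : u \in D -> L u = false by move/nL/negbTE.
case: (set_0Vmem D) => [D0|[u uD]].
  exists [::], (fun=> false); split=> // U _; exists U; split=> // [x|w _]; first by rewrite D0 inE.
  by rewrite addbF.
(* With all labels zero, [u] has a neighbour [w] in [D], as its indicator vector would otherwise
   contradict [nonsing]; complementing at [w] gives [u] the label one. *)
have [w wD uw] : exists2 w, w \in D & g u w.
  apply/exists_inP; case: exists_inP => // nw; have := ns (fun x => (x == u) && true).
  case/(_ _ _ u)/negP; last by rewrite eqxx.
  - by move=> x; case: eqP => // ->; rewrite uD.
  - move=> x xD; rewrite par1 nL //=; apply/negP => ux; apply: nw; by exists x.
pose g1 := local_comp g w.
have back S : kills g1 D (fun x => L x (+) g w x) S -> par g1 S w = false /\ kills g D L S.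
  move=> kS; have p0 : par g1 S w = false by rewrite kS // nL // sg.2.
  split=> // x xD; have := par_lcK w S x sg; rewrite p0.
  rewrite (@par_ext g _ S) => [->|y]; last by rewrite andbF addbF.
  by rewrite kS // nL //; case: (S x) (g w x) => [] [].
have [||||vs [d [vsD H]]] := stepA g1 (fun x => L x (+) g w x) u.
- exact: simple_lc.
- by move=> S S0 /back[_ kS]; apply: ns.
- by [].
- by rewrite nL // sg.1 uw.
exists (w :: vs), (fun x => d x (+) g w x); split=> [v|U UD].
  by rewrite inE => /predU1P[->//|/vsD].
have [R [RU /back[p0 kR] E]] := H U UD; exists R; split=> // x xD.
rewrite /= E //; have := par_lcK w R x sg; rewrite p0.
rewrite (@par_ext g _ R) => [->|y]; last by rewrite andbF addbF.
by rewrite RU //; case: (par _ _ _) (d x) (U x) (g w x) => [] [] [] [].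
Qed.

End Pivot.

(** * Choice, pigeonholes and alternating subsequences *)

Lemma fchoice A B (P : A -> B -> Prop) :
  (forall a, exists b, P a b) -> exists f, forall a, P a (f a).
Proof.
move=> H; exists (fun a => proj1_sig (constructive_indefinite_description _ (H a))) => a.
exact: proj2_sig.
Qed.

Lemma pigeon (C : finType) (c : nat -> C) (s : seq nat) q :
  #|C| * q < size s -> exists col, q < size [seq i <- s | c i == col].
Proof.
move=> sq; apply: NNPP => nq; move: sq; apply/negP; rewrite -leqNgt.
have -> : size s = \sum_(col : C) count (fun i => c i == col) s.
  elim: s {nq} => [|i s IH] /=; first by rewrite big1.
  by rewrite big_split /= -IH (bigD1 (c i)) //= eqxx big1 // => col; rewrite eq_sym => /negbTE->.
rewrite -sum_nat_const; apply: leq_sum => col _.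
by rewrite leqNgt -size_filter; apply/negP => lt; apply: nq; exists col.
Qed.

(** Two pigeonholes: some colour [f] recurs often, and among the separators picked between its
    consecutive occurrences some colour [e] recurs often. Interleaving them gives the
    alternation. *)
Lemma alternation (C : finType) (Q : nat -> C) (anti : rel C) m q :
  (forall k l, 0 < k -> k < l -> l <= m -> Q k = Q l ->
     exists2 s, k < s < l & anti (Q s) (Q k)) ->
  0 < q -> #|C| * (#|C| * q.-1).+1 < m ->
  exists f e (i : nat -> nat),
    [/\ anti e f, forall j, j.+1 < q.*2 -> i j < i j.+1,
        forall j, j < q.*2 -> 0 < i j <= m
      & forall j, j < q.*2 -> Q (i j) = if odd j then e else f].
Proof.
move=> sep q0 mq; have [|f] := @pigeon _ Q (iota 1 m) (#|C| * q.-1).+1.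
  by rewrite size_iota.
set y := filter _ _ => ysz.
have ys : sorted ltn y by apply: sorted_filter (iota_ltn_sorted _ _) => ? ? ?; apply: ltn_trans.
have yin t : t < size y -> 0 < nth 0 y t <= m /\ Q (nth 0 y t) = f.
  by move=> ty; have := mem_nth 0 ty; rewrite mem_filter mem_iota => /andP[/eqP-> ?]; split=> //; lia.
have ymon s t : s < t -> t < size y -> nth 0 y s < nth 0 y t.
  by move=> st ty; apply: (sorted_ltn_nth ltn_trans 0 ys); rewrite ?inE; lia.
have [s sP] : exists s : nat -> nat, forall t, t.+1 < size y ->
    nth 0 y t < s t < nth 0 y t.+1 /\ anti (Q (s t)) f.
  apply: (@fchoice _ _ (fun t s => t.+1 < size y -> nth 0 y t < s < nth 0 y t.+1 /\ anti (Q s) f)).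
  move=> t; case: (ltnP t.+1 (size y)) => ty; last by exists 0.
  have [y1 Q1] := yin t (ltnW ty); have [y2 Q2] := yin _ ty.
  have [||||r r1 r2] := sep (nth 0 y t) (nth 0 y t.+1); try lia.
  - exact: ymon.
  - by rewrite Q1 Q2.
  by exists r; rewrite -Q1.
have [|e] := @pigeon _ (Q \o s) (iota 0 (size y).-1) q.-1; first by rewrite size_iota; lia.
set J := filter _ _ => Jsz.
have Js : sorted ltn J by apply: sorted_filter (iota_ltn_sorted _ _) => ? ? ?; apply: ltn_trans.
have Jin t : t < q -> (nth 0 J t).+1 < size y /\ Q (s (nth 0 J t)) = e.
  move=> tq; have tJ : t < size J by lia.
  by have := mem_nth 0 tJ; rewrite mem_filter mem_iota => /andP[/eqP/=-> ?]; split=> //; lia.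
have Jmon t : t.+1 < q -> nth 0 J t < nth 0 J t.+1.
  by move=> tq; apply: (sorted_ltn_nth ltn_trans 0 Js); rewrite ?inE; lia.
exists f, e, (fun j => if odd j then s (nth 0 J j./2) else nth 0 y (nth 0 J j./2)).
split=> [|j jq|j jq|j jq].
- by have [J0 <-] := Jin 0 q0; case: (sP _ J0).
- rewrite /= uphalf_half; case: (boolP (odd j)) => oj /=.
    have j2 : j./2.+1 < q by lia.
    have [J1 _] := Jin _ (ltnW j2); have [J2 _] := Jin _ j2.
    have [/andP[_ s2] _] := sP _ J1; rewrite add1n; apply: leq_trans s2 _.
    have := Jmon _ j2; rewrite leq_eqVlt => /predU1P[->//|lt]; apply/ltnW/ymon => //; lia.
  have j2 : j./2 < q by lia.
  by rewrite add0n; have [J1 _] := Jin _ j2; have [/andP[]] := sP _ J1.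
- have j2 : j./2 < q by lia.
  have [J1 _] := Jin _ j2; have [y1 _] := yin _ (ltnW J1); have [y2 _] := yin _ J1.
  have [/andP[s1 s2] _] := sP _ J1.
  by case: ifP => _ //; lia.
have j2 : j./2 < q by lia.
have [J1 JE] := Jin _ j2; have [_ y1] := yin _ (ltnW J1).
by case: ifP.
Qed.

(** * Strips *)

Section StripVectors.
Variables (T : finType) (g : rel T) (m : nat) (Q0 Y : {set T}) (x : nat -> T).

Definition Tk k := Q0 :|: [set y in map x (iota 0 k)].

Lemma TkP k y : reflect (y \in Q0 \/ exists2 i, i < k & y = x i) (y \in Tk k).
Proof.
rewrite !inE; apply: (iffP orP) => -[|]; try by left.
  by case/mapP => i; rewrite mem_iota => /= ik ->; right; exists i.
by case=> i ik ->; right; apply: map_f; rewrite mem_iota.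
Qed.

Lemma Tk_sub k l : k <= l -> Tk k \subset Tk l.
Proof.
move=> kl; apply/subsetP => y /TkP[yQ|[i ik ->]]; apply/TkP; first by left.
by right; exists i => //; apply: leq_trans kl.
Qed.

Definition cutk h k := cutle1 (del h (x k)) (Tk k).

(* The middle of a strip of cut-rank two: x k is responsible for the second dimension of
   the k-th cut. *)
Record strip : Prop := Strip {
  st_simple : simple_graph g;
  st_inj : forall i j, i <= m.+1 -> j <= m.+1 -> x i = x j -> i = j;
  st_Q0 : forall i, i <= m.+1 -> x i \notin Q0;
  st_YQ0 : forall y, y \in Y -> y \notin Q0;
  st_last : x m.+1 \in Y;
  st_Y : forall i, i <= m -> x i \notin Y;
  st_linked : linked g (Tk 1) Y;
  st_cut : forall k, k <= m.+1 -> cutk g k;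
  st_alive : forall u w, g u w -> (u \in Tk m.+1) || (u \in Y) }.

Hypothesis S : strip.
Local Notation sg := (st_simple S).
Local Notation xinj := (st_inj S).
Local Notation xQ0 := (st_Q0 S).
Local Notation YQ0 := (st_YQ0 S).
Local Notation xnY := (st_Y S).
Local Notation lk := (st_linked S).
Local Notation ck := (st_cut S).

Lemma xTk i k : i <= m.+1 -> k <= m.+2 -> (x i \in Tk k) = (i < k).
Proof.
move=> im km; apply/TkP/idP => [[xi|[j jk xij]]|ik]; last by right; exists i.
  by rewrite (negbTE (xQ0 im)) in xi.
by rewrite (xinj im _ xij) //; lia.
Qed.

Lemma TkS k y : (y \in Tk k.+1) = (y == x k) || (y \in Tk k).
Proof.
apply/TkP/predU1P => [[yQ|[i]]|[->|/TkP[yQ|[i ik ->]]]].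
- by right; apply/TkP; left.
- rewrite ltnS leq_eqVlt => /predU1P[-> ->|ik ->]; first by left.
  by right; apply/TkP; right; exists i.
- by right; exists k.
- by left.
- by right; exists i => //; apply: ltnW.
Qed.

Lemma YTk k y : k <= m.+1 -> y \in Y -> y \notin Tk k.
Proof.
move=> km yY; apply/negP => /TkP[yQ|[i ik yi]]; first by rewrite (negbTE (YQ0 yY)) in yQ.
by move: yY; rewrite yi (negbTE (xnY _)) //; lia.
Qed.

Lemma ncut h k : linked h (Tk 1) Y -> 0 < k <= m.+1 -> ~ cutle1 h (Tk k).
Proof.
move=> lk /andP[k0 km]; apply: lk; first exact: Tk_sub.
by move=> y; apply: YTk.
Qed.

Lemma cutkE h k : cutk h k -> k <= m.+1 ->
  exists A B : T -> bool, forall a b, a \in Tk k -> b \notin Tk k.+1 -> h a b = A a && B b.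
Proof.
case=> A [B AB] km; exists A, B => a b aT; rewrite TkS negb_or => /andP[bx bT].
rewrite -AB // /del bx andbT; suff -> : a != x k by rewrite andbT.
by apply: contraTneq aT => ->; rewrite xTk // ?ltnn //; lia.
Qed.

(** Were the column of [x k] zero, the cut at [Tk k] would have rank one even with [x k] present,
    against linkedness. [right_nbr] argues alike with the row of [x k] in the next cut. *)
Lemma left_nbr h k : linked h (Tk 1) Y -> cutk h k -> 0 < k <= m.+1 ->
  exists2 r, r \in Tk k & h r (x k).
Proof.
move=> lk ck km; apply: NNPP => nr; apply: (ncut lk km).
have [|A [B AB]] := cutkE ck; first by lia.
exists A, (fun b => (b != x k) && B b) => a b aT bT.
case: eqP => [->|/eqP bx]; last by rewrite AB // TkS negb_or bx.
by rewrite andbF; apply/negP => ax; apply: nr; exists a.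
Qed.

Lemma right_nbr h k : linked h (Tk 1) Y -> cutk h k -> k <= m ->
  exists2 r, r \notin Tk k.+1 & h (x k) r.
Proof.
move=> lk ck km; apply: NNPP => nr; apply: (@ncut h k.+1 lk); first by lia.
have [|A [B AB]] := cutkE ck; first by lia.
exists (fun a => (a != x k) && A a), B => a b; rewrite {1}TkS => /predU1P[->|aT] bT.
  by rewrite eqxx; apply/negP => ax; apply: nr; exists b.
rewrite AB //; suff -> : a != x k by [].
by apply: contraTneq aT => ->; rewrite xTk // ?ltnn //; lia.
Qed.

(** Deleting the column of [x k] lowers the rank of the cut, so this column is independent of the
    others; one or two rows then combine to zero everywhere except at [x k]. *)
Lemma raw_vector k : 0 < k <= m -> exists R : T -> bool,
  (forall r, R r -> r \in Tk k) /\ forall w, w \notin Tk k -> par g R w = (w == x k).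
Proof.
move=> km; have kc : k <= m.+1 by lia.
have [A [B AB]] := cutkE (ck kc) kc.
have ABk a b : a \in Tk k -> b \notin Tk k -> b != x k -> g a b = A a && B b.
  by move=> aT bT bx; rewrite AB // TkS negb_or bx.
have nc : ~ cutle1 g (Tk k) by apply: (ncut lk); lia.
case: (boolP [exists r in Tk k, g r (x k) && ~~ A r]) => [/exists_inP[r rT /andP[rx nA]]|/exists_inPn n1].
  exists (fun y => (y == r) && true); split=> [y|w wT]; first by case: eqP => // ->.
  by rewrite par1; case: (eqVneq w (x k)) => [->|wx] //=; rewrite ABk // (negbTE nA).
case: (boolP [exists r in Tk k, g r (x k)]) => [/exists_inP[r rT rx]|/exists_inPn n2]; last first.
  case: nc; exists A, (fun b => (b != x k) && B b) => a b aT bT.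
  case: (eqVneq b (x k)) => [->|bx] /=; last exact: ABk.
  by rewrite andbF; apply/negbTE/n2.
case: (boolP [exists r' in Tk k, A r' && ~~ g r' (x k)]) => [/exists_inP[r' rT' /andP[A' nx]]|/exists_inPn n3].
  exists (fun y => ((y == r) && true) (+) ((y == r') && true)); split=> [y /=|w wT].
    by case: (eqVneq y r) => [->|_] //=; case: (eqVneq y r') => [->|_].
  rewrite par_add !par1 /=; case: (eqVneq w (x k)) => [->|wx]; first by rewrite rx (negbTE nx).
  have Ar : A r by have := n1 r rT; rewrite rx /= negbK.
  by rewrite !ABk // Ar A' addbb.
case: nc; exists A, (fun b => (b == x k) || B b) => a b aT bT.
case: (eqVneq b (x k)) => [->|bx] /=; last exact: ABk.
by have := n1 a aT; have := n3 a aT; case: (g a (x k)) (A a) => [] [].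
Qed.

(** The parities at [x j] for j = k - 1, ..., 1 are cleared by adding the vector of index j, which
    has no further parity outside [Tk 1]. *)
Lemma norm_vector k : 0 < k <= m -> exists R : T -> bool,
  (forall r, R r -> r \in Tk k) /\ forall w, w \notin Tk 1 -> par g R w = (w == x k).
Proof.
have [N] := ubnP k; elim: N => // N IH in k * => kN km.
suff main d : d < k -> exists R : T -> bool,
    (forall r, R r -> r \in Tk k) /\ forall w, w \notin Tk (k - d) -> par g R w = (w == x k).
  have [|R [RT RE]] := main k.-1; first by lia.
  by exists R; split=> // w wT; apply: RE; have -> : k - k.-1 = 1 by lia.
elim: d => [_|d IHd dk]; first by rewrite subn0; apply: raw_vector.
have [R [RT RE]] := IHd (ltnW dk); set j := k - d.+1.
have jE : k - d = j.+1 by lia.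
have [||S' [ST SE]] := IH j; try lia.
exists (fun y => R y (+) (par g R (x j) && S' y)); split=> [r|w wT].
  case Rr : (R r); first by move=> _; apply: RT.
  by move=> /andP[_ /ST]; apply: (subsetP (Tk_sub _)); lia.
rewrite par_add; have -> : par g (fun y => par g R (x j) && S' y) w = par g R (x j) && par g S' w.
  by rewrite /par big_distrr /=; apply: eq_bigr => r _; rewrite -andbA.
have w1 : w \notin Tk 1 by apply: contra wT; apply: (subsetP (Tk_sub _)); lia.
rewrite SE //; case: (eqVneq w (x j)) => [->|wj].
  rewrite andbT addbb; apply/esym/negbTE/eqP => /xinj e; have := e ltac:(lia) ltac:(lia); lia.
by rewrite andbF addbF RE // jE TkS negb_or wj.
Qed.

(* Replacing the part of a vector inside Q0 by its projection to a single vertex alpha is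
   possible because the rows of Q0 outside Tk 1 are all proportional. *)
Lemma strip_vectors : exists (al : T) (A0 B0 : T -> bool) (R_ : nat -> T -> bool),
  [/\ al \in Q0, A0 al,
      forall a b, a \in Q0 -> b \notin Tk 1 -> g a b = A0 a && B0 b
    & forall k, 0 < k <= m ->
       (forall r, R_ k r -> r = al \/ exists2 i, i < k & r = x i) /\
       forall w, w \notin Tk 1 -> par g (R_ k) w = (w == x k)].
Proof.
have [A0 [B0 AB0]] := cutkE (ck (leq0n _)) (leq0n _).
have inQ a : (a \in Tk 0) = (a \in Q0) by rewrite !inE in_nil orbF.
have [al alQ Aal] : exists2 al, al \in Q0 & A0 al.
  apply: NNPP => nal; apply: (@ncut g 1 lk) => //.
  exists (fun a => a == x 0), (g (x 0)) => a b; rewrite TkS inQ => /predU1P[->|aQ] bT.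
    by rewrite eqxx.
  rewrite AB0 ?inQ //; have -> : A0 a = false by apply/negP => Aa; apply: nal; exists a.
  by apply/esym/negbTE; rewrite negb_and; apply/orP; left; apply: contraTneq aQ => ->; apply: xQ0.
exists al, A0, B0; have [|R_ HR] := @fchoice nat (T -> bool) (fun k R => 0 < k <= m ->
       (forall r, R r -> r = al \/ exists2 i, i < k & r = x i) /\
       forall w, w \notin Tk 1 -> par g R w = (w == x k)); last first.
  by exists R_; split=> // a b aQ; apply: AB0; rewrite inQ.
move=> k; case: (boolP (0 < k <= m)) => km; last by exists (fun=> false).
have [R [RT RE]] := norm_vector km.
pose c := \big[addb/false]_(r in Q0) (R r && A0 r).
exists (fun r => (if r \in Q0 then false else R r) (+) ((r == al) && c)) => _; split=> [r|w wT].
  case: (eqVneq r al) => [->|ral] /=; first by left.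
  by rewrite addbF; case: ifP => // rQ /RT/TkP[|]; [rewrite rQ|right].
rewrite par_add par1 AB0 ?inQ // Aal /= -RE // /par (bigID (mem Q0)) /=.
rewrite [in RHS](bigID (mem Q0)) /= big1 ?addFb => [|r ->] //.
rewrite addbC; congr addb; last by apply: eq_bigr => r /negbTE->.
by rewrite /c big_distrl /=; apply: eq_bigr => r rQ; rewrite AB0 ?inQ // andbA.
Qed.

(* Triangularity: a vector with no parity beyond Tk a.+1 has no support there either. *)
Lemma no_tail a (R : T -> bool) : a <= m -> (forall r, R r -> r \in Tk m.+1) ->
  (forall w, w \notin Tk a.+1 -> par g R w = false) ->
  forall s, a < s <= m -> R (x s) = false.
Proof.
move=> am RT R0 s; have [N] := ubnP (m - s); elim: N => // N IH in s * => sN sm.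
apply/negP => Rs; have sc : s <= m.+1 by lia.
have [A [B AB]] := cutkE (ck sc) sc.
(* If [x s] were in [R], the vanishing image would make its row equal to [c] times [B] beyond
   [Tk s.+1], and this cut would have rank one. *)
pose c := \big[addb/false]_r ((R r && (r \in Tk s)) && A r).
apply: (@ncut g s.+1 lk); first by lia.
exists (fun a => if a == x s then c else A a), B => r w; rewrite TkS => rT wT.
case: eqP rT => [-> _|_ /= rT]; last exact: AB.
have : par g R w = (c && B w) (+) g (x s) w.
  have -> : g (x s) w = \big[addb/false]_r ((r == x s) && g (x s) w).
    by rewrite (@big_addb1 _ _ (x s)) ?eqxx // => y /negbTE->.
  rewrite /c big_distrl -big_split /=; apply: eq_bigr => y _.
  case: (eqVneq y (x s)) => [->|yx] /=; first by rewrite Rs xTk ?ltnn ?andbF //; lia.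
  rewrite addbF; case: (boolP (y \in Tk s)) => yT; first by rewrite AB // andbT andbA.
  rewrite andbF /=; apply/negP => /andP[Ry _]; have /TkP[yQ|[i im yi]] := RT _ Ry.
    by case/negP: yT; apply/TkP; left.
  have si : s < i.
    move: yT yx; rewrite yi xTk; try lia.
    by move=> i1 /eqP ne; case: (eqVneq i s) => [e|]; [rewrite e in ne|lia].
  by move: Ry; rewrite yi IH //; lia.
rewrite R0; last by apply: contra wT; apply: (subsetP (Tk_sub _)); lia.
by case: (c && B w) (g (x s) w) => [] [].
Qed.

End StripVectors.

(** * Closing a path to an induced cycle *)

Section Closing.
Variable T : finType.
Implicit Types (g h e : rel T).

Lemma shortest_path e (a b : T) : connect e a b -> exists s,
  [/\ path e a s, last a s = b, uniq (a :: s)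
    & forall i j, i < j -> j <= size s -> e (nth a (a :: s) i) (nth a (a :: s) j) -> j = i.+1].
Proof.
move=> cab; pose P n := [exists s : n.-tuple T, path e a s && (last a s == b)].
have exP : exists n, P n.
  case/connectP: cab => s ps bE; exists (size s); apply/existsP; exists (in_tuple s).
  by rewrite ps bE eqxx.
case: (ex_minnP exP) => n /existsP[s /andP[ps /eqP ls]] nmin.
have min s' : path e a s' -> last a s' = b -> n <= size s'.
  move=> ps' ls'; apply: nmin; apply/existsP; exists (in_tuple s').
  by rewrite ps' ls' eqxx.
exists s; split=> //.
  case: (shortenP ps) ls => s' ps' us' sub /(min _ ps').
  rewrite -{1}(size_tuple s) => le; case/andP: us' => as' us.
  have [_ eqs] := uniq_min_size us sub le.
  by rewrite /= -eqs as' (leq_size_uniq us sub le).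
move=> i j ij; rewrite size_tuple => jn eij; apply/eqP; rewrite eqn_leq ij andbT.
have jE : j = j.-1.+1 by lia.
have lti : last a (take i s) = nth a (a :: s) i.
  by case: i {eij} ij => [|i] ij; rewrite ?take0 // (take_nth a) ?size_tuple ?last_rcons //; lia.
have dj : drop j.-1 s = nth a (a :: s) j :: drop j s.
  by rewrite {2 3}jE /= -drop_nth // size_tuple; lia.
have := min (take i s ++ drop j.-1 s); rewrite cat_path last_cat lti dj /=.
have ps2 : path e a (take i s ++ drop i s) by rewrite cat_take_drop.
have ps3 : path e a (take j s ++ drop j s) by rewrite cat_take_drop.
have ltj : last a (take j s) = nth a (a :: s) j.
  by rewrite {1}jE (take_nth a) ?size_tuple ?last_rcons -?jE 1?{2}jE //; lia.
move: ps2 ps3; rewrite !cat_path ltj => /andP[-> _] /andP[_ ->].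
rewrite eij; have <- : last a s = last (nth a (a :: s) j) (drop j s).
  by rewrite -ltj -last_cat cat_take_drop.
move=> /(_ isT ls); rewrite size_cat /= size_take size_drop size_tuple.
by case: ifP; lia.
Qed.

(** Interior vertices have only their two path neighbours, so a shortest connection from [y 2] to
    [y 0] avoiding [y 1] must first run along the path up to [y N.+1]. With [y 1] as hub it closes
    an induced cycle of length at least N + 2. *)
Lemma close_cycle g h (y : nat -> T) N : simple_graph h -> reach g h -> 0 < N ->
  (forall i j, i <= N.+1 -> j <= N.+1 -> y i = y j -> i = j) ->
  (forall j w, 0 < j <= N -> h (y j) w = (w == y j.-1) || (w == y j.+1)) ->
  connect [rel u w | [&& h u w, u != y 1 & w != y 1]] (y 2) (y 0) ->
  exists2 k, N <= k.+1 & fan g (true :: nseq k false ++ [:: true]).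
Proof.
move=> [hs hi] gh N0 yinj deg; set e := [rel _ _ | _].
case/shortest_path => s [ps ls us ind]; pose p := nth (y 2) (y 2 :: s).
have pe i : i < size s -> e (p i) (p i.+1) by move=> il; apply: (pathP (y 2) ps).
have pinj i j : i <= size s -> j <= size s -> p i = p j -> i = j.
  by move=> il jl /eqP; rewrite nth_uniq ?ltnS // => /eqP.
have plast : p (size s) = y 0 by rewrite -ls /p -[size s]/((size (y 2 :: s)).-1) nth_last.
have chain i : i < N -> i <= size s /\ p i = y i.+2.
  elim/ltn_ind: i => -[|i] IH iN; first by [].
  have [il pi] := IH i (leqnn _) (ltnW iN).
  have {}il : i < size s.
    rewrite ltn_neqAle il andbT; apply/eqP => ie; move: plast; rewrite -ie pi => /yinj; lia.
  split=> //; have := pe i il; rewrite /e /= pi deg; last by lia.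
  case/and3P => /orP[/eqP pE|/eqP -> //] _ pn1.
  case: i IH iN il pi pE pn1 => [|i] IH iN il pi pE pn1; first by rewrite pE eqxx in pn1.
  have [il' pi'] := IH i ltac:(lia) ltac:(lia).
  by have := pinj i.+2 i il ltac:(lia); rewrite pE pi' => /(_ erefl); lia.
have sz : N <= size s.
  have [il pi] := chain N.-1 ltac:(lia).
  case: (ltngtP N.-1 (size s)) il => // [lt|Ne] _; first by lia.
  by move: plast; rewrite -Ne pi => /yinj; lia.
exists (size s).-1; first by lia.
exists h, (y 1), p; split=> //.
have szw : size (true :: nseq (size s).-1 false ++ [:: true]) = (size s).+1.
  by rewrite /= size_cat size_nseq /=; lia.
have pn1 i : i <= size s -> p i != y 1.
  case: i => [_|i il]; first by apply/eqP => /yinj; lia.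
  by have /and3P[] := pe i il.
split; rewrite szw.
- by move=> i j il jl; apply: pinj.
- move=> i j il jl; case: (ltngtP i j) => [ij|ji|<-]; last by rewrite hi; lia.
    case: (eqVneq i.+1 j) => [<-|ne] /=; first by have /and3P[-> _ _] := pe i ltac:(lia).
    have -> : (j.+1 == i) = false by lia.
    apply/negP => hij; have := ind i j ij jl; rewrite /e /= hij !pn1 // => /(_ isT); lia.
  case: (eqVneq j.+1 i) => [<-|ne]; first by rewrite orbT hs; have /and3P[-> _ _] := pe j ltac:(lia).
  have -> : (i.+1 == j) = false by lia.
  apply/negP => hij; have := ind j i ji il; rewrite /e /= hs hij !pn1 // => /(_ isT); lia.
- by move=> i il; apply: pn1.
move=> i il; rewrite deg ?N0 //=.
have -> : (p i == y 0) = (i == size s).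
  rewrite -plast; apply/eqP/eqP => [/pinj|->] //; apply=> //; lia.
have -> : (p i == y 2) = (i == 0).
  rewrite -[y 2]/(p 0); apply/eqP/eqP => [/pinj|->] //; apply=> //; lia.
case: i il => [|i] il //=; first by rewrite orbT.
rewrite nth_cat size_nseq orbF; case: ltnP => ltk; first by rewrite nth_nseq ltk; lia.
have -> : i - (size s).-1 = 0 by lia.
by rewrite /=; lia.
Qed.

End Closing.

(** The standard symplectic form on GF(2)^4: the first two bits are values of a vector, the last two
    the values of its image at the same two vertices. *)
Definition om (p q : bool * bool * bool * bool) : bool :=
  let: (a, b, c, d) := p in let: (a', b', c', d') := q in
  (a && c') (+) (c && a') (+) (b && d') (+) (d && b').

Lemma om_sym p q : om p q = om q p.
Proof. by move: p q => [[[[] []] []] []] [[[[] []] []] []]. Qed.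

Lemma om_self p : om p p = false.
Proof. by move: p => [[[[] []] []] []]. Qed.

Lemma ind_addb (T : finType) (F : T -> bool) y : \big[addb/false]_u ((u == y) && F u) = F y.
Proof. by rewrite (@big_addb1 _ _ y) ?eqxx // => u /negbTE->. Qed.

(* lia is slow in large contexts, so the hypotheses not about natural numbers go first. *)
Ltac alia := repeat match goal with H : ?P |- _ =>
   let t := type of P in constr_eq t Prop;
   lazymatch P with
   | @eq ?A _ _ => tryif unify A nat then fail else clear H
   | is_true (leq _ _) => fail
   | is_true (andb (leq _ _) (leq _ _)) => fail
   | is_true (negb (leq _ _)) => fail
   | is_true (negb (@eq_op ?A _ _)) => tryif unify (Equality.sort A) nat then fail else clear H
   | _ => clear H end end; lia.

(** * Elimination inside a window of the strip *)

Section Window.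
Variables (T : finType) (g : rel T) (m : nat) (Q0 Y : {set T}) (x : nat -> T).
Hypothesis S : strip g m Q0 Y x.
Local Notation sg := (st_simple S).
Local Notation xinj := (st_inj S).
Local Notation xQ0 := (st_Q0 S).
Local Notation lk := (st_linked S).
Local Notation ck := (st_cut S).
Local Notation T_ k := (Tk Q0 x k).

Variables (al : T) (A0 B0 : T -> bool) (R_ : nat -> T -> bool).
Hypotheses (alQ : al \in Q0) (Aal : A0 al)
  (AB0 : forall a b, a \in Q0 -> b \notin T_ 1 -> g a b = A0 a && B0 b)
  (HR : forall k, 0 < k <= m ->
     (forall r, R_ k r -> r = al \/ exists2 i, i < k & r = x i) /\
     forall w, w \notin T_ 1 -> par g (R_ k) w = (w == x k)).

(* What the k-th vector and its image do at the left end, where they need not be a unit vector. *)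
Definition symb k := (R_ k al, R_ k (x 0), par g (R_ k) al, par g (R_ k) (x 0)).

Lemma al_x i : i <= m.+1 -> (al == x i) = false.
Proof. by move=> im; apply/negbTE; apply: contraNneq (xQ0 im) => <-. Qed.

Lemma alT k : al \in T_ k.
Proof. by apply/TkP; left. Qed.

Lemma RT k r : 0 < k <= m -> R_ k r -> r \in T_ k.
Proof.
move=> km /(proj1 (HR km))[->|[i ik ->]]; first exact: alT.
by apply/TkP; right; exists i.
Qed.

Lemma Rpar k w : 0 < k <= m -> w \notin T_ 1 -> par g (R_ k) w = (w == x k).
Proof. by move=> km; apply: (proj2 (HR km)). Qed.

Lemma Rge k i : 0 < k <= m -> k <= i <= m -> R_ k (x i) = false.
Proof.
move=> km /andP[ki im]; apply/negP => /(RT km); rewrite (xTk S); alia.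
Qed.

Lemma x_eq i j : i <= m.+1 -> j <= m.+1 -> (x i == x j) = (i == j).
Proof. by move=> im jm; apply/eqP/eqP => [/xinj|->] //; apply. Qed.

Lemma dotR k l : 0 < k <= m -> 0 < l <= m ->
  \big[addb/false]_u (par g (R_ k) u && R_ l u) =
  R_ l (x k) (+) (par g (R_ k) al && R_ l al) (+) (par g (R_ k) (x 0) && R_ l (x 0)).
Proof.
move=> km lm.
rewrite -(ind_addb (R_ l) (x k)) -(ind_addb (fun u => par g (R_ k) u && R_ l u) al).
rewrite -(ind_addb (fun u => par g (R_ k) u && R_ l u) (x 0)).
rewrite -!big_split /=; apply: eq_bigr => u _.
case Rlu: (R_ l u); last by rewrite !andbF.
rewrite !andbT; case: (proj1 (HR lm) _ Rlu) => [->|[i il ->]].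
  by rewrite !al_x ?eqxx ?addbF //; alia.
rewrite (eq_sym _ al) al_x ?addbF; last by alia.
rewrite !x_eq; try alia.
case: (posnP i) => [->|i0]; first by have -> : (0 == k) = false by alia.
by rewrite addbF Rpar ?x_eq ?(xTk S) //; alia.
Qed.

(** Symmetry of the adjacency matrix equates the pairings of each vector with the other's image. The
    images are unit vectors on the supports except at [al] and [x 0], whose terms make up the
    symplectic form. *)
Lemma Rom k l : 0 < k <= m -> 0 < l <= m ->
  R_ l (x k) (+) R_ k (x l) = om (symb k) (symb l).
Proof.
move=> km lm; have := par_dot (R_ k) (R_ l) sg.1; rewrite !dotR // /symb /om.
case: (R_ l (x k)) (R_ k (x l)) (R_ k al) (R_ l al) => [] [] [] [];
case: (R_ k (x 0)) (R_ l (x 0)) (par g (R_ k) al) (par g (R_ l) al) => [] [] [] [];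
by case: (par g (R_ k) (x 0)) (par g (R_ l) (x 0)) => [] [].
Qed.

Lemma Rom_lt k l : 0 < k -> k <= l -> l <= m -> R_ l (x k) = om (symb k) (symb l).
Proof. by move=> k0 kl lm; rewrite -Rom ?(@Rge k l) ?addbF //; alia. Qed.

(** Otherwise [Rom_lt] and triangularity force [R_ k] and [R_ l] to be equal, although their images
    differ at [x k]. *)
Lemma symb_sep k l : 0 < k -> k < l -> l <= m -> symb k = symb l ->
  exists2 s, k < s < l & om (symb s) (symb k).
Proof.
move=> k0 kl lm skl; apply: NNPP => ns.
have [e1 e2 _ _] : [/\ R_ k al = R_ l al, R_ k (x 0) = R_ l (x 0),
  par g (R_ k) al = par g (R_ l) al & par g (R_ k) (x 0) = par g (R_ l) (x 0)] by case: skl.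
have km : 0 < k <= m by alia.
have lm' : 0 < l <= m by alia.
have Req i : i < l -> R_ k (x i) = R_ l (x i).
  case: (posnP i) => [->|i0 il] //.
  case: (ltngtP i k) => ik.
  - by rewrite !Rom_lt ?skl //; alia.
  - rewrite (@Rge k) ?Rom_lt -?skl; try alia; apply/esym/negP => o; apply: ns.
    by exists i => //; alia.
  - by rewrite ik (@Rge k) ?Rom_lt -?skl ?om_self //; alia.
have Re : R_ k =1 R_ l.
  move=> r; apply/idP/idP => [Rr|Rr].
    by move: (Rr); have [->|[i ik ->]] := proj1 (HR km) _ Rr; rewrite ?e1 ?Req //; alia.
  by move: (Rr); have [->|[i ik ->]] := proj1 (HR lm') _ Rr; rewrite -?e1 -?Req //; alia.
have nT : x k \notin T_ 1 by rewrite (xTk S); alia.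
have := par_ext g Re (x k); rewrite !Rpar // eqxx x_eq; alia.
Qed.

Variables (E : nat) (kk : nat -> nat) (e f : bool * bool * bool * bool).
Hypotheses (E2 : 1 < E) (kkmon : forall j, j < E -> kk j < kk j.+1)
  (kkin : forall j, j <= E -> 0 < kk j <= m)
  (kksym : forall j, j <= E -> symb (kk j) = if odd j then e else f)
  (oef : om e f).

Lemma kklt i j : i < j -> j <= E -> kk i < kk j.
Proof.
elim: j => // j IH; rewrite ltnS leq_eqVlt => /predU1P[->|ij] jE; first exact: kkmon.
by apply: ltn_trans (IH ij (ltnW jE)) (kkmon jE).
Qed.

Lemma kkle i j : i <= j -> j <= E -> kk i <= kk j.
Proof. by rewrite leq_eqVlt => /predU1P[->|ij jE] //; apply/ltnW/kklt. Qed.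

Lemma kk_lt_inv i j : i <= E -> j <= E -> kk i < kk j -> i < j.
Proof. by move=> iE jE; rewrite !ltnNge; apply: contra => ji; apply: kkle. Qed.

Lemma kkom i j : i <= E -> j <= E -> om (symb (kk i)) (symb (kk j)) = odd (i + j).
Proof.
move=> iE jE; rewrite !kksym // oddD.
by case: (odd i) (odd j) => [] []; rewrite ?om_self //= 1?om_sym oef.
Qed.

Lemma Rkk i j : i <= j -> j <= E -> R_ (kk j) (x (kk i)) = odd (i + j).
Proof.
move=> ij jE; have iE := leq_trans ij jE.
have := kkin iE; have := kkin jE; have := kkle ij jE => k1 k2 k3.
by rewrite Rom_lt ?kkom //; alia.
Qed.

(** The two summands have the same symbol, so everything at the left end cancels. This vector will
    yield the row of [x (kk j)] after the elimination. *)
Definition hv j r := R_ (kk j.-1) r (+) R_ (kk j.+1) r.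

Lemma hv_symb j : 0 < j < E -> symb (kk j.-1) = symb (kk j.+1).
Proof.
case: j => // j /= jE; rewrite !kksym /= ?negbK //; alia.
Qed.

Lemma hv_supp j r : 0 < j < E -> hv j r -> exists2 s, kk j.-1 < s < kk j.+1 & r = x s.
Proof.
move=> jE; have sy := hv_symb jE; have j0 : 0 < j by case/andP: jE.
have [e1 e2 _ _] : [/\ R_ (kk j.-1) al = R_ (kk j.+1) al, R_ (kk j.-1) (x 0) = R_ (kk j.+1) (x 0),
  par g (R_ (kk j.-1)) al = par g (R_ (kk j.+1)) al
  & par g (R_ (kk j.-1)) (x 0) = par g (R_ (kk j.+1)) (x 0)] by case: sy.
have k1 := @kkin j.-1 ltac:(alia); have k2 := @kkin j.+1 ltac:(alia).
have k12 : kk j.-1 < kk j.+1 by apply: kklt; alia.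
have hal : hv j al = false by rewrite /hv e1 addbb.
have hx i : i < kk j.+1 -> hv j (x i) -> kk j.-1 < i.
  case: (posnP i) => [->|i0 il]; first by rewrite /hv e2 addbb.
  rewrite ltnNge; apply: contraTN => il2; rewrite /hv.
  rewrite Rom_lt; try alia.
  by rewrite Rom_lt ?sy ?addbb //; alia.
move=> hr; have : R_ (kk j.-1) r \/ R_ (kk j.+1) r.
  by move: hr; rewrite /hv; case: (R_ _ r); [left|right].
case=> Rr; [have [re|[i ik re]] := proj1 (HR k1) _ Rr|have [re|[i ik re]] := proj1 (HR k2) _ Rr].
- by move: hr; rewrite re hal.
- by exists i => //; have := hx i; rewrite -re hr => /(_ _ isT); alia.
- by move: hr; rewrite re hal.
- by exists i => //; have := hx i; rewrite -re hr => /(_ _ isT); alia.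
Qed.

Lemma hv_self j : 0 < j < E -> hv j (x (kk j)).
Proof.
move=> jE; have k1 := @kkin j ltac:(alia); have k2 : kk j.-1 <= kk j by apply: kkle; alia.
by rewrite /hv Rge ?Rkk ?kkin //; alia.
Qed.

Lemma hv_par j w : 0 < j < E ->
  par g (hv j) w = (w == x (kk j.-1)) (+) (w == x (kk j.+1)).
Proof.
move=> jE; have sy := hv_symb jE; have j0 : 0 < j by case/andP: jE.
have [_ _ e3 e4] : [/\ R_ (kk j.-1) al = R_ (kk j.+1) al, R_ (kk j.-1) (x 0) = R_ (kk j.+1) (x 0),
  par g (R_ (kk j.-1)) al = par g (R_ (kk j.+1)) al
  & par g (R_ (kk j.-1)) (x 0) = par g (R_ (kk j.+1)) (x 0)] by case: sy.
have k1 := @kkin j.-1 ltac:(alia); have k2 := @kkin j.+1 ltac:(alia).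
have k12 : kk j.-1 < kk j.+1 by apply: kklt; alia.
case: (boolP (w \in T_ 1)) => wT; last by rewrite par_add !Rpar.
have nx i : 0 < i <= m -> (w == x i) = false.
  by move=> i0; apply: contraTF wT => /eqP->; rewrite (xTk S); alia.
rewrite !nx //=.
(* On [Q0] the image is a multiple of [A0], and it vanishes at [al], where [A0] is one. *)
have Q0E v : v \in Q0 -> par g (hv j) v = A0 v && \big[addb/false]_r (hv j r && B0 r).
  move=> vQ; rewrite big_distrr /=; apply: eq_bigr => r _.
  case hr : (hv j r); last by rewrite andbF.
  have [s sj rs] := hv_supp jE hr; rewrite sg.1 AB0 // rs (xTk S); alia.
have c0 : \big[addb/false]_r (hv j r && B0 r) = false.
  by have := Q0E al alQ; rewrite Aal par_add e3 addbb.
move: wT => /TkP[wQ|[i]]; first by rewrite Q0E // c0 andbF.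
by rewrite ltnS leqn0 => /eqP-> ->; rewrite par_add e4 addbb.
Qed.

Definition isD s := (kk 0 < s < kk E) && (s \notin map kk (iota 0 E.+1)).
Definition D : {set T} := [set y in map x (filter isD (iota 0 m))].

Lemma DP y : reflect (exists2 s, isD s & y = x s) (y \in D).
Proof.
rewrite inE; apply: (iffP mapP) => [[s]|[s sD ->]].
  by rewrite mem_filter => /andP[sD _] ->; exists s.
exists s => //; rewrite mem_filter sD mem_iota /=; have := @kkin E (leqnn _).
by case/andP: sD; alia.
Qed.

Lemma isD_win s : isD s -> kk 0 < s < kk E.
Proof. by case/andP. Qed.

Lemma isD_kk j : j <= E -> isD (kk j) = false.
Proof. by move=> jE; rewrite /isD map_f ?andbF // mem_iota; alia. Qed.

Lemma win_m s : s < kk E -> s <= m.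
Proof. by have := @kkin E (leqnn _); alia. Qed.

Lemma x_D s : s <= m.+1 -> (x s \in D) = isD s.
Proof.
move=> sm; apply/DP/idP => [[s' sD /xinj e']|sD]; last by exists s.
have /andP[_ /win_m s'm] := isD_win sD; by rewrite e' //; alia.
Qed.

Lemma D_T k y : k <= (kk 0).+1 -> y \in D -> y \notin T_ k.
Proof.
move=> k0 /DP[s sD ->]; have /andP[s1 /win_m s2] := isD_win sD.
have := @kkin 0 ltac:(alia) => ?; rewrite (xTk S); alia.
Qed.

Lemma win_cases s : kk 0 < s < kk E -> isD s \/ exists2 j, 0 < j < E & s = kk j.
Proof.
move=> sw; case: (boolP (isD s)) => sD; [by left|right].
move: sD; rewrite /isD sw negbK => /mapP[j]; rewrite mem_iota => /= jE sE.
exists j => //; rewrite sE in sw; case/andP: sw => s1 s2.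
apply/andP; split; first by case: j {jE sE s2} s1 => //; rewrite ltnn.
by rewrite ltn_neqAle; apply/andP; split; [apply: contraTneq s2 => ->; rewrite ltnn|alia].
Qed.

(** * The kernel of the eliminated block *)

Definition ker (R : T -> bool) :=
  (forall y, R y -> y \in D) /\ (forall y, y \in D -> par g R y = false).

Lemma hv_D j y : 0 < j < E -> hv j y -> y != x (kk j) -> y \in D.
Proof.
move=> jE hy yk; have [s /andP[s1 s2] ys] := hv_supp jE hy.
have k1 : kk 0 <= kk j.-1 by apply: kkle; alia.
have k2 : kk j.+1 <= kk E by apply: kkle; alia.
have sw : kk 0 < s < kk E by alia.
have [sD|[i iE si]] := win_cases sw; first by apply/DP; exists s.
have i1 : j.-1 < i by apply: kk_lt_inv; rewrite -?si; alia.
have i2 : i < j.+1 by apply: kk_lt_inv; rewrite -?si; alia.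
move: yk; rewrite ys si; have -> : i = j by alia.
by rewrite eqxx.
Qed.

(** Pair [R] with [hv j]: the image of [hv j] avoids [D], and [x (kk j)] is the only vertex of
    [hv j] outside [D]. *)
Lemma ker_kk R j : ker R -> 0 < j < E -> par g R (x (kk j)) = false.
Proof.
move=> [RD R0] jE; have := par_dot R (hv j) sg.1.
rewrite (@big_addb1 _ _ (x (kk j))) => [|y yk]; last first.
  by case hy : (hv j y); rewrite ?andbF // R0 //; apply: hv_D hy yk.
rewrite hv_self // andbT => ->; apply: big1 => y _; rewrite hv_par //.
case Ry : (R y); rewrite ?andbF // andbT; have /DP[s sD ->] := RD _ Ry.
have /andP[_ /win_m sm] := isD_win sD.
have k1 := @kkin j.-1 ltac:(alia); have k2 := @kkin j.+1 ltac:(alia).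
rewrite !x_eq; try alia.
have -> : (s == kk j.-1) = false.
  by apply: contraTF sD => /eqP->; rewrite isD_kk //; alia.
by apply: contraTF sD => /eqP->; rewrite isD_kk //; alia.
Qed.

Lemma ker_win R s : ker R -> kk 0 < s < kk E -> par g R (x s) = false.
Proof.
move=> kR /win_cases[sD|[j jE ->]]; last exact: ker_kk.
by apply: (proj2 kR); apply/DP; exists s.
Qed.

Variables (A B : T -> bool).
Hypothesis AB : forall a b, a \in T_ (kk 0) -> b \notin T_ (kk 0).+1 -> g a b = A a && B b.

Definition za (R : T -> bool) := \big[addb/false]_r (R r && B r).
Definition pa s := \big[addb/false]_(r in T_ (kk 0)) (A r && R_ s r).

Lemma ker_T R r : ker R -> r \in T_ (kk 0) -> par g R r = A r && za R.
Proof.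
move=> [RD _] rT; rewrite big_distrr /=; apply: eq_bigr => y _.
case Ry : (R y); rewrite ?andbF //= sg.1 AB //; exact: D_T (RD _ Ry).
Qed.

(** Pairing with [R_ s] picks out the value at [x s]. On the support of [R_ s] the image of [R]
    lives only on the left part and at [x (kk 0)], so [R] depends on two bits. *)
Lemma ker_val R s : ker R -> kk 0 < s < kk E ->
  R (x s) = (za R && pa s) (+) (par g R (x (kk 0)) && R_ s (x (kk 0))).
Proof.
move=> kR sw; have sm : 0 < s <= m by have := @win_m s; alia.
have := par_dot (R_ s) R sg.1; have k0m := @kkin 0 ltac:(alia).
rewrite (@big_addb1 _ _ (x s)) => [|y ys]; last first.
  case Ry : (R y); rewrite ?andbF // Rpar ?(negbTE ys) //.
  by have := @D_T 1 y ltac:(alia) ((proj1 kR) _ Ry).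
rewrite Rpar ?eqxx //=; last by rewrite (xTk S); alia.
move=> ->; rewrite -(ind_addb (fun u => par g R u && R_ s u) (x (kk 0))).
rewrite /pa big_distrr [X in X (+) _]big_mkcond -big_split /=; apply: eq_bigr => u _.
case: (boolP (u \in T_ (kk 0))) => uT.
  rewrite ker_T // andbA (andbC (za R)); have -> : (u == x (kk 0)) = false.
    by apply: contraTF uT => /eqP->; rewrite (xTk S) ?ltnn //; alia.
  by rewrite addbF; case: (za R) (A u) (R_ s u) => [] [] [].
case: (eqVneq u (x (kk 0))) => [->|uk] //=.
case Ru : (R_ s u); rewrite ?andbF // andbT.
have := RT sm Ru => /TkP[uQ|[i is' ui]].
  by case/negP: uT; apply/TkP; left.
rewrite ui ker_win //; apply/andP; split; last by alia.
rewrite ltnNge leq_eqVlt negb_or; apply/andP; split.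
  by apply: contraNneq uk => <-; rewrite ui.
by apply: contraNN uT => ik; rewrite ui; apply/TkP; right; exists i.
Qed.

(** [x (kk 1)] is not in [D], so [R] vanishes there; this ties the two bits together and leaves only
    [za R] free. *)
Lemma ker_k1 R : ker R -> par g R (x (kk 0)) = za R && pa (kk 1).
Proof.
move=> kR; have k01 := @kkmon 0 ltac:(alia); have k1E := @kklt 1 E E2 (leqnn _).
have := ker_val kR (s := kk 1) ltac:(alia); rewrite (@Rkk 0 1) //; last by alia.
have -> : R (x (kk 1)) = false.
  apply/negP => /(proj1 kR); rewrite x_D ?isD_kk //; [alia|have := @kkin 1 ltac:(alia); alia].
by rewrite andbT; case: (za R && _) (par _ _ _) => [] [].
Qed.

Lemma ker_za R : ker R -> (exists y, R y) -> za R.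
Proof.
move=> kR [y Ry]; have /DP[s sD ys] := (proj1 kR) _ Ry.
have := ker_val kR (isD_win sD); rewrite ker_k1 // -ys Ry.
by case: (za R).
Qed.

Lemma ker_unique R R' : ker R -> ker R' -> (exists y, R y) -> (exists y, R' y) -> R =1 R'.
Proof.
move=> kR kR' nR nR' y; case: (boolP (y \in D)) => [/DP[s sD ->]|yD]; last first.
  have -> : R y = false by apply: contraNF yD => /(proj1 kR).
  by apply/esym; apply: contraNF yD => /(proj1 kR').
by rewrite !(ker_val _ (isD_win sD)) // !ker_k1 // !ker_za.
Qed.

(* The matrix of D has corank at most one. *)
Lemma nonsing_D : nonsing g D (fun=> false) \/
  exists u (R : T -> bool), [/\ nonsing g (D :\ u) (fun=> false), u \in D, R u & ker R].
Proof.
case: (classic (nonsing g D (fun=> false))) => [|ns]; [by left|right].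
have [R [kR [u Ru]]] : exists R : T -> bool, ker R /\ exists u, R u.
  apply: NNPP => nR; apply: ns => R RD RK y; apply/negP => Ry; apply: nR.
  exists R; split; last by exists y.
  split=> [z Rz|z zD]; last by rewrite RK.
  by apply/negPn/negP => /RD; rewrite Rz.
exists u, R; split=> //; last exact: (proj1 kR).
move=> R' R'D R'K y; have R'u : R' u = false by apply: R'D; rewrite in_setD1 eqxx.
have R'sub z : R' z -> z \in D.
  by move=> R'z; apply/negPn/negP => zD; rewrite R'D ?in_setD1 ?negb_and ?zD ?orbT // in R'z.
have p0 : par g R' u = false.
  have := par_dot R R' sg.1; rewrite big1 => [|z _]; last first.
    by case R'z : (R' z); rewrite ?andbF // (proj2 kR) // R'sub.
  rewrite (@big_addb1 _ _ u) ?Ru ?andbT // => z zu.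
  case Rz : (R z); rewrite ?andbF // R'K // in_setD1 zu /=; exact: (proj1 kR).
have kR' : ker R'.
  split=> // z zD; case: (eqVneq z u) => [->|zu] //; rewrite R'K //.
  by rewrite in_setD1 zu.
apply/negP => R'y; have := ker_unique kR kR' (ex_intro _ u Ru) (ex_intro _ y R'y) u.
by rewrite Ru R'u.
Qed.

Definition Bset : {set T} := [set y | (y \in Y) || [exists s : 'I_m.+1, (kk E <= s) && (y == x s)]].

Lemma BsetP y : reflect (y \in Y \/ exists2 s, kk E <= s <= m & y = x s) (y \in Bset).
Proof.
rewrite inE; apply: (iffP orP) => -[yY|]; try by left.
  by case/existsP => s /andP[s1 /eqP->]; right; exists s => //; have := ltn_ord s; alia.
case=> s /andP[s1 s2] ->; right; have sm : s < m.+1 by [].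
by apply/existsP; exists (Ordinal sm); rewrite /= s1 eqxx.
Qed.

(** The image of the kernel vector becomes the row of the surviving vertex. If that row meets the
    end of the window, it meets another vertex beyond it, through which a lost edge can be
    replaced. *)
Lemma ker_left R : ker R -> par g R (x (kk 0)) ->
  exists w, [/\ w \in T_ (kk 0), w != x (kk 0) & par g R w].
Proof.
move=> kR; rewrite ker_k1 // => /andP[z1 p1].
have [w /andP[wT Aw]] : exists w, (w \in T_ (kk 0)) && A w.
  apply: NNPP => nw; move: p1; rewrite /pa big1 // => r rT.
  by apply/negbTE; rewrite negb_and; apply/orP; left; apply/negP => Ar; apply: nw; exists r; rewrite rT.
exists w; split=> //; last by rewrite ker_T // Aw.
by apply: contraTneq wT => ->; have := @kkin 0 ltac:(alia) => ?; rewrite (xTk S) ?ltnn //; alia.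
Qed.

Lemma dead_par R w : w \notin T_ m.+1 -> w \notin Y -> par g R w = false.
Proof.
move=> wT wY; apply: big1 => r _; apply/negbTE; rewrite negb_and; apply/orP; right.
by rewrite sg.1; apply/negP => /(st_alive S); rewrite (negbTE wT) (negbTE wY).
Qed.

Lemma ker_right R : ker R -> par g R (x (kk E)) ->
  exists w, [/\ w \in Bset, w != x (kk E) & par g R w].
Proof.
move=> kR pE; apply: NNPP => nw; have kE := @kkin E (leqnn _).
have k0 := @kkin 0 ltac:(alia); have k0E : kk 0 < kk E by apply: kklt; alia.
(* Without such a [w], this sum has no parity beyond [x (kk 0)], hence by [no_tail] no support
   there; yet it contains [x (kk E.-1)]. *)
pose P y := R y (+) R_ (kk E) y.
have nP : P (x (kk E.-1)) = false.
  have kEm := @kkin E.-1 ltac:(alia).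
  have k1 : kk 0 < kk E.-1 by apply: kklt; alia.
  apply: (@no_tail _ _ _ _ _ _ S (kk 0)); try alia.
    move=> r; rewrite /P; case: (boolP (R r)) => Rr /=; last first.
      by move/(RT kE); apply: (subsetP (Tk_sub _ _ _)); alia.
    have /DP[s sD ->] := (proj1 kR) _ Rr; have /andP[s1 /win_m s2] := isD_win sD.
    by move=> _; apply/TkP; right; exists s.
  move=> w wT; rewrite par_add.
  have w1 : w \notin T_ 1 by apply: contra wT; apply: (subsetP (Tk_sub _ _ _)); alia.
  rewrite Rpar //; case: (boolP (w \in Bset)) => [wB|wB].
    case: (eqVneq w (x (kk E))) => [->|wE]; first by rewrite pE.
    by rewrite addbF; apply/negP => pw; apply: nw; exists w.
  have wE : (w == x (kk E)) = false.
    by apply: contraNF wB => /eqP->; apply/BsetP; right; exists (kk E) => //; alia.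
  rewrite wE addbF; case: (boolP (w \in T_ m.+1)) => wTm; last first.
    by apply: dead_par => //; apply: contra wB => wY; apply/BsetP; left.
  move: wTm => /TkP[wQ|[s sm ws]]; first by case/negP: wT; apply/TkP; left.
  rewrite ws ker_win //; rewrite ws (xTk S) in wT; try alia.
  rewrite ws in wB; have : ~~ (kk E <= s).
    by apply: contra wB => Es; apply/BsetP; right; exists s => //; alia.
  alia.
move: nP; rewrite /P Rkk ?leq_pred //.
have -> : odd (E.-1 + E) by alia.
suff -> : R (x (kk E.-1)) = false by [].
apply/negP => /(proj1 kR); rewrite x_D ?isD_kk //; [alia|have := @kkin E.-1 ltac:(alia); alia].
Qed.

(** By nonsingularity a vector with zero parity on [D0] is the only lift of its restriction, so its
    image can be read off as an image in the new graph. *)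
Lemma pivot_rows D0 : nonsing g D0 (fun=> false) -> exists vs d,
  [/\ forall v, v \in vs -> v \in D0,
    forall U, (forall y, y \in D0 -> U y = false) -> exists R,
      [/\ forall y, y \notin D0 -> R y = U y, forall y, y \in D0 -> par g R y = false
        & forall w, w \notin D0 -> par (local_comps g vs) U w = par g R w (+) (d w && U w)]
    & forall R w, (forall y, y \in D0 -> par g R y = false) -> w \notin D0 ->
      par (local_comps g vs) (fun y => (y \notin D0) && R y) w = par g R w (+) (d w && R w)].
Proof.
move=> ns; have [vs [d [vsD H]]] := pivot_out sg ns.
exists vs, d; split=> // R w R0 wD.
have [|R' [R'U R'K R'E]] := H (fun y => (y \notin D0) && R y); first by move=> y ->.
rewrite R'E // wD /=; congr addb; apply: par_ext => y.
suff : R' y (+) R y = false by case: (R' y) (R y) => [] [].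
apply: (ns (fun y => R' y (+) R y)) => z zD; first by rewrite R'U // zD addbb.
by rewrite par_add R'K // R0.
Qed.

Lemma kk_D0 (D0 : {set T}) j : {subset D0 <= D} -> j <= E -> x (kk j) \notin D0.
Proof.
move=> D0D jE; apply: contraT; rewrite negbK => /D0D; rewrite x_D ?isD_kk //.
by have := kkin jE; alia.
Qed.

Lemma kkE i j : i <= E -> j <= E -> (x (kk i) == x (kk j)) = (i == j).
Proof.
move=> iE jE; rewrite x_eq; [|have := kkin iE; alia|have := kkin jE; alia].
apply/eqP/eqP => [e'|->] //; apply/eqP; rewrite eqn_leq (leqNgt i) (leqNgt j).
by apply/andP; split; apply/negP => /kklt; rewrite e' ltnn => /(_ ltac:(alia)).
Qed.

(** In the singular case all of [D] except [u] is eliminated. Then [hu] is the row of [u], and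
    [eps j] tells whether [hv j] contains [u]; as [u] lies between two chosen vertices, this happens
    for at most two consecutive j. *)
Lemma window_graph : exists (D0 : {set T}) vs d (eps : nat -> bool) (hu : T -> bool),
  let h := local_comps g vs in
  [/\ {subset D0 <= D} /\ (forall v, v \in vs -> v \in D0),
    forall U, (forall y, y \in D0 -> U y = false) -> exists R,
      [/\ forall y, y \notin D0 -> R y = U y, forall y, y \in D0 -> par g R y = false
        & forall w, w \notin D0 -> par h U w = par g R w (+) (d w && U w)],
    forall j w, 0 < j < E -> w \notin D0 -> w != x (kk j) ->
      h (x (kk j)) w = ((w == x (kk j.-1)) (+) (w == x (kk j.+1))) (+) (eps j && hu w),
    forall i j, eps i -> eps j -> i <= j.+1
  & [/\ forall j, 0 < j < E -> hu (x (kk j)) = false,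
      hu (x (kk 0)) -> exists w, [/\ w \in T_ (kk 0), w != x (kk 0) & hu w]
    & hu (x (kk E)) -> exists w, [/\ w \in Bset, w != x (kk E) & hu w]]].
Proof.
case: nonsing_D => [ns|[u [R [ns uD Ru kR]]]].
  have [vs [d [vsD lift row]]] := pivot_rows ns.
  exists D, vs, d, (fun=> false), (fun=> false); split=> //; first by split=> [y|].
  move=> j w jE wD wk.
  have := row (hv j) w; rewrite (_ : par _ _ w = par (local_comps g vs) (fun y => (y == x (kk j)) && true) w).
    rewrite par1 andTb hv_par // => -> //.
      have -> : hv j w = false by apply: contraNF wD => hw; apply: hv_D hw wk.
      by rewrite andbF.
    move=> y yD; rewrite hv_par //; apply/negbTE.
    have /negbTE-> : y != x (kk j.-1).
      by apply: contraTneq yD => ->; apply: kk_D0 => //; alia.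
    have /negbTE-> // : y != x (kk j.+1).
    by apply: contraTneq yD => ->; apply: kk_D0 => //; alia.
  apply: par_ext => y; case: (eqVneq y (x (kk j))) => [->|yk].
    by rewrite hv_self // kk_D0 //; alia.
  by case hy : (hv j y); rewrite ?andbF //= andbT; apply/negbTE; rewrite negbK; apply: hv_D hy yk.
have [vs [d [vsD lift row]]] := pivot_rows ns.
set D0 := D :\ u in vsD lift row; set h := local_comps g vs in lift row.
have sh : simple_graph h by apply: simple_lcs sg.
have D0D : {subset D0 <= D} by move=> y; rewrite in_setD1 => /andP[].
have uD0 : u \notin D0 by rewrite in_setD1 eqxx.
have hvD0 j y : 0 < j < E -> hv j y -> y != x (kk j) -> y != u -> y \in D0.
  by move=> jE hy yk yu; rewrite in_setD1 yu; apply: hv_D hy yk.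
have hv0 j y : 0 < j < E -> y \in D -> par g (hv j) y = false.
  move=> jE yD; rewrite hv_par //; apply/negbTE.
  have /negbTE-> : y != x (kk j.-1).
    by apply: contraTneq yD => ->; apply: (@kk_D0 D) => //; alia.
  have /negbTE-> // : y != x (kk j.+1).
  by apply: contraTneq yD => ->; apply: (@kk_D0 D) => //; alia.
have uk j : j <= E -> (u == x (kk j)) = false.
  by move=> jE; apply: contraTF uD => /eqP->; apply: (@kk_D0 D) => //.
have hu w : w \notin D0 -> w != u -> h u w = par g R w.
  move=> wD wu; have := row R w; rewrite (_ : par _ _ w = par h (fun y => (y == u) && true) w).
    rewrite par1 andTb => -> //.
      have -> : R w = false.
        by apply: contraNF wD => /(proj1 kR) wD; rewrite in_setD1 wu.
      by rewrite andbF addbF.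
    by move=> y /D0D; apply: (proj2 kR).
  apply: par_ext => y; case: (eqVneq y u) => [->|yu]; first by rewrite uD0 Ru.
  case Ry : (R y); rewrite ?andbF //= andbT; apply/negbTE; rewrite negbK in_setD1 yu.
  exact: (proj1 kR).
have huk j : 0 < j < E -> h u (x (kk j)) = false.
  by move=> jE; rewrite hu ?ker_kk // ?kk_D0 //; [alia|rewrite eq_sym uk //; alia].
have hrow j w : 0 < j < E -> w \notin D0 ->
    h (x (kk j)) w (+) (hv j u && h u w) = par g (hv j) w (+) (d w && hv j w).
  move=> jE wD; rewrite -row //; last by move=> y /D0D; apply: hv0.
  rewrite -[h (x (kk j)) w]andTb -[X in X (+) _]par1 -(par1 h (hv j u) u w) -par_add.
  apply: par_ext => y; case: (eqVneq y (x (kk j))) => [->|yk].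
    by rewrite hv_self // kk_D0 //= 1?(eq_sym _ u) ?uk //; alia.
  case: (eqVneq y u) => [->|yu]; first by rewrite uD0.
  by case hy : (hv j y); rewrite ?andbF //= andbT; apply/esym/negbTE; rewrite negbK; apply: hvD0 hy yk yu.
exists D0, vs, d, (fun j => (0 < j < E) && hv j u), (h u); split=> //.
- move=> j w jE wD wk; have := hrow j w jE wD; rewrite jE /= hv_par //.
  case: (eqVneq w u) => [->|wu].
    have hk : local_comps g vs (x (kk j)) u = false by rewrite -[LHS]/(h _ _) (sh.1 _ u) huk.
    by move=> _; rewrite hk sh.2 andbF uk ?uk //; alia.
  have -> : hv j w = false by apply: contraNF wD => hw; apply: hvD0 hw wk wu.
  by rewrite andbF addbF => <-; rewrite -addbA addbb addbF.
- move=> i j /andP[iE hi] /andP[jE hj].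
  have [s si us] := hv_supp iE hi; have [s' sj us'] := hv_supp jE hj.
  have ss : s = s'.
    have k1 := @kkin i.+1 ltac:(alia); have k2 := @kkin j.+1 ltac:(alia).
    by apply: xinj; rewrite -?us -?us' //; alia.
  rewrite -ss in sj; have : i.-1 < j.+1 by apply: kk_lt_inv; alia.
  by alia.
have kD j : j <= E -> x (kk j) \notin D0 by apply: kk_D0.
have ku j : j <= E -> x (kk j) != u by move=> jE; rewrite eq_sym uk.
have k0 := @kkin 0 ltac:(alia).
split=> //.
- rewrite hu ?kD ?ku // => /(ker_left kR)[w [wT wk pw]]; exists w; split=> //.
  have wD : w \notin D by apply: contraTN wT => /(@D_T (kk 0)); apply.
  rewrite hu //; first by apply: contra wD => /D0D.
  by apply: contraNneq wD => ->.
rewrite hu ?kD ?ku // => /(ker_right kR)[w [wB wk pw]]; exists w; split=> //.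
have wD : w \notin D.
  apply/negP => /DP[s sD ws]; have /andP[s1 s2] := isD_win sD; have sm := win_m s2.
  case/BsetP: wB => [|[s' s'E ws']]; first by rewrite ws (negbTE (st_Y S sm)).
  have : s = s' by apply: xinj; rewrite -?ws -?ws' //; alia.
  alia.
rewrite hu //; first by apply: contra wD => /D0D.
by apply: contraNneq wD => ->.
Qed.
Definition conn_in (h : rel T) (X : {set T}) :=
  forall a b, a \in X -> b \in X -> connect [rel u w | [&& h u w, u \in X & w \in X]] a b.

(** The elimination chooses its local complementations itself; all that is known is that they take
    place off the ends. *)
Definition rconn (X : {set T}) :=
  forall vs, (forall v, v \in vs -> v \notin X) -> conn_in (local_comps g vs) X.

Hypotheses (connX : rconn (T_ 1)) (connY : rconn Y).

Lemma window_cycle len : 0 < len -> len.*2.+2 <= E ->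
  exists2 k, len <= k.+1 & fan g (true :: nseq k false ++ [:: true]).
Proof.
move=> len0 lenE; have [D0 [vs [d [eps [hu]]]]] := window_graph.
set h := local_comps g vs => -[[D0D vsD] lift row epsb [huk hu0 huE]].
have sh : simple_graph h by apply: simple_lcs sg.
have [hs hi] := sh.
(* If one of the positions 1, ..., [len] is disturbed, none from [len.+2] on is; hence a window
   about twice as long as the stretch. *)
have [c [c0 cE cl]] : exists c, [/\ 0 < c, c + len <= E & forall j, c <= j < c + len -> eps j = false].
  case: (classic (exists2 j, 0 < j <= len & eps j)) => [[j1 j1l e1]|ne].
    exists len.+2; split=> //; first by alia.
    by move=> j jl; apply/negP => /epsb/(_ e1); alia.
  exists 1; split=> //; first by alia.
  by move=> j jl; apply/negP => ej; apply: ne; exists j => //; alia.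
pose h3 : rel T := fun u w => [&& h u w, u \notin D0 & w \notin D0].
have h3s : symmetric h3 by move=> u w; rewrite /h3 hs; congr andb; rewrite andbC.
pose y i := x (kk (c.-1 + i)).
have yD i : i <= len.+1 -> y i \notin D0 by move=> il; apply: kk_D0 => //; alia.
have yE i j : i <= len.+1 -> j <= len.+1 -> (y i == y j) = (i == j).
  by move=> il jl; rewrite kkE; alia.
have deg j w : 0 < j <= len -> h3 (y j) w = (w == y j.-1) || (w == y j.+1).
  move=> jl; have y1 := yD j.-1 ltac:(alia); have y2 := yD j.+1 ltac:(alia).
  rewrite /h3 yD /=; last by alia.
  case: (boolP (w \in D0)) => wD.
    rewrite andbF; apply/esym/negbTE; rewrite negb_or.
    by apply/andP; split; [apply: contraNneq y1 => <-|apply: contraNneq y2 => <-].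
  rewrite andbT; case: (eqVneq w (y j)) => [->|wy].
    by rewrite hi !yE; alia.
  rewrite row //; last by alia.
  rewrite cl ?addbF; last by alia.
  have -> : x (kk (c.-1 + j).-1) = y j.-1 by rewrite /y; congr (x (kk _)); alia.
  have -> : x (kk (c.-1 + j).+1) = y j.+1 by rewrite /y; congr (x (kk _)); alia.
  case: (eqVneq w (y j.-1)) => [->|_] //=; rewrite yE; alia.
pose st u := [exists i : 'I_len.+1, (0 < i) && (u == y i)].
have stP u : reflect (exists2 i, 0 < i <= len & u = y i) (st u).
  apply: (iffP existsP) => [[i /andP[i0 /eqP->]]|[i /andP[i0 il] ->]].
    by exists i => //; have := ltn_ord i; alia.
  by exists (Ordinal (il : i < len.+1)); rewrite /= i0 eqxx.
pose e2 : rel T := fun u w => [&& h3 u w, ~~ st u & ~~ st w].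
have e2s : symmetric e2 by move=> u w; rewrite /e2 h3s; congr andb; rewrite andbC.
have csym := sym_connect_sym e2s.
have kk0 := @kkin 0 ltac:(alia); have kkEm := @kkin E (leqnn _).
have kk0E : kk 0 < kk E by apply: kklt; alia.
have nst_T u : u \in T_ (kk 0).+1 -> u \notin D0 /\ ~~ st u.
  move=> uT; split; first by apply: contraTN uT => /D0D; apply: D_T.
  apply/negP => /stP[i il uy]; move: uT; rewrite uy.
  have k1 : kk 0 < kk (c.-1 + i) by apply: kklt; alia.
  have k2 := @kkin (c.-1 + i) ltac:(alia).
  by rewrite (xTk S); alia.
have nst_B u : u \in Bset -> u \notin D0 /\ ~~ st u.
  move=> uB; have nws s : kk 0 < s < kk E -> u != x s.
    move=> sE; apply/eqP => us; case/BsetP: uB => [|[s' s'E us']].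
      by rewrite us (negbTE (st_Y S _)) //; alia.
    have : s = s' by apply: xinj; rewrite -?us -?us' //; alia.
    by alia.
  split; first by apply/negP => /D0D/DP[s /isD_win/nws/eqP].
  apply/negP => /stP[i il /eqP]; apply/negP/nws.
  by apply/andP; split; apply: kklt; alia.
have e2I u w : h u w -> u \notin D0 /\ ~~ st u -> w \notin D0 /\ ~~ st w -> connect e2 u w.
  by move=> huw [uD us] [wD ws]; apply: connect1; rewrite /e2 /h3 huw uD wD us ws.
have kk_nst j : j <= E -> j < c \/ c + len <= j -> ~~ st (x (kk j)).
  move=> jE jc; apply/negP => /stP[i il /eqP]; rewrite kkE; try alia.
  by move/eqP => je; case: jc => jc; alia.
have vsT v k : v \in vs -> k <= (kk 0).+1 -> v \notin T_ k.
  by move=> /vsD/D0D vD k0; apply: D_T vD.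
have lkh : linked h (T_ 1) Y by apply: linked_lcs lk; apply: sg.
(* All local complementations are at vertices of [D], hence commute with the deletion of [x s] for s
   outside the window. *)
have cutkh s : s <= m.+1 -> ~ (kk 0 < s < kk E) -> cutk Q0 x h s.
  move=> sm ns; rewrite /cutk /h -local_comps_del.
    by apply: cutle1_lcs; [apply: simple_del sg|apply: ck].
  move=> v /vsD/D0D/DP[s' s'D ->]; apply/eqP => /xinj e'; apply: ns.
  have := isD_win s'D; rewrite e' //; have /andP[_ /win_m] := isD_win s'D; alia.
have conT k : 0 < k <= (kk 0).+1 -> forall t, t \in T_ k -> connect e2 al t.
  elim: k => // k IH /andP[_ k0]; case: (posnP k) => [-> t tT|kpos t].
    have cX : conn_in h (T_ 1) by apply: connX => v /vsT; apply.
    apply: (connect_sub _ (cX _ _ (alT 1) tT)).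
    have T1 v : v \in T_ 1 -> v \in T_ (kk 0).+1 by apply: (subsetP (Tk_sub _ _ _)).
    by move=> u w /and3P[huw u1 w1]; apply: e2I => //; apply/nst_T/T1.
  rewrite TkS => /predU1P[->|tT]; last by apply: IH => //; alia.
  have [||r rT hr] := @left_nbr _ _ _ _ _ _ S h k lkh; try alia.
    by apply: cutkh; alia.
  apply: connect_trans (IH _ r rT) _; first by alia.
  apply: e2I => //; apply: nst_T; first by apply: (subsetP (Tk_sub _ _ _)) rT; alia.
  by rewrite (xTk S); alia.
have alive_h u w : h u w -> (w \in T_ m.+1) || (w \in Y).
  by rewrite hs; apply: (alive_lcs sg.1 (st_alive S)).
have conB t : t \in Bset -> connect e2 (x m.+1) t.
  have conY t' : t' \in Y -> connect e2 (x m.+1) t'.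
    have cY : conn_in h Y.
      apply: connY => v /vsD/D0D/DP[s /isD_win/andP[_ /win_m sm] ->]; exact: (st_Y S).
    move=> tY; apply: (connect_sub _ (cY _ _ (st_last S) tY)).
    by move=> u w /and3P[huw u1 w1]; apply: e2I => //; apply: nst_B; apply/BsetP; left.
  case/BsetP => [/conY//|[s s1 ->]]; have [N] := ubnP (m - s).
  elim: N => // N IH in s s1 *; rewrite ltnS => sN.
  have [||r rT hr] := @right_nbr _ _ _ _ _ _ S h s lkh; try alia.
    by apply: cutkh; alia.
  have xsB : x s \in Bset by apply/BsetP; right; exists s.
  have [tr rB] : connect e2 (x m.+1) r /\ r \in Bset.
    case/orP: (alive_h _ _ hr) => [/TkP[rQ|[i im ri]]|rY].
    - by case/negP: rT; apply/TkP; left.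
    - have si : s < i by rewrite ri (xTk S) in rT; alia.
      split; last by apply/BsetP; right; exists i => //; alia.
      by rewrite ri; apply: IH; alia.
    by split; [apply: conY|apply/BsetP; left].
  by apply: connect_trans tr _; apply: e2I; [rewrite hs|apply: nst_B|apply: nst_B].
have kedge j : 0 < j -> j.+1 < E -> j.+1 < c \/ c + len <= j -> connect e2 (x (kk j)) (x (kk j.+1)).
  move=> j0 jE jc; have jc1 : j < c \/ c + len <= j by case: jc => jc; [left|right]; alia.
  have jc2 : j.+1 < c \/ c + len <= j.+1 by case: jc => jc; [left|right]; alia.
  have [D1 D2] : x (kk j) \notin D0 /\ x (kk j.+1) \notin D0 by split; apply: kk_D0 => //; alia.
  have [s1 s2] : ~~ st (x (kk j)) /\ ~~ st (x (kk j.+1)) by split; apply: kk_nst => //; alia.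
  apply: e2I => //.
  by rewrite row ?kkE ?huk ?andbF ?kk_D0 //; alia.
have xT1 : x (kk 0) \in T_ (kk 0).+1 by rewrite (xTk S); alia.
have {}conT t : t \in T_ (kk 0).+1 -> connect e2 al t.
  by apply: conT; rewrite leqnn.
have al_a := conT _ xT1.
have al_y0 : connect e2 al (y 0).
  rewrite /y addn0; case: (posnP c.-1) => [->|c1] //.
  have main : forall j, 0 < j -> j < c -> connect e2 al (x (kk j)).
    elim=> // j IH _ jc; case: (posnP j) => [->|j0]; last first.
      by apply: connect_trans (IH j0 (ltnW jc)) _; apply: kedge; alia.
    have x1 : x (kk 1) \notin D0 /\ ~~ st (x (kk 1)) by split; [apply: kk_D0 => //; alia|apply: kk_nst; alia].
    case: (boolP (hu (x (kk 0)))) => [hx|hx]; last first.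
      apply: connect_trans al_a _; apply: e2I => //; last by split; [apply: kk_D0|apply: kk_nst; alia].
      rewrite hs row ?kk_D0 ?kkE //; try alia.
      by rewrite eqxx (negbTE hx) andbF.
    case: (boolP (eps 1)) => e1; last first.
      apply: connect_trans al_a _; apply: e2I => //; last by split; [apply: kk_D0|apply: kk_nst; alia].
      rewrite hs row ?kk_D0 ?kkE //; try alia.
      by rewrite eqxx (negbTE e1).
    (* The surviving vertex has cancelled the edge to [x (kk 0)]; [w] takes its place. *)
    have [w [wT wk hw]] := hu0 hx.
    have wT' : w \in T_ (kk 0).+1 by apply: (subsetP (Tk_sub _ _ _)) wT.
    have wne j' : 0 < j' -> j' <= E -> w != x (kk j').
      move=> j0 jE; apply: contraTneq wT' => ->; have k1 := @kklt 0 j' j0 jE; have k2 := @kkin j' jE.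
      by rewrite (xTk S); alia.
    apply: connect_trans (conT _ wT') _.
    apply: e2I; [|exact: nst_T|exact: x1].
    rewrite hs row ?(proj1 (nst_T _ wT')) ?wne //; try alia.
    by rewrite (negbTE wk) (negbTE (wne 2 _ _)) ?e1 ?hw //; alia.
  by apply: main; alia.
have bB : x (kk E) \in Bset by apply/BsetP; right; exists (kk E) => //; alia.
have m_y1 : connect e2 (x m.+1) (y len.+1).
  have yc : y len.+1 = x (kk (c + len)) by rewrite /y; congr (x (kk _)); alia.
  rewrite yc; case: (ltngtP (c + len) E) => [cE'|cE'|->]; [|alia|exact: conB].
  have main : forall i, 0 < i -> c + len <= E - i -> connect e2 (x m.+1) (x (kk (E - i))).
    elim=> // i IH _ ci; case: (posnP i) => [->|i0]; last first.
      apply: connect_trans (IH i0 _) _; first by alia.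
      rewrite csym; have -> : E - i = (E - i.+1).+1 by alia.
      by apply: kedge; alia.
    have xE : x (kk (E - 1)) \notin D0 /\ ~~ st (x (kk (E - 1))).
      by split; [apply: kk_D0 => //; alia|apply: kk_nst; alia].
    have E1 : (E - 1).+1 = E by alia.
    case: (boolP (eps (E - 1) && hu (x (kk E)))) => [/andP[e1 hx]|hx]; last first.
      apply: connect_trans (conB _ bB) _; apply: e2I => //; last exact: nst_B.
      rewrite hs row ?E1 ?kk_D0 ?kkE //; try alia.
      by rewrite eqxx (negbTE hx); alia.
    have [w [wB wk hw]] := huE hx; have [wD wst] := nst_B _ wB.
    have wne j : j < E -> w != x (kk j).
      move=> jE; apply: contraTneq wB => ->; have k2 := @kklt j E jE (leqnn _).
      apply/BsetP => -[|[s s1 /xinj]]; first by rewrite (negbTE (st_Y S _)) //; alia.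
      by move=> e'; have := e' ltac:(alia) ltac:(alia); alia.
    apply: connect_trans (conB _ wB) _; apply: e2I => //.
    rewrite hs row ?wne ?E1 //; try alia.
    by rewrite (negbTE wk) (negbTE (wne _ _)) ?e1 ?hw //; alia.
  have -> : c + len = E - (E - (c + len)) by alia.
  by apply: main; alia.
suff main : connect e2 (x (kk 0)) (x (kk E)).
  have y01 : connect e2 (y len.+1) (y 0).
    have c1 : connect e2 (y len.+1) (x m.+1) by rewrite csym.
    have c3 : connect e2 (x (kk E)) (x (kk 0)) by rewrite csym.
    have c4 : connect e2 (x (kk 0)) al by rewrite csym.
    exact: connect_trans (connect_trans (connect_trans (connect_trans c1 (conB _ bB)) c3) c4) al_y0.
  apply: (@close_cycle _ g h3 y len) => //.
  - by split=> // u; rewrite /h3 hi.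
  - exact/reach_avoid/reach_lcs/reach_refl.
  - by move=> i j il jl /eqP; rewrite yE // => /eqP.
  apply: (connect_trans _ (connect_sub _ y01)); last first.
    move=> u w /and3P[h3uw us ws]; apply: connect1; rewrite /= h3uw /=.
    by apply/andP; split; [apply: contra us|apply: contra ws] => /eqP->; apply/stP; exists 1 => //; alia.
  have chain i : i < len -> connect [rel u w | [&& h3 u w, u != y 1 & w != y 1]] (y 2) (y i.+2).
    elim: i => [|i IH] il; first exact: connect0.
    apply: connect_trans (IH (ltnW il)) (connect1 _); rewrite /= deg; last by alia.
    by rewrite eqxx orbT !yE; alia.
  by have := chain len.-1 ltac:(alia); rewrite prednK.
(* If the ends lie in different components, the vectors L U with U \subset C' are determined by
   their parities on C1, although C1 is smaller than C'. *)
apply: NNPP => nc.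
pose C : {set T} := [set v | connect e2 (x (kk 0)) v].
have inC v : (v \in C) = connect e2 (x (kk 0)) v by rewrite inE.
have TC v : v \in T_ (kk 0).+1 -> v \in C.
  by move=> vT; rewrite inC (connect_trans _ (conT v vT)) // csym.
have BC v : v \in Bset -> v \notin C.
  move=> vB; rewrite inC; apply/negP => cv; apply: nc; apply: connect_trans cv _.
  by rewrite csym; apply: connect_trans (conB _ vB); rewrite csym; apply: conB.
have stC v : v \in C -> v \notin D0 /\ ~~ st v.
  rewrite inC => /connectP[s ps ->]; case/lastP: s ps => [_|s w] /=.
    by apply: nst_T; rewrite (xTk S); alia.
  by rewrite rcons_path last_rcons => /andP[_ /and3P[/and3P[_ _ wD] _ ws]].
have aliveC v : v \in C -> v \in T_ m.+1.
  move=> vC; have : (v \in T_ m.+1) || (v \in Y).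
    move: vC; rewrite inC => /connectP[s ps ->]; case/lastP: s ps => [_|s w] /=.
      by rewrite (xTk S); alia.
    by rewrite rcons_path last_rcons => /andP[_ /and3P[/and3P[/alive_h]]].
  by case/orP => // vY; have := BC v; rewrite vC => /(_ ltac:(by apply/BsetP; left)).
have y0C : y 0 \in C by rewrite inC (connect_trans _ al_y0) // csym.
have y1C : y len.+1 \notin C.
  rewrite inC; apply/negP => cy; apply: nc; apply: connect_trans cy _.
  by rewrite csym; apply: connect_trans m_y1; rewrite csym; apply: conB.
have nTa : ~ cutle1 g (T_ (kk 0).+1) by apply: (ncut S lk); alia.
have [al' alT' Aal'] : exists2 al', al' \in T_ (kk 0) & A al'.
  apply: NNPP => na; apply: nTa; exists (fun a => a == x (kk 0)), (g (x (kk 0))) => a b.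
  rewrite TkS => /predU1P[-> _|aT bT]; first by rewrite eqxx.
  rewrite AB //; have -> : A a = false by apply/negP => Aa; apply: na; exists a.
  apply/esym/negbTE; rewrite negb_and; apply/orP; left.
  by apply: contraTneq aT => ->; rewrite (xTk S) ?ltnn //; alia.
have alx : al' != x (kk 0).
  by apply: contraTneq alT' => ->; rewrite (xTk S) ?ltnn //; alia.
(* [al'] and [x (kk 0)] span the rows of the left end beyond it. [y 0] is left out as the only
   vertex of the component [C] with a neighbour on the stretch. *)
pose C1 := C :\: T_ (kk 0).+1; pose C' := (al' |: (x (kk 0) |: C1)) :\ y 0.
have aT1 : al' \in T_ (kk 0).+1 by apply: (subsetP (Tk_sub _ _ _)) alT'.
have C'C v : v \in C' -> v \in C.
  rewrite !inE => /andP[_ /or3P[/eqP->|/eqP->|/andP[_]]] //; rewrite -?inC; exact: TC.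
have cardC' : #|C1| < #|C'|.
  have : #|al' |: (x (kk 0) |: C1)| = #|C1|.+2.
    by rewrite !cardsU1 !in_setU1 !in_setD (negbTE alx) aT1 xT1.
  by rewrite (cardsD1 (y 0)) -/C'; case: (_ \in _); alia.
(* As [U] avoids [y 0], its neighbours among the survivors lie in [C], so the lift of [U] has zero
   image outside [C]. *)
have [L LP] : exists L : {set T} -> T -> bool, forall U : {set T}, U \subset C' ->
    [/\ forall v, v \notin D0 -> L U v = (v \in U) &
        forall w, w \notin C -> par g (L U) w = false].
  apply: (@fchoice _ _ (fun (U : {set T}) (R : T -> bool) => U \subset C' ->
    [/\ forall v, v \notin D0 -> R v = (v \in U) &
        forall w, w \notin C -> par g R w = false])).
  move=> U; case: (boolP (U \subset C')) => [UC|_]; last by exists (fun=> false).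
  have UC' v : v \in U -> v \in C' by apply: (subsetP UC).
  have [|R [RU R0 RE]] := lift (mem U).
    move=> v vD; apply/negbTE; apply: contraL vD => /UC'/C'C/stC[]//.
  exists R => _; split=> // w wC; case: (boolP (w \in D0)) => wD; first exact: R0.
  have := RE w wD; have -> : mem U w = false by apply/negbTE; apply: contra wC => /UC'/C'C.
  rewrite andbF addbF => <-; apply: big1 => r _; apply/negbTE; rewrite negb_and -implybE.
  apply/implyP => rU; apply/negP => hrw; have rC' := UC' r rU.
  have rC := C'C r rC'; have [rD rs] := stC r rC.
  case: (boolP (st w)) => [/stP[j jl wj]|ws].
    have : h3 (y j) r by rewrite -wj h3s /h3 hrw rD wD.
    rewrite deg // => /orP[] /eqP rj.
      case: (posnP j.-1) => j1; last by case/stP: rs; exists j.-1 => //; alia.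
      by move: rC'; rewrite rj j1 !inE eqxx.
    case: (eqVneq j len) => jE; first by move: y1C; rewrite -jE -rj rC.
    by case/stP: rs; exists j.+1 => //; alia.
  case/negP: wC; rewrite inC; apply: connect_trans (connect1 (_ : e2 r w)); first by rewrite -inC.
  by rewrite /e2 /h3 hrw rD wD rs ws.
pose phi (U : {set T}) := [set s in C1 | par g (L U) s].
have phiE U v : (v \in phi U) = (v \in C1) && par g (L U) v by rewrite in_set.
(* The difference [P] of two lifts with equal parities on [C1] has no parity beyond [x (kk 0)]. By
   [no_tail] only [al'] and [x (kk 0)] can be in it, and their rows are independent there. *)
have phi_inj : {in powerset C' &, injective phi}.
  move=> U1 U2; rewrite !inE => U1C U2C /setP ephi.
  have [L1 P1] := LP _ U1C; have [L2 P2] := LP _ U2C.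
  pose P v := L U1 v (+) L U2 v.
  have Ppar w : w \notin T_ (kk 0).+1 -> par g P w = false.
    move=> wT; rewrite par_add; case: (boolP (w \in C)) => wC; last by rewrite P1 // P2.
    have wC1 : w \in C1 by rewrite in_setD wT.
    by have := ephi w; rewrite !phiE wC1 /= => ->; rewrite addbb.
  have Lsupp (U : {set T}) : U \subset C' -> forall v, L U v -> v \in T_ m.+1.
    move=> UC v Lv; have [LU _] := LP _ UC; case: (boolP (v \in D0)) => vD.
      have /DP[s /isD_win/andP[_ /win_m sm] ->] := D0D _ vD.
      by apply/TkP; right; exists s.
    by rewrite LU // in Lv; apply/aliveC/C'C/(subsetP UC).
  have Ptail s : kk 0 < s <= m -> P (x s) = false.
    apply: (@no_tail _ _ _ _ _ _ S (kk 0)) => //; first by alia.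
    by move=> r; rewrite /P; case: (boolP (L U1 r)) => [/(Lsupp _ U1C)//|_ /=]; apply: Lsupp.
  have Pout v : v \in T_ m.+1 -> v \notin T_ (kk 0).+1 -> P v = false.
    move=> /TkP[vQ|[s sm ->]]; first by case/negP; apply/TkP; left.
    by rewrite (xTk S); try alia; move=> sk; apply: Ptail; alia.
  have Pin v : P v -> v = al' \/ v = x (kk 0).
    move=> Pv; have vm : v \in T_ m.+1.
      move: Pv; rewrite /P.
      by case: (boolP (L U1 v)) => [/(Lsupp _ U1C)//|_ /=]; apply: Lsupp.
    have vT : v \in T_ (kk 0).+1 by apply: contraT => vT; move: Pv; rewrite Pout.
    have [vD _] := nst_T _ vT; have : v \in C'.
      by move: Pv; rewrite /P L1 // L2 //; case: (boolP (v \in U1)) => [/(subsetP U1C)|_ /= /(subsetP U2C)].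
    rewrite in_setD1 !in_setU1 in_setD vT /= orbF => /andP[_ /orP[/eqP|/eqP]]; [left|right] => //.
  have Prow w : w \notin T_ (kk 0).+1 -> (P al' && B w) (+) (P (x (kk 0)) && g (x (kk 0)) w) = false.
    move=> wT; rewrite -(Ppar w wT); have -> : B w = g al' w by rewrite AB // Aal'.
    rewrite -(ind_addb (fun u => P u && g u w) al') -(ind_addb (fun u => P u && g u w) (x (kk 0))).
    rewrite -big_split /=; apply: eq_bigr => u _; case Pu : (P u); last by rewrite !andbF.
    by case: (Pin u Pu) => ->; rewrite eqxx ?(negbTE alx) 1?(eq_sym _ al') ?(negbTE alx) ?addbF.
  have Px : P (x (kk 0)) = false.
    apply/negP => Px; apply: nTa.
    exists (fun r => if r == x (kk 0) then P al' else A r), B => r w; rewrite TkS => rT wT.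
    case: eqP rT => [-> _|_ /= rT]; last exact: AB.
    by have := Prow w wT; rewrite Px /=; case: (P al' && B w) (g _ w) => [] [].
  have Pa : P al' = false.
    apply/negP => Pa; apply: nTa; exists (fun a => a == x (kk 0)), (g (x (kk 0))) => r w.
    rewrite TkS => /predU1P[-> _|rT wT]; first by rewrite eqxx.
    have := Prow w wT; rewrite Px Pa /= addbF => B0'; rewrite AB // B0' andbF.
    apply/esym/negbTE; rewrite negb_and; apply/orP; left.
    by apply: contraTneq rT => ->; rewrite (xTk S) ?ltnn //; alia.
  have P0 v : P v = false.
    by apply/negP => Pv; move: (Pv); have [->|->] := Pin v Pv; rewrite ?Pa ?Px.
  apply/setP => v; case: (boolP (v \in C')) => vC; last first.
    have nv (U : {set T}) : U \subset C' -> (v \in U) = false.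
      by move=> UC; apply: contraNF vC => /(subsetP UC).
    by rewrite !nv.
  have [vD _] := stC v (C'C v vC); rewrite -L1 // -L2 //.
  by have := P0 v; rewrite /P; case: (L U1 v) (L U2 v) => [] [].
have := card_in_imset phi_inj; rewrite card_powerset => cI.
have : #|phi @: powerset C'| <= #|powerset C1|.
  apply/subset_leq_card/subsetP => _ /imsetP[U _ ->]; rewrite powersetE.
  by apply/subsetP => v; rewrite phiE => /andP[].
by rewrite cI card_powerset leq_exp2l // leqNgt cardC'.
Qed.

End Window.

(** Sixteen symbols enter both pigeonholes, and 16 (16 (n - 1) + 1) < 256 n. The alternation has 2n
    terms, so the window ends at index 2n - 1 and has room for a stretch of n - 2. *)
Lemma strip_cycle (T : finType) (g : rel T) m (Q0 Y : {set T}) (x : nat -> T) n :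
  strip g m Q0 Y x -> rconn g (Tk Q0 x 1) -> rconn g Y -> 3 <= n -> 256 * n <= m ->
  exists2 k, n <= k + 3 & fan g (true :: nseq k false ++ [:: true]).
Proof.
move=> S cX cY n3 nm; have [al [A0 [B0 [R_ [alQ Aal AB0 HR]]]]] := strip_vectors S.
have C16 : #|{: bool * bool * bool * bool}| = 16 by rewrite !card_prod card_bool.
have [||f [e [kk [oef mon kin kQ]]]] := @alternation _ (symb g x al R_) om m n
  (fun k l => @symb_sep _ _ _ _ _ _ S _ _ alQ HR k l).
- by alia.
- by rewrite C16; alia.
have k0 := kin 0 ltac:(alia).
have k0m : kk 0 <= m.+1 by alia.
have [A [B AB]] := cutkE S (st_cut S k0m) k0m.
have E1 : 1 < n.*2.-1 by alia.
have E2 j : j < n.*2.-1 -> kk j < kk j.+1 by move=> jn; apply: mon; alia.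
have E3 j : j <= n.*2.-1 -> 0 < kk j <= m by move=> jn; apply: kin; alia.
have E4 j : j <= n.*2.-1 -> symb g x al R_ (kk j) = if odd j then e else f.
  by move=> jn; apply: kQ; alia.
have [||k kn fk] := @window_cycle _ _ _ _ _ _ S _ _ _ _ alQ Aal AB0 HR _ _ _ _ E1 E2 E3 E4 oef _ _ AB cX cY (n - 2).
- by alia.
- by alia.
by exists k => //; alia.
Qed.

(** * Ends that stay connected *)

Section RobustlyConnected.
Variables (T : finType) (X Z : {set T}) (v : T).
Hypotheses (vX : v \in X) (vZ : v \notin Z) (ZX : Z \subset X).
Implicit Types (h : rel T) (w : T).

Local Notation D := ([set d in X | (d != v) && (d \notin Z)]).

(* Vertices of D see nothing outside X, and those of Z all see the same outside vertices;
   hence a local complementation outside X only complements the edges of X inside v |: Z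
   when v sees the vertex, and inside Z otherwise. *)
Record robust h : Prop := Robust {
  rb_dead : forall d w, d \in D -> w \notin X -> h d w = false;
  rb_twin : forall z z' w, z \in Z -> z' \in Z -> w \notin X -> h z w = h z' w;
  rb_conn : exists2 d0, d0 \in D &
    forall d, d \in D -> connect [rel u w | [&& h u w, u \in D & w \in D]] d0 d;
  rb_Z : forall z, z \in Z -> exists2 d, d \in D & h z d;
  rb_hub : (exists2 d, d \in D & h v d) \/
    (exists z z', [/\ z \in Z, z' \in Z & h v z && ~~ h v z']) }.

Lemma robust_lc h w : simple_graph h -> w \notin X -> robust h -> robust (local_comp h w).
Proof.
move=> [hs hi] wX [dead twin [d0 d0D conn] toD hub].
have lcD d y : d \in D -> local_comp h w d y = h d y /\ local_comp h w y d = h y d.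
  by move=> dD; rewrite !lcE (hs w d) (dead d w dD wX) andbF !addbF.
split=> //.
- by move=> d y dD yX; rewrite (lcD d y dD).1 dead.
- move=> z z' y zZ z'Z yX; rewrite !lcE (hs w z) (hs w z') (twin z z' y) // (twin z z' w) //.
  suff E u : u \in Z -> (u == y) = false by rewrite !E.
  by move=> uZ; apply: contraNF yX => /eqP<-; apply: (subsetP ZX).
- exists d0 => // d /conn; rewrite (eq_connect (e' := [rel u y | [&& local_comp h w u y, u \in D & y \in D]])) //.
  by move=> u y /=; case: (boolP (u \in D)) => uD; rewrite ?andbF // (lcD u y uD).1.
- by move=> z zZ; have [d dD zd] := toD z zZ; exists d; rewrite ?(lcD d z dD).2.
case: hub => [[d dD vd]|[z [z' [zZ z'Z vz]]]].
  by left; exists d; rewrite ?(lcD d v dD).2.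
(* All edges between [v] and [Z] are toggled together, so [v] still separates [Z], possibly with [z]
   and [z'] exchanged. *)
right; have E y : y \in Z -> local_comp h w v y = h v y (+) (h w v && h w z).
  move=> yZ; rewrite lcE (hs w y) (twin y z) // (hs w z).
  by have -> : v != y by [apply: contraNneq vZ => ->]; rewrite andbT.
case: (boolP (h w v && h w z)) => c; [exists z', z|exists z, z'];
  by rewrite !E ?(negbTE c) ?c; move: vz; case: (h v z) (h v z') => [] [].
Qed.

Lemma robust_del h w : w \notin X -> robust h -> robust (del h w).
Proof.
move=> wX [dead twin [d0 d0D conn] toD hub].
have inX u : u \in X -> (u == w) = false by move=> uX; apply: contraNF wX => /eqP<-.
have delX a b : a \in X -> b \in X -> del h w a b = h a b.
  by move=> aX bX; rewrite /del !inX ?andbT.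
have DX d : d \in D -> d \in X by rewrite in_set => /andP[].
have ZX' z : z \in Z -> z \in X by apply: (subsetP ZX).
split=> //.
- by move=> d y dD yX; rewrite /del dead.
- by move=> z z' y zZ z'Z yX; rewrite /del (twin z z') // (inX z) ?(inX z') ?ZX'.
- exists d0 => // d /conn; rewrite (eq_connect (e' := [rel u y | [&& del h w u y, u \in D & y \in D]])) //.
  move=> u y /=; case: (boolP (u \in D)) => uD; rewrite ?andbF //.
  by case: (boolP (y \in D)) => yD; rewrite ?andbF // delX ?DX.
- by move=> z zZ; have [d dD zd] := toD z zZ; exists d; rewrite ?delX ?(DX d) ?(ZX' z).
case: hub => [[d dD vd]|[z [z' [zZ z'Z vz]]]]; [left|right].
  by exists d; rewrite ?delX ?(DX d).
by exists z, z'; rewrite !delX ?(ZX' z) ?(ZX' z').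
Qed.

Lemma robust_rconn h : simple_graph h -> robust h -> rconn h X.
Proof.
move=> sh rh vs; elim: vs h sh rh => [|w vs IH] h sh rh avoid /=; last first.
  apply: IH; [exact: simple_lc|apply: robust_lc => //; apply: avoid; exact: mem_head|].
  by move=> u uv; apply: avoid; rewrite inE uv orbT.
case: rh => dead twin [d0 d0D conn] toD hub.
rewrite /conn_in; set e := [rel u w | _].
have es : connect_sym e.
  by apply: sym_connect_sym => a b /=; rewrite sh.1; congr andb; rewrite andbC.
have DX d : d \in D -> d \in X by rewrite in_set => /andP[].
have conD d : d \in D -> connect e d0 d.
  move/conn; apply: connect_sub => a b /and3P[ab aD bD].
  by apply: connect1; rewrite /= ab !DX.
have conZ z : z \in Z -> connect e d0 z.
  move=> zZ; have [d dD zd] := toD z zZ; apply: connect_trans (conD d dD) _.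
  by rewrite es; apply: connect1; rewrite /= zd (subsetP ZX) ?DX.
have conv : connect e d0 v.
  case: hub => [[d dD vd]|[z [z' [zZ _ /andP[vz _]]]]].
    apply: connect_trans (conD d dD) _.
    by rewrite es; apply: connect1; rewrite /= vd vX DX.
  apply: connect_trans (conZ z zZ) _.
  by rewrite es; apply: connect1; rewrite /= vz vX (subsetP ZX).
have con a : a \in X -> connect e d0 a.
  move=> aX; case: (eqVneq a v) => [->|av] //; case: (boolP (a \in Z)) => aZ; first exact: conZ.
  by apply: conD; rewrite in_set aX av aZ.
by move=> a b aX bX; apply: connect_trans (con b bX); rewrite es; apply: con.
Qed.

End RobustlyConnected.

(** [linked_removal] disposes of the vertices outside [U] in turn, without control over which
    alternative occurs; hence [P] has to be stable under both operations. *)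
Lemma linked_minor (T : finType) (g : rel T) (X Y U : {set T}) (P : rel T -> Prop) :
  simple_graph g -> linked g X Y -> X \subset U -> Y \subset U ->
  (forall h w, simple_graph h -> w \notin U -> P h -> P (local_comp h w)) ->
  (forall h w, simple_graph h -> w \notin U -> P h -> P (del h w)) -> P g ->
  exists h, [/\ simple_graph h, reach g h, linked h X Y, P h & forall u w, h u w -> u \in U].
Proof.
move=> sg lk XU YU Plc Pdel Pg.
suff [h [sh gh lkh Ph iso]] : exists h, [/\ simple_graph h, reach g h, linked h X Y, P h
    & forall u w, u \in enum (~: U) -> h u w = false].
  exists h; split=> // u w; apply: contraTT => uU.
  by rewrite iso // mem_enum in_setC.
have : {subset enum (~: U) <= ~: U} by move=> u; rewrite mem_enum.
elim: (enum _) => [|v s IH] sub; first by exists g; split=> //; exact: reach_refl.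
have [|h [sh gh lkh Ph iso]] := IH; first by move=> u us; apply: sub; rewrite inE us orbT.
have vU : v \notin U by rewrite -in_setC sub ?mem_head.
have isol F : (forall u w, u \in s -> F u w = false) -> forall u w, u \in v :: s -> del F v u w = false.
  by move=> Fs u w /predU1P[->|us]; rewrite /del ?eqxx ?andbF ?Fs.
have [vX vY] : v \notin X /\ v \notin Y.
  by split; apply: contraNN vU; apply: subsetP.
have [lk'|lk'] := linked_removal sh lkh vX vY.
  exists (del h v); split=> //; [exact: simple_del|exact: reach_del|exact: Pdel|exact: isol].
exists (del (local_comp h v) v); split=> //.
- exact/simple_del/simple_lc.
- exact/reach_del/reach_lc.
- by apply: Pdel => //; [exact: simple_lc|exact: Plc].
by apply: isol => u w us; rewrite lcE iso // (sh.1 v u) iso.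
Qed.

(** * Minimal configurations *)

Section Path.
Variable T : finType.
Implicit Types (g h : rel T) (p : nat -> T) (l : nat).

Definition ipath h p l :=
  (forall i j, i <= l -> j <= l -> p i = p j -> i = j) /\
  (forall i j, i <= l -> j <= l -> h (p i) (p j) = (i.+1 == j) || (j.+1 == i)).

Definition onp p l : {set T} := [set y in map p (iota 0 l.+1)].

Lemma onpP p l y : reflect (exists2 i, i <= l & y = p i) (y \in onp p l).
Proof.
rewrite /onp in_set; apply: (iffP mapP) => -[i]; first by rewrite mem_iota; exists i => //; lia.
by move=> il ->; exists i => //; rewrite mem_iota; lia.
Qed.

Definition ext h p l : {set T} := [set v | (v \notin onp p l) && [exists w, h v w]].

Lemma extP h p l v : reflect (v \notin onp p l /\ exists w, h v w) (v \in ext h p l).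
Proof. by rewrite /ext in_set; apply: (iffP andP) => -[? /existsP]. Qed.

Definition ends_l p : {set T} := [set p 0; p 1].
Definition ends_r p l : {set T} := [set p l.-1; p l].

Definition config g L h p l :=
  [/\ reach g h, ipath h p l, L <= l & linked h (ends_l p) (ends_r p l)].

Lemma min_config g L h p l : config g L h p l ->
  exists h' p' l', config g L h' p' l' /\
    forall h2 p2 l2, config g L h2 p2 l2 -> #|ext h' p' l'| <= #|ext h2 p2 l2|.
Proof.
have [N] := ubnP #|ext h p l|; elim: N => // N IH in h p l * => hN cf.
case: (classic (exists h2 p2 l2, config g L h2 p2 l2 /\ #|ext h2 p2 l2| < #|ext h p l|)).
  by case=> h2 [p2 [l2 [c2 lt]]]; apply: (IH h2 p2 l2) => //; lia.
move=> nex; exists h, p, l; split=> // h2 p2 l2 c2; rewrite leqNgt; apply/negP => lt.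
by apply: nex; exists h2, p2, l2.
Qed.

Lemma init_config g L : simple_graph g -> prime_graph g -> 3 <= L ->
  has_induced_path g L -> exists p, config g L g p L.
Proof.
move=> sg pg L3 [f [finj fadj]]; exists (fun i => f (inord i)).
have iE i : i <= L -> @inord L i = i :> nat by move=> il; rewrite inordK.
have pinj i j : i <= L -> j <= L -> f (inord i) = f (inord j) -> i = j.
  by move=> il jl /finj/(congr1 (@nat_of_ord _)); rewrite !iE.
split=> //; first exact: reach_refl.
  by split=> // i j il jl; rewrite fadj !iE.
move=> Q XQ YQ; apply: prime_cut => //.
  apply: leq_trans (subset_leq_card XQ); rewrite cards2.
  by case: eqP => // /pinj; lia.
have YQ' : ends_r (fun i => f (inord i)) L \subset ~: Q.
  by apply/subsetP => y /YQ; rewrite inE.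
apply: leq_trans (subset_leq_card YQ'); rewrite cards2.
by case: eqP => // /pinj; lia.
Qed.

End Path.

(** * Vertices off the path in a minimal configuration *)

Section Minimal.
Variables (T : finType) (g : rel T) (L n : nat) (h : rel T) (p : nat -> T) (l : nat).
Hypotheses (sg : simple_graph g) (cf : config g L h p l)
  (hmin : forall h2 p2 l2, config g L h2 p2 l2 -> #|ext h p l| <= #|ext h2 p2 l2|)
  (l4 : 3 <= l) (n4 : 4 <= n)
  (nf : forall k, n <= k + 3 -> ~ fan g (true :: nseq k false ++ [:: true])).

Local Notation E := (ext h p l).

Lemma gh : reach g h. Proof. by case: cf. Qed.
Lemma sh : simple_graph h. Proof. exact: simple_reach gh. Qed.
Lemma pinj i j : i <= l -> j <= l -> p i = p j -> i = j.
Proof. by have [_ [pi _] _ _] := cf; apply: pi. Qed.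
Lemma padj i j : i <= l -> j <= l -> h (p i) (p j) = (i.+1 == j) || (j.+1 == i).
Proof. by have [_ [_ pa] _ _] := cf; apply: pa. Qed.
Lemma hlk : linked h (ends_l p) (ends_r p l). Proof. by case: cf. Qed.

Lemma p_ext i : i <= l -> p i \notin E.
Proof.
by move=> il; apply/negP => /extP[/negP]; case; apply/onpP; exists i.
Qed.

Lemma alive_cases y w : h y w -> (exists2 i, i <= l & y = p i) \/ y \in E.
Proof.
move=> yw; case: (boolP (y \in onp p l)) => [/onpP|yp]; [by left|right].
by apply/extP; split=> //; exists w.
Qed.

Lemma ext_p v i : v \in E -> i <= l -> v != p i.
Proof. by move=> vE il; apply: contraTneq vE => ->; apply: p_ext. Qed.

Lemma ext_ends v : v \in E -> v \notin ends_l p /\ v \notin ends_r p l.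
Proof.
move=> vE; rewrite !inE !negb_or !ext_p //; alia.
Qed.

Lemma no_smaller h' p' l' v : config g L h' p' l' -> v \in E -> v \notin ext h' p' l' ->
  (forall w, w \in ext h' p' l' -> w \in E) -> False.
Proof.
move=> c' vE vn sub; have := hmin c'; apply/negP; rewrite -ltnNge.
by apply/proper_card/properP; split; [apply/subsetP|exists v].
Qed.

Lemma ext_critical v : v \in E -> ~ linked (del h v) (ends_l p) (ends_r p l).
Proof.
move=> vE lk; have [gh' [pi pa] Ll _] := cf.
apply: (@no_smaller (del h v) p l v) => //.
- split=> //; first exact: reach_del.
  split=> // i j il jl; rewrite -pa // /del.
  by rewrite !(eq_sym _ v) !(ext_p vE) ?andbT.
- by apply/negP => /extP[_ [w]]; rewrite /del eqxx andbF.
by move=> w /extP[wp [y /and3P[hy _ _]]]; apply/extP; split=> //; exists y.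
Qed.

(** With at most one neighbour on the path, local complementation at [v] leaves the path induced,
    and either way of removing [v] would contradict minimality. *)
Lemma ext_two v : v \in E -> exists i j, [/\ i < j, j <= l, h v (p i) & h v (p j)].
Proof.
move=> vE; apply: NNPP => n2.
have one i j : i <= l -> j <= l -> h v (p i) -> h v (p j) -> i = j.
  move=> il jl hi hj; apply/eqP; apply: contraT; rewrite neq_ltn => /orP[lt|lt].
    by case: n2; exists i, j.
  by case: n2; exists j, i.
have [v1 v2] := ext_ends vE.
have [lk|lk] := linked_removal sh hlk v1 v2; first exact: ext_critical vE lk.
have [gh' [pi pa] Ll _] := cf.
apply: (@no_smaller (del (local_comp h v) v) p l v) => //.
- split=> //; first exact/reach_del/reach_lc.
  split=> // i j il jl; rewrite -pa // /del lcE.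
  rewrite !(eq_sym _ v) !(ext_p vE) ?andbT //.
  case vi : (h v (p i)); rewrite ?addbF //=; case vj : (h v (p j)); rewrite ?addbF //=.
  by rewrite (one i j) ?eqxx ?addbF.
- by apply/negP => /extP[_ [w]]; rewrite /del eqxx andbF.
move=> w /extP[wp [y /and3P[hy _ _]]]; apply/extP; split=> //.
move: hy; rewrite lcE; case: (boolP (h w y)) => [wy|_ /= /and3P[vw _ _]]; first by exists y.
by exists v; rewrite sh.1.
Qed.

(* Otherwise local complementation at v makes it an inner vertex of a longer path. *)
Lemma ext_not_mid v i : v \in E -> 0 < i -> i.+1 < l ->
  (forall j, j <= l -> h v (p j) = (j == i) || (j == i.+1)) -> False.
Proof.
move=> vE i0 il mid; have [gh' [pi pa] Ll lk] := cf; have [hs hi] := sh.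
pose p' j := if j <= i then p j else if j == i.+1 then v else p j.-1.
have p'o j : j <= l.+1 -> j != i.+1 -> exists2 j', j' <= l & p' j = p j' /\ j' = (if j <= i then j else j.-1).
  move=> jl ji; rewrite /p' (negbTE ji); case: ifP => ji'; first by exists j => //; alia.
  by exists j.-1 => //; alia.
have p'v : p' i.+1 = v by rewrite /p' ltnn eqxx.
have lcp a b : a <= l -> b <= l -> local_comp h v (p a) (p b) =
    ((a.+1 == b) || (b.+1 == a)) (+) [&& (a == i) || (a == i.+1), (b == i) || (b == i.+1) & a != b].
  move=> al bl; rewrite lcE pa // !mid //; congr (_ (+) [&& _, _ & _]).
  by congr negb; apply/eqP/eqP => [/pi|->] //; apply.
have lcv a : a <= l -> local_comp h v v (p a) = (a == i) || (a == i.+1).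
  by move=> al; rewrite lcE hi /= addbF mid.
have lcs : symmetric (local_comp h v) by case: (simple_lc v sh).
have lci : irreflexive (local_comp h v) by case: (simple_lc v sh).
have c' : config g L (local_comp h v) p' l.+1.
  split; [exact: reach_lc|split|by apply: leq_trans Ll _|].
  - move=> a b al bl; case: (eqVneq a i.+1) => ai; case: (eqVneq b i.+1) => bi.
    + by rewrite ai bi.
    + have [b' b'l [-> _]] := p'o b bl bi; rewrite ai p'v => e.
      by have := ext_p vE b'l; rewrite e eqxx.
    + have [a' a'l [-> _]] := p'o a al ai; rewrite bi p'v => e.
      by have := ext_p vE a'l; rewrite -e eqxx.
    have [a' a'l [-> aE]] := p'o a al ai; have [b' b'l [-> bE]] := p'o b bl bi.
    by move/(pi _ _ a'l b'l); rewrite aE bE; do 2 case: ifP; alia.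
  - move=> a b al bl; case: (eqVneq a i.+1) => ai; case: (eqVneq b i.+1) => bi.
    + by rewrite ai bi p'v lci; alia.
    + have [b' b'l [-> bE]] := p'o b bl bi; rewrite ai p'v lcv // bE.
      by case: ifP; alia.
    + have [a' a'l [-> aE]] := p'o a al ai; rewrite bi p'v lcs lcv // aE.
      by case: ifP; alia.
    have [a' a'l [-> aE]] := p'o a al ai; have [b' b'l [-> bE]] := p'o b bl bi.
    by rewrite lcp // aE bE; do 2 case: ifP; alia.
  have -> : ends_l p' = ends_l p by rewrite /ends_l /p' i0.
  have -> : ends_r p' l.+1 = ends_r p l.
    rewrite /ends_r /p' /=.
    have -> : (l <= i) = false by alia.
    have -> : (l == i.+1) = false by alia.
    have -> : (l < i) = false by alia.
    by have -> : (l.+1 == i.+1) = false by alia.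
  exact: linked_lc sh lk.
apply: (no_smaller c' vE).
  by apply/negP => /extP[/negP]; case; apply/onpP; exists i.+1 => //; alia.
move=> w /extP[wp [y hy]]; apply/extP; split.
  apply/onpP => -[j jl wj]; case/negP: wp; apply/onpP.
  exists (if j <= i then j else j.+1); first by case: ifP; alia.
  rewrite /p' wj; case: (leqP j i) => ji; first by rewrite ji.
  have -> : (j.+1 <= i) = false by alia.
  by have -> : (j.+1 == i.+1) = false by alia.
move: hy; rewrite lcE; case: (boolP (h w y)) => [wy|_ /= /and3P[vw _ _]]; first by exists y.
by exists v; rewrite hs.
Qed.

Lemma ext_bounds : exists lf rg : T -> nat, forall v, v \in E ->
  [/\ lf v < rg v <= l, h v (p (lf v)), h v (p (rg v))
    & forall i, i <= l -> h v (p i) -> lf v <= i <= rg v].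
Proof.
have [f fP] : exists f : T -> nat * nat, forall v, v \in E ->
  [/\ (f v).1 < (f v).2 <= l, h v (p (f v).1), h v (p (f v).2)
    & forall i, i <= l -> h v (p i) -> (f v).1 <= i <= (f v).2].
  apply: (@fchoice _ _ (fun v (f : nat * nat) => v \in E -> [/\ f.1 < f.2 <= l, h v (p f.1), h v (p f.2)
    & forall i, i <= l -> h v (p i) -> f.1 <= i <= f.2])) => v.
  case: (boolP (v \in E)) => vE; last by exists (0, 0).
  have [i [j [ij jl hi hj]]] := ext_two vE.
  pose P k := (k <= l) && h v (p k).
  have exP : exists k, P k by exists j; rewrite /P jl.
  have ubP k : P k -> k <= l by case/andP.
  case: (ex_minnP exP) (ex_maxnP exP ubP) => a /andP[al ha] amin [b /andP[bl hb] bmax].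
  exists (a, b) => _; split=> //=.
  - have := amin i; have := bmax j; rewrite /P jl hj hi => /(_ isT) jb /(_ ltac:(alia)); alia.
  - by move=> k kl hk; rewrite amin ?bmax // /P kl.
by exists (fun v => (f v).1), (fun v => (f v).2).
Qed.

Variables (lf rg : T -> nat).
Hypothesis lrP : forall v, v \in E ->
  [/\ lf v < rg v <= l, h v (p (lf v)), h v (p (rg v))
    & forall i, i <= l -> h v (p i) -> lf v <= i <= rg v].

Lemma fan_segment v a b : v \in E -> a <= b <= l ->
  fan g (map (fun i => h v (p i)) (iota a (b - a).+1)).
Proof.
move=> vE ab; exists h, v, (fun i => p (a + i)); split; first exact: gh.
split; rewrite size_map size_iota.
- by move=> i j il jl /pinj e; have := e ltac:(alia) ltac:(alia); alia.
- by move=> i j il jl; rewrite padj; alia.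
- by move=> i il; rewrite eq_sym ext_p //; alia.
by move=> i il; rewrite (nth_map 0) ?size_iota // nth_iota.
Qed.

(** A larger gap already gives the word 1 0^k 1 with n <= k + 3. *)
Lemma ext_gap v i j : v \in E -> i < j -> j <= l -> h v (p i) -> h v (p j) ->
  (forall k, i < k < j -> h v (p k) = false) -> j <= i + (n - 3).
Proof.
move=> vE ij jl hi hj hk; rewrite leqNgt; apply/negP => lt.
apply: (@nf (j - i).-1); first by alia.
have := fan_segment vE (a := i) (b := j) ltac:(alia); congr (fan _ _).
have -> : (j - i).+1 = ((j - i).-1 + 1).+1 by alia.
rewrite /= hi iotaD map_cat /=; congr (_ :: _ ++ [:: _]).
  apply: (@eq_from_nth _ false) => [|k]; rewrite size_map size_iota ?size_nseq // => kl.
  by rewrite (nth_map 0) ?size_iota // nth_iota // nth_nseq kl; apply: hk; alia.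
by rewrite -hj; congr (h v (p _)); alia.
Qed.

(** One more neighbour would give, after dropping zeros and contracting triples of ones, 2 (n - 3)
    zeros between two ones. *)
Lemma ext_count v a b : v \in E -> a <= b <= l ->
  count (fun i => h v (p i)) (iota a (b - a).+1) <= 3 * (n - 3) + 1.
Proof.
move=> vE ab; rewrite leqNgt; apply/negP => lt.
have := fan_ones sg (fan_segment vE ab); rewrite count_map => fo.
apply: (@nf (2 * (n - 3))); first by alia.
apply: fan_zeros => //; set c := count _ _ in fo.
have := @fan_infix _ g [::] (nseq (3 * (n - 3) + 2) true) (nseq (c - (3 * (n - 3) + 2)) true).
rewrite /= -nseqD subnKC; last by rewrite /c (eq_count (a2 := fun i => h v (p i))) //; alia.
by apply.
Qed.

(* At most 3 (n - 3) + 1 neighbours (ext_count) with gaps of at most n - 3 (ext_gap). *)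
Definition width := 3 * (n - 3) * (n - 3).

Lemma ext_width v : v \in E -> rg v <= lf v + width.
Proof.
move=> vE; have [/andP[lr rl] hl hr lrm] := lrP vE.
suff main c : lf v <= c <= l -> h v (p c) ->
    c <= lf v + count (fun i => h v (p i)) (iota (lf v).+1 (c - lf v)) * (n - 3).
  have := main (rg v) ltac:(alia) hr; have := ext_count vE (a := lf v) (b := rg v) ltac:(alia).
  rewrite /= hl /width; set k := count _ _ => k1 k2.
  by apply: leq_trans k2 _; rewrite leq_add2l leq_mul2r; apply/orP; right; alia.
elim/ltn_ind: c => c IH cl hc; case: (eqVneq c (lf v)) => [->|ne]; first exact: leq_addr.
pose P k := (k < c) && h v (p k).
have exP : exists k, P k by exists (lf v); rewrite /P hl andbT; alia.
have ubP k : P k -> k <= c by case/andP; alia.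
case: (ex_maxnP exP ubP) => b /andP[bc hb] bmax.
have lb : lf v <= b by apply: bmax; rewrite /P hl andbT; alia.
have gap : c <= b + (n - 3).
  apply: (ext_gap vE) => //; first by alia.
  move=> k kbc; apply/negP => hk; have := bmax k; rewrite /P hk andbT; alia.
have := IH b bc ltac:(alia) hb.
have -> : c - lf v = (b - lf v) + (c - b).-1.+1 by alia.
rewrite iotaD count_cat -[(c - b).-1.+1]addn1 iotaD count_cat /=.
have -> : (lf v).+1 + (b - lf v) + (c - b).-1 = c by alia.
rewrite hc; set k1 := count _ _; set k2 := count _ _; rewrite !mulnDl => bk; apply: leq_trans gap _.
by apply: leq_trans (leq_add bk (leqnn _)) _; rewrite -!addnA !leq_add2l addnCA leq_addr.
Qed.

(** Take [u] as hub and the path from [p (rg u)] to [p (lf v)], prolonged by [v]: its word is 1 0^d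
    1 with d = [lf v - rg u]. *)
Lemma ext_far u v : u \in E -> v \in E -> h u v -> rg u < lf v -> lf v < rg u + n.
Proof.
move=> uE vE uv ruv; have [/andP[lr rl] hl hr lrm] := lrP uE.
have [/andP[lr' rl'] hl' hr' lrm'] := lrP vE.
rewrite ltnNge; apply/negP => far; set d := lf v - rg u.
apply: (@nf d); first by rewrite /d; alia.
have [hs hi] := sh.
exists h, u, (fun i => if i <= d then p (rg u + i) else v); split; first exact: gh.
have szw : size (true :: nseq d false ++ [:: true]) = d.+2.
  by rewrite /= size_cat size_nseq /= addn1.
have hvp i : i <= d -> h v (p (rg u + i)) = (i == d).
  move=> il; case: (eqVneq i d) => [->|ne]; first by rewrite /d subnKC // ltnW.
  by apply/negP => /(lrm' _ _)/=; rewrite /d in il ne; alia.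
have hup i : i <= d -> h u (p (rg u + i)) = (i == 0).
  move=> il; case: (eqVneq i 0) => [->|ne]; first by rewrite addn0.
  by apply/negP => /(lrm _ _)/=; rewrite /d in il; alia.
rewrite /d in hvp hup *; split; rewrite szw.
- move=> i j il jl; case: (leqP i _) => id; case: (leqP j _) => jd.
  + by move/pinj => e; have := e ltac:(alia) ltac:(alia); alia.
  + by move=> e; have := @ext_p v (rg u + i) vE ltac:(alia); rewrite e eqxx.
  + by move=> e; have := @ext_p v (rg u + j) vE ltac:(alia); rewrite e eqxx.
  by alia.
- move=> i j il jl; case: (leqP i _) => id; case: (leqP j _) => jd.
  + by rewrite padj; alia.
  + by rewrite hs hvp //; alia.
  + by rewrite hvp //; alia.
  by rewrite hi; alia.
- move=> i il; case: (leqP i _) => id; first by rewrite eq_sym ext_p //; alia.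
  by apply: contraTneq uv => ->; rewrite hi.
move=> i il; case: (leqP i _) => id; last first.
  have -> : i = (lf v - rg u).+1 by alia.
  by rewrite uv /= nth_cat size_nseq ltnn subnn.
rewrite hup //; case: i il id => [|i] il id //=.
by rewrite nth_cat size_nseq id nth_nseq id.
Qed.

(** Off-path vertices are placed by their rightmost neighbour, so the cut depends on i alone and
    grows with it. *)
Definition Qc i : {set T} := [set y | (y \in onp p i) || ((y \in E) && (rg y <= i.+1))].

Lemma p_Qc a i : a <= l -> i <= l -> (p a \in Qc i) = (a <= i).
Proof.
move=> al il; rewrite in_set (negbTE (p_ext al)) orbF.
by apply/onpP/idP => [[b bi /pinj ->]|ai]; try alia; exists a.
Qed.

Lemma ext_Qc v i : v \in E -> i <= l -> (v \in Qc i) = (rg v <= i.+1).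
Proof.
move=> vE il; rewrite in_set vE; case: onpP => [[b bi vb]|] //.
by have := @ext_p v b vE ltac:(alia); rewrite vb eqxx.
Qed.

Lemma Qc_ends i : 0 < i -> i.+2 <= l ->
  ends_l p \subset Qc i /\ forall y, y \in ends_r p l -> y \notin Qc i.
Proof.
move=> i0 il; split.
  by apply/subsetP => y; rewrite !in_set2 => /orP[] /eqP->; rewrite p_Qc; alia.
by move=> y; rewrite !in_set2 => /orP[] /eqP->; rewrite p_Qc; alia.
Qed.

Lemma Qc_ncut i : 0 < i -> i.+2 <= l -> ~ cutle1 h (Qc i).
Proof. by move=> i0 il; have [c1 c2] := Qc_ends i0 il; apply: hlk. Qed.

Definition crit v i := [/\ 0 < i, i.+2 <= l & cutle1 (del h v) (Qc i)].

(** Rank one lets the path cross only once. Another off-path vertex placed differently from [Qc]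
    would have the two ends of the crossing edge as its only path neighbours, which [ext_not_mid]
    excludes. *)
Lemma ext_crit v : v \in E -> exists i, crit v i.
Proof.
move=> vE; have [Q [XQ YQ [A [B AB]]]] : exists Q : {set T}, [/\ ends_l p \subset Q,
    forall y, y \in ends_r p l -> y \notin Q & cutle1 (del h v) Q].
  by apply: NNPP => nQ; apply: (ext_critical vE) => Q XQ YQ cQ; apply: nQ; exists Q.
have p0 : p 0 \in Q by apply: (subsetP XQ); rewrite in_set2 eqxx.
have p1 : p 1 \in Q by apply: (subsetP XQ); rewrite in_set2 eqxx orbT.
have pl : p l \notin Q by apply: YQ; rewrite in_set2 eqxx orbT.
have pl1 : p l.-1 \notin Q by apply: YQ; rewrite in_set2 eqxx.
have exP : exists j, p j \notin Q by exists l.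
case: (ex_minnP exP) => -[|[|i]]; rewrite ?p0 ?p1 // => pi1 imin.
have il : i.+3 <= l by have := imin _ pl1; alia.
have pin j : j < i.+2 -> p j \in Q.
  by move=> jl; apply: contraT => /imin; alia.
have dp a b : a <= l -> b <= l -> del h v (p a) (p b) = (a.+1 == b) || (b.+1 == a).
  by move=> al bl; rewrite /del padj // !(eq_sym _ v) !(ext_p vE) // !andbT.
have /andP[Ai Bi] : A (p i.+1) && B (p i.+2).
  by rewrite -AB ?(pin i.+1) // dp; alia.
have pout b : i.+2 <= b <= l -> p b \notin Q.
  move=> bl; apply/negP => pb; pose P k := (k <= l) && (p k \in Q).
  have exP' : exists k, P k by exists b; rewrite /P pb andbT; alia.
  have ubP' k : P k -> k <= l by case/andP.
  case: (ex_maxnP exP' ubP') => c /andP[cl pc] cmax.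
  have bc : b <= c by apply: cmax; rewrite /P pb andbT; alia.
  have cl' : c < l.
    by rewrite ltn_neqAle cl andbT; apply: contraTneq pc => ->.
  have pc1 : p c.+1 \notin Q.
    by apply/negP => pc1; have := cmax c.+1; rewrite /P pc1 andbT; alia.
  have bne : b != i.+2 by apply: contraTneq pb => ->.
  have /andP[Ac Bc] : A (p c) && B (p c.+1) by rewrite -AB // dp //; alia.
  have e1 : del h v (p c) (p i.+2) by rewrite AB // Ac Bi.
  have e2 : del h v (p i.+1) (p c.+1) by rewrite AB ?(pin i.+1) // Ai Bc.
  by move: e1 e2; rewrite !dp; alia.
have posE u : u \in E -> u != v -> (u \in Q) = (rg u <= i.+2).
  move=> uE uv; have [/andP[lr rl] hl hr lrm] := lrP uE.
  have dup j : j <= l -> del h v u (p j) = h u (p j).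
    by move=> jl; rewrite /del uv eq_sym ext_p // !andbT.
  have dpu j : j <= l -> del h v (p j) u = h u (p j).
    by move=> jl; rewrite /del uv eq_sym ext_p // !andbT sh.1.
  apply/idP/idP => [uQ|ru].
    rewrite leqNgt; apply/negP => ru.
    have : del h v u (p (rg u)) by rewrite dup.
    rewrite AB ?pout //; last by alia.
    case/andP => _ Br; have : del h v (p i.+1) (p (rg u)).
      by rewrite AB ?(pin i.+1) ?pout ?Ai //; alia.
    by rewrite dp; alia.
  apply: contraT => uQ; have nb a : a < i.+2 -> h u (p a) -> a = i.+1.
    move=> ai ha; have : del h v (p a) u by rewrite dpu //; alia.
    rewrite AB ?pin // => /andP[Aa _].
    have : del h v (p a) (p i.+2) by rewrite AB ?(pin a) // Aa.
    by rewrite dp; alia.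
  have lE : lf u = i.+1 by apply: nb => //; alia.
  have rE : rg u = i.+2 by alia.
  case: (@ext_not_mid u i.+1 uE); [alia|alia|] => j jl.
  apply/idP/orP => [hj|[/eqP->|/eqP->]]; last by rewrite -rE.
    by have := lrm j jl hj; rewrite lE rE; alia.
  by rewrite -lE.
exists i.+1; split=> //.
apply: (@cutle1_alive _ _ Q); first exact: simple_del sh.
  move=> x y /and3P[hxy xv yv]; case: (alive_cases hxy) => [[j jl ->]|xE].
    rewrite p_Qc //; last by alia.
    case: (ltnP j i.+2) => ji; first by rewrite pin.
    by rewrite (negbTE (pout j _)) ?ltnNge; alia.
  by rewrite posE // ext_Qc //; alia.
by exists A, B.
Qed.

Lemma crit_AB v i : v \in E -> crit v i -> exists A B : T -> bool,
  [/\ forall a b, a \in Qc i -> b \notin Qc i -> a != v -> b != v -> h a b = A a && B b,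
      A (p i), B (p i.+1),
      forall a, a < i -> A (p a) = false
    & forall b, i.+1 < b <= l -> B (p b) = false].
Proof.
move=> vE [i0 il [A [B AB]]]; exists A, B.
have AB' a b : a \in Qc i -> b \notin Qc i -> a != v -> b != v -> h a b = A a && B b.
  by move=> aQ bQ av bv; rewrite -AB // /del av bv !andbT.
have pp a b : a <= i -> i < b <= l -> A (p a) && B (p b) = ((a.+1 == b) || (b.+1 == a)).
  move=> ai bi; rewrite -AB' ?p_Qc ?padj //; try alia.
  - by rewrite eq_sym ext_p //; alia.
  - by rewrite eq_sym ext_p //; alia.
have /andP[Ai Bi] : A (p i) && B (p i.+1) by rewrite pp; alia.
split=> //.
- by move=> a ai; have := pp a i.+1; rewrite Bi andbT => ->; alia.
by move=> b bi; have := pp i b; rewrite Ai andTb => ->; alia.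
Qed.

Lemma crit_right_lf v i u : v \in E -> crit v i -> u \in E -> u != v -> i.+1 < rg u -> i <= lf u.
Proof.
move=> vE cv uE uv ru; have [A [B [AB Ai Bi Aa Bb]]] := crit_AB vE cv; have [i0 il _] := cv.
have [/andP[lr rl] hl hr lrm] := lrP uE.
rewrite leqNgt; apply/negP => li.
have : h (p (lf u)) u by rewrite sh.1.
rewrite AB ?p_Qc ?ext_Qc ?(Aa _ li) //; try alia.
by rewrite eq_sym ext_p //; alia.
Qed.

(** If the crossing were far away, an edge from [v] across the cut would lead to a distant off-path
    vertex, against [ext_far]. So [v] has no such edge, and the cut has rank one without deleting
    it. *)
Lemma crit_near v i : v \in E -> crit v i -> i <= rg v + n /\ lf v <= i.+1 + n.
Proof.
move=> vE cv; have [i0 il [A [B AB]]] := cv.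
have [/andP[lr rl] hl hr lrm] := lrP vE.
split; rewrite leqNgt; apply/negP => far; apply: (Qc_ncut i0 il).
  exists (fun a => (a != v) && A a), B => a b aQ bQ.
  have vQ : v \in Qc i by rewrite ext_Qc //; alia.
  have bv : b != v by apply: contraNneq bQ => ->.
  case: (eqVneq a v) => [->|av] /=; last by rewrite -AB // /del av bv !andbT.
  apply/negP => hvb; case: (alive_cases (_ : h b v)) => [|[j jl bj]|bE]; first by rewrite sh.1.
    by rewrite bj p_Qc in bQ; [have := lrm j jl; rewrite -bj => /(_ hvb)|..]; alia.
  have rb : i.+1 < rg b by move: bQ; rewrite ext_Qc //; alia.
  have lb := crit_right_lf vE cv bE bv rb.
  by have := ext_far vE bE hvb; alia.
exists A, (fun b => (b != v) && B b) => a b aQ bQ.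
have vQ : v \notin Qc i by rewrite ext_Qc //; alia.
have av : a != v by apply: contraTneq aQ => ->.
case: (eqVneq b v) => [->|bv] /=; last by rewrite -AB // /del av bv !andbT.
rewrite andbF; apply/negP => hav; case: (alive_cases hav) => [[j jl aj]|aE].
  rewrite aj p_Qc // in aQ; try by alia.
  by have := lrm j jl; rewrite sh.1 -aj => /(_ hav); alia.
have ra : rg a <= i.+1 by move: aQ; rewrite ext_Qc //; alia.
by have := ext_far aE vE hav; alia.
Qed.

(** Otherwise the path edge at c is the only edge across [Qc c]. *)
Lemma ext_near c : 0 < c -> c.+2 <= l ->
  exists v, [/\ v \in E, c <= rg v + n & lf v <= c.+1 + n].
Proof.
move=> c0 cl; apply: NNPP => nv; apply: (Qc_ncut c0 cl).
have far v : v \in E -> rg v + n < c \/ c.+1 + n < lf v.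
  move=> vE; case: (leqP c (rg v + n)) => c1; last by left.
  by case: (leqP (lf v) (c.+1 + n)) => c2; [case: nv; exists v|right].
exists (fun a => a == p c), (fun b => b == p c.+1) => a b aQ bQ.
have pE i j : i <= l -> j <= l -> (p i == p j) = (i == j).
  by move=> il jl; apply/eqP/eqP => [/pinj|->] //; apply.
apply/idP/andP => [hab|[/eqP-> /eqP->]]; last by rewrite padj; alia.
have hba : h b a by rewrite sh.1.
case: (alive_cases hab) => [[i il ai]|aE]; case: (alive_cases hba) => [[j jl bj]|bE].
- move: aQ bQ hab; rewrite ai bj !p_Qc ?padj ?pE //; alia.
- have [/andP[lr rl] hl hr lrm] := lrP bE.
  have rb : c.+1 < rg b by move: bQ; rewrite ext_Qc //; alia.
  have ic : i <= c by move: aQ; rewrite ai p_Qc //; alia.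
  by have := lrm i il; rewrite -ai => /(_ hba) ?; case: (far b bE) => ?; alia.
- have [/andP[lr rl] hl hr lrm] := lrP aE.
  have ra : rg a <= c.+1 by move: aQ; rewrite ext_Qc //; alia.
  have jc : c < j by move: bQ; rewrite bj p_Qc //; alia.
  by have := lrm j jl; rewrite -bj => /(_ hab) ?; case: (far a aE) => ?; alia.
have [/andP[lr rl] hl hr lrm] := lrP aE; have [/andP[lr' rl'] hl' hr' lrm'] := lrP bE.
have rb : c.+1 < rg b by move: bQ; rewrite ext_Qc //; alia.
have ra : rg a <= c.+1 by move: aQ; rewrite ext_Qc //; alia.
have ef := ext_far aE bE hab.
by move: ef; case: (far a aE) => ?; case: (far b bE) => ?; alia.
Qed.

(** Crossing and rightmost neighbour stray at most [width] + 2n + 1 from the prescribed place; twice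
    this plus one keeps them in order. *)
Definition step := 2 * width + 4 * n + 3.

Lemma crit_chain N : N * step + 3 <= l -> exists (x : nat -> T) (i : nat -> nat),
  [/\ forall k, k <= N -> x k \in E /\ crit (x k) (i k),
      forall j k, j < k -> k <= N -> i j < i k,
      forall j k, j < k -> k <= N -> rg (x j) <= (i k).+1,
      forall j k, j < k -> k <= N -> (i j).+1 < rg (x k)
    & forall j k, j < k -> k <= N -> rg (x j) < rg (x k)].
Proof.
move=> Nl; pose c k := k * step + 1.
have [x xP] : exists x : nat -> T, forall k, k <= N ->
    [/\ x k \in E, c k <= rg (x k) + n & lf (x k) <= (c k).+1 + n].
  apply: (@fchoice _ _ (fun k v => k <= N -> [/\ v \in E, c k <= rg v + n & lf v <= (c k).+1 + n])).
  move=> k; case: (leqP k N) => kN; last by exists (p 0).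
  have ck : c k <= N * step + 1 by rewrite leq_add2r leq_mul2r kN orbT.
  have c0 : 0 < c k by rewrite /c addn1.
  have cl : (c k).+2 <= l by alia.
  by have [v vP] := ext_near c0 cl; exists v.
have [i iP] : exists i : nat -> nat, forall k, k <= N -> crit (x k) (i k).
  apply: (@fchoice _ _ (fun k i => k <= N -> crit (x k) i)) => k.
  case: (leqP k N) => kN; last by exists 0.
  by have [xE _ _] := xP k kN; have [i ci] := ext_crit xE; exists i.
have cc j k : j < k -> c j + step <= c k.
  by move=> jk; rewrite /c -addnAC leq_add2r -mulSnr leq_mul2r jk orbT.
have bd k : k <= N -> [/\ c k <= rg (x k) + n, rg (x k) <= (c k).+1 + n + width,
   i k <= (c k).+1 + 2 * n + width & c k <= (i k).+1 + 2 * n + width].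
  move=> kN; have [xE c1 c2] := xP k kN; have [b1 b2] := crit_near xE (iP k kN).
  by have := ext_width xE; split; alia.
have bd2 j k : j < k -> k <= N ->
    [/\ i j < i k, rg (x j) <= (i k).+1, (i j).+1 < rg (x k) & rg (x j) < rg (x k)].
  move=> jk kN; have := cc j k jk; rewrite {1}/step => jk'.
  have [a1 a2 a3 a4] := bd j ltac:(alia); have [b1 b2 b3 b4] := bd k kN.
  by split; alia.
exists x, i; split.
- by move=> k kN; have [xE _ _] := xP k kN; split=> //; apply: iP.
- by move=> j k jk kN; case: (bd2 j k).
- by move=> j k jk kN; case: (bd2 j k).
- by move=> j k jk kN; case: (bd2 j k).
by move=> j k jk kN; case: (bd2 j k).
Qed.

(** * Robust ends and the construction of the strip *)

Definition Yc v i : {set T} := v |: [set y | ((y \in onp p l) || (y \in E)) && (y \notin Qc i)].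

Lemma path_connect (D : {set T}) a b : a <= b -> b <= l ->
  (forall j, a <= j <= b -> p j \in D) ->
  connect [rel u w | [&& h u w, u \in D & w \in D]] (p a) (p b).
Proof.
elim: b => [|b IH] ab bl pD; first by have -> : a = 0 by alia.
case: (eqVneq a b.+1) => [->|ne]; first exact: connect0.
apply: (@connect_trans _ _ (p b)).
  by apply: IH => [||j jb]; [alia|alia|apply: pD; alia].
by apply: connect1; rewrite /= padj ?pD; alia.
Qed.

Lemma path_connectV (D : {set T}) a b : a <= b -> b <= l ->
  (forall j, a <= j <= b -> p j \in D) ->
  connect [rel u w | [&& h u w, u \in D & w \in D]] (p b) (p a).
Proof.
move=> ab bl pD; rewrite (sym_connect_sym _ (p b)); first exact: path_connect.
by move=> u w /=; rewrite sh.1; congr andb; rewrite andbC.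
Qed.

(** [Z] consists of the vertices that see across the cut. If [v] saw no other vertex of this side
    and all or none of [Z], placing [v] on the far side would give a cut of rank one. *)
Lemma robust_left v i : v \in E -> crit v i ->
  exists2 Z : {set T}, v \notin Z /\ Z \subset v |: (Qc i :\ v) & robust (v |: (Qc i :\ v)) Z v h.
Proof.
move=> vE cv; have [A [B [AB Ai Bi Aa Bb]]] := crit_AB vE cv; have [i0 il _] := cv.
have il' : i <= l by alia.
have pv j : j <= l -> p j != v by move=> jl; rewrite eq_sym ext_p.
pose Z : {set T} := [set z in Qc i :\ v | A z].
have inX y : (y \in v |: (Qc i :\ v)) = (y == v) || (y \in Qc i).
  by rewrite !inE; case: (y == v).
have inZ y : (y \in Z) = [&& y != v, y \in Qc i & A y] by rewrite !inE -andbA.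
set X := v |: _ in inX *.
have outX y : y \notin X -> y != v /\ y \notin Qc i by rewrite inX negb_or => /andP.
have inD y : (y \in [set d in X | (d != v) && (d \notin Z)]) = [&& y != v, y \in Qc i & ~~ A y].
  by rewrite in_set inX inZ; case: (y == v) (y \in Qc i) (A y) => [] [] [].
have pD j : j < i -> p j \in [set d in X | (d != v) && (d \notin Z)].
  by move=> ji; rewrite inD pv ?p_Qc ?Aa //; alia.
have extA u : u \in E -> u != v -> u \in Qc i -> A u = (rg u == i.+1).
  move=> uE uv uQ; have [/andP[lr rl] hl hr lrm] := lrP uE.
  have : h u (p i.+1) = A u by rewrite AB ?pv ?p_Qc ?Bi ?andbT //; alia.
  move: uQ; rewrite ext_Qc // => ru <-; apply/idP/eqP => [hu|<-] //.
  by have := lrm i.+1 ltac:(alia) hu; alia.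
exists Z; first by split; [rewrite inZ eqxx|apply/subsetP => z; rewrite inZ inX => /and3P[_ -> _]; rewrite orbT].
split.
- move=> d w; rewrite inD => /and3P[dv dQ nA] /outX[wv wQ].
  by rewrite AB // (negbTE nA).
- move=> z z' w; rewrite !inZ => /and3P[zv zQ Az] /and3P[zv' zQ' Az'] /outX[wv wQ].
  by rewrite !AB // Az Az'.
- exists (p 0); first exact: pD.
  move=> d; rewrite inD => /and3P[dv dQ nA]; move: (dQ).
  have pc a : a < i -> connect [rel u w | [&& h u w, u \in [set d in X | (d != v) && (d \notin Z)]
      & w \in [set d in X | (d != v) && (d \notin Z)]]] (p 0) (p a).
    by move=> ai; apply: path_connect => [||j ja]; [alia|alia|apply: pD; alia].
  rewrite in_set => /orP[/onpP[a al da]|/andP[dE _]].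
    rewrite da; apply: pc; rewrite ltn_neqAle al andbT.
    by apply: contraNneq nA => ai; rewrite da ai.
  have [/andP[lr rl] hl hr lrm] := lrP dE.
  have rd : rg d <= i.
    by move: (dQ) nA; rewrite extA // ext_Qc // => ? ?; alia.
  apply: connect_trans (pc (lf d) _) _; first by alia.
  by apply: connect1; rewrite /= sh.1 hl pD ?inD ?dv ?dQ //; alia.
- move=> z; rewrite inZ => /and3P[zv zQ Az]; move: (zQ).
  rewrite in_set => /orP[/onpP[a al za]|/andP[zE _]].
    have -> : z = p i.
      by rewrite za; congr p; apply/eqP; rewrite eqn_leq al /= leqNgt; apply: contraTN Az => ai; rewrite za Aa.
    by exists (p i.-1); [apply: pD; alia|rewrite padj; alia].
  have [/andP[lr rl] hl hr lrm] := lrP zE.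
  have rz : rg z = i.+1 by apply/eqP; rewrite -extA.
  case: (ltnP (lf z) i) => li; first by exists (p (lf z)) => //; apply: pD.
  have lz : lf z = i by alia.
  case: (ext_not_mid zE i0) => [|j jl]; first by alia.
  apply/idP/orP => [hj|[/eqP->|/eqP->]]; [|by rewrite -lz|by rewrite -rz].
  by have := lrm j jl hj; rewrite lz rz; alia.
apply: NNPP => /not_or_and[n1 n2].
have [v1 v2] := ext_ends vE; have [e1 e2] := Qc_ends i0 il.
apply: (@hlk (Qc i :\ v)).
- by apply/subsetP => y yl; rewrite in_setD1 (subsetP e1) // andbT; apply: contraNneq v1 => <-.
- by move=> y yr; rewrite in_setD1 (negbTE (e2 y yr)) andbF.
exists A, (fun b => if b == v then [exists z in Z, h v z] else B b) => a b.
rewrite in_setD1 => /andP[av aQ]; rewrite in_setD1 negb_and negbK.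
case: (eqVneq b v) => [-> _|bv /= bQ]; last by rewrite AB.
rewrite sh.1; case: (boolP (A a)) => Aa'; last first.
  by apply/negP => va; apply: n1; exists a; rewrite ?inD ?av ?aQ.
have aZ : a \in Z by rewrite inZ av aQ.
apply/idP/exists_inP => [va|[z zZ vz]]; first by exists a.
by apply: contraT => va; case: n2; exists z, a; rewrite vz.
Qed.

Lemma robust_right v i : v \in E -> crit v i ->
  exists2 Z : {set T}, v \notin Z /\ Z \subset Yc v i & robust (Yc v i) Z v h.
Proof.
move=> vE cv; have [A [B [AB Ai Bi Aa Bb]]] := crit_AB vE cv; have [i0 il _] := cv.
have il' : i <= l by alia.
have pv j : j <= l -> p j != v by move=> jl; rewrite eq_sym ext_p.
pose alv y := (y \in onp p l) || (y \in E).
have alive y w : h y w -> alv y.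
  move=> /alive_cases[[j jl ->]|yE]; rewrite /alv ?yE ?orbT //.
  by apply/orP; left; apply/onpP; exists j.
pose Z : {set T} := [set z in Yc v i :\ v | B z].
have inX y : (y \in Yc v i) = (y == v) || alv y && (y \notin Qc i).
  by rewrite /Yc in_setU1 in_set.
have inZ y : (y \in Z) = [&& y != v, alv y, y \notin Qc i & B y].
  by rewrite in_set in_setD1 inX; case: (y == v); rewrite //= -andbA.
set X := Yc v i in inX *.
have inD y : (y \in [set d in X | (d != v) && (d \notin Z)]) = [&& y != v, alv y, y \notin Qc i & ~~ B y].
  by rewrite in_set inX inZ; case: (y == v) (alv y) (y \in Qc i) (B y) => [] [] [] [].
have pal j : j <= l -> alv (p j) by move=> jl; apply/orP; left; apply/onpP; exists j.
have pD j : i.+1 < j <= l -> p j \in [set d in X | (d != v) && (d \notin Z)].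
  by move=> ji; rewrite inD pv ?pal ?p_Qc ?Bb //; alia.
have outX y z : y \notin X -> z != v -> z \notin Qc i -> h z y = A y && (y \in Qc i) && B z.
  rewrite inX negb_or sh.1 => /andP[yv nal] zv zQ.
  case: (boolP (y \in Qc i)) nal => yQ; first by rewrite AB // andbT.
  by rewrite andbT andbF => nal; apply: contraNF nal => /alive.
exists Z; first by split; [rewrite inZ eqxx|apply/subsetP => z; rewrite inZ inX => /and4P[_ -> -> _]; rewrite orbT].
split.
- move=> d w; rewrite inD => /and4P[dv _ dQ nB] wX.
  by rewrite outX // (negbTE nB) andbF.
- move=> z z' w; rewrite !inZ => /and4P[zv _ zQ Bz] /and4P[zv' _ zQ' Bz'] wX.
  by rewrite !outX // Bz Bz'.
- exists (p l); first by apply: pD; alia.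
  have pc a : i.+1 < a <= l -> connect [rel u w | [&& h u w, u \in [set d in X | (d != v) && (d \notin Z)]
      & w \in [set d in X | (d != v) && (d \notin Z)]]] (p l) (p a).
    by move=> ai; apply: path_connectV => [||j ja]; [alia|alia|apply: pD; alia].
  move=> d; rewrite inD => /and4P[dv /orP[/onpP[a al da]|dE] dQ nB].
    move: (dQ); rewrite da p_Qc // => ai; apply: pc; rewrite al andbT.
    have : a != i.+1 by apply: contraNneq nB => e; rewrite da e.
    by alia.
  have [/andP[lr rl] hl hr lrm] := lrP dE.
  move: (dQ); rewrite ext_Qc // => rd.
  apply: connect_trans (pc (rg d) _) _; first by alia.
  by apply: connect1; rewrite /= sh.1 hr pD ?inD ?dv ?dQ ?nB /alv ?dE ?orbT //; alia.
- move=> z; rewrite inZ => /and4P[zv /orP[/onpP[a al za]|zE] zQ Bz].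
    move: (zQ); rewrite za p_Qc // => ai.
    have -> : a = i.+1.
      by apply/eqP; apply: contraTT Bz => ne; rewrite za Bb //; alia.
    by exists (p i.+2); [apply: pD; alia|rewrite padj; alia].
  have [/andP[lr rl] hl hr lrm] := lrP zE.
  by move: (zQ); rewrite ext_Qc // => rz; exists (p (rg z)) => //; apply: pD; alia.
apply: NNPP => /not_or_and[n1 n2].
have [v1 v2] := ext_ends vE; have [e1 e2] := Qc_ends i0 il.
apply: (@hlk (v |: Qc i)).
- by apply/subsetP => y yl; rewrite in_setU1 (subsetP e1) ?orbT.
- move=> y yr; rewrite in_setU1 (negbTE (e2 y yr)) orbF.
  by apply: contraNneq v2 => <-.
exists (fun a => if a == v then [exists z in Z, h v z] else A a), (fun b => alv b && B b) => a b.
rewrite in_setU1 => aQ; rewrite in_setU1 negb_or => /andP[bv bQ].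
case: (boolP (alv b)) => ab /=; last first.
  by rewrite andbF; apply: contraNF ab; rewrite sh.1 => /alive.
case: (eqVneq a v) aQ => [-> _|av /= aQ]; last by rewrite AB.
case: (boolP (B b)) => Bb'; last first.
  by rewrite andbF; apply/negP => vb; apply: n1; exists b; rewrite ?inD ?bv ?ab ?bQ.
have bZ : b \in Z by rewrite inZ bv ab bQ.
rewrite andbT; apply/idP/exists_inP => [vb|[z zZ vz]]; first by exists b.
by apply: contraT => vb; case: n2; exists z, b; rewrite vz.
Qed.

Lemma Qc_sub i j y : i <= j -> y \in Qc i -> y \in Qc j.
Proof.
move=> ij; rewrite in_set => yQ; rewrite in_set; case/orP: yQ => [/onpP[a ai ->]|/andP[-> ry]].
  by apply/orP; left; apply/onpP; exists a => //; alia.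
by apply/orP; right; alia.
Qed.

Lemma strip_exists m : m.+1 * step + 3 <= l -> exists (f : rel T) Q0 Y x,
  [/\ strip f m Q0 Y x, reach h f, rconn f (Tk Q0 x 1) & rconn f Y].
Proof.
move=> ml; have [x [i [xc ii ri ir rr]]] := crit_chain ml.
have xE k : k <= m.+1 -> x k \in E by move=> /xc[].
have xcrit k : k <= m.+1 -> crit (x k) (i k) by move=> /xc[].
have il k : k <= m.+1 -> i k <= l by move=> /xcrit[? ? _]; alia.
have xQ j k : j <= m.+1 -> k <= m.+1 -> j != k -> (x j \in Qc (i k)) = (j < k).
  move=> jm km; rewrite ext_Qc ?xE ?il // neq_ltn => /orP[jk|kj].
    by rewrite jk ri.
  by have := ir k j kj jm; alia.
have xinj j k : j <= m.+1 -> k <= m.+1 -> x j = x k -> j = k.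
  suff lt a b : a < b -> b <= m.+1 -> x a <> x b.
    move=> jm km e; apply/eqP; apply: contraT; rewrite neq_ltn => /orP[lt1|lt1].
      by case: (lt _ _ lt1 km).
    by case: (lt _ _ lt1 jm).
  by move=> ab bm e; have := rr a b ab bm; rewrite e ltnn.
(* A critical vertex may lie on either side of its own cut; [x 0] is moved into the left end
   [Tk Q0 x 1], and [x m.+1] into [Y]. *)
pose Q0 := Qc (i 0) :\ x 0; pose Y := Yc (x m.+1) (i m.+1).
have T1 : Tk Q0 x 1 = x 0 |: (Qc (i 0) :\ x 0).
  by apply/setP => y; rewrite /Tk in_setU in_setU1 orbC !inE.
have Q0i k y : y \in Q0 -> k <= m.+1 -> y \in Qc (i k).
  rewrite in_setD1 => /andP[_ yQ] km; case: (posnP k) => [->|k0] //.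
  by apply: Qc_sub yQ; apply/ltnW/ii.
have YQ k y : y \in Y -> y != x m.+1 -> k <= m.+1 -> y \notin Qc (i k).
  rewrite in_setU1 => /predU1P[->|]; first by rewrite eqxx.
  rewrite in_set => /andP[_ yQ] _ km; apply: contra yQ => yQ.
  by case: (eqVneq k m.+1) => [<-|ne] //; apply: Qc_sub yQ; apply/ltnW/ii; alia.
have xQ0 j : j <= m.+1 -> x j \notin Q0.
  move=> jm; rewrite in_setD1; case: (eqVneq j 0) => [->|j0]; first by rewrite eqxx.
  by rewrite xQ // ltn0 andbF.
have xY j : j <= m -> x j \notin Y.
  move=> jm; apply/negP => jY.
  have ne : x j != x m.+1 by apply/eqP => /xinj; alia.
  by have := YQ m.+1 _ jY ne (leqnn _); rewrite xQ; alia.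
have YQ0 y : y \in Y -> y \notin Q0.
  move=> yY; case: (eqVneq y (x m.+1)) => [->|ne]; first exact: xQ0.
  by apply: contra (YQ 0 _ yY ne isT) => /Q0i; apply.
have [ZX [vX ZXs] rbX] := robust_left (xE 0 isT) (xcrit 0 isT).
have [ZY [vY ZYs] rbY] := robust_right (xE m.+1 (leqnn _)) (xcrit m.+1 (leqnn _)).
rewrite -T1 in ZXs rbX; rewrite -/Y in ZYs rbY.
pose X := Tk Q0 x 1; rewrite -/X in ZXs rbX.
have vXX : x 0 \in X by rewrite /X T1 in_setU1 eqxx.
have vYY : x m.+1 \in Y by rewrite in_setU1 eqxx.
pose U := Tk Q0 x m.+1 :|: Y.
have XU : X \subset U by apply: subset_trans (subsetUl _ _); apply: Tk_sub.
have YU : Y \subset U := subsetUr _ _.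
have xU k : k <= m.+1 -> x k \in U.
  rewrite leq_eqVlt in_setU => /predU1P[->|km]; first by rewrite vYY orbT.
  by apply/orP; left; apply/TkP; right; exists k.
pose P f := [/\ forall k, k <= m.+1 -> cutle1 (del f (x k)) (Qc (i k)),
                robust X ZX (x 0) f & robust Y ZY (x m.+1) f].
have [i01 i02 _] := xcrit 0 isT; have [j01 j02 _] := xcrit m.+1 (leqnn _).
have lk : linked h X Y.
  apply: linked_mono hlk; apply/subsetP => y yl.
    rewrite /X T1 in_setU1 in_setD1 -implyNb.
    by apply/implyP => ->; apply: (subsetP (Qc_ends i01 i02).1).
  rewrite in_setU1; apply/orP; right; rewrite in_set (Qc_ends j01 j02).2 // andbT.
  apply/orP; left; apply/onpP; move: yl; rewrite in_set2 => /orP[]/eqP->; [exists l.-1|exists l] => //; alia.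
have [f [sf hf lkf [cf' rX rY] alv]] : exists f, [/\ simple_graph f, reach h f, linked f X Y, P f & forall u w, f u w -> u \in U].
  apply: (linked_minor sh) => // [f w sf wU [pc pX pY]|f w sf wU [pc pX pY]|].
  - have wX : w \notin X by apply: contra wU; apply: subsetP.
    have wY : w \notin Y by apply: contra wU; apply: subsetP.
    split; [|exact: robust_lc|exact: robust_lc] => k km.
    have wx : w != x k by apply: contraNneq wU => ->; apply: xU.
    by rewrite -lc_del //; apply: cutle1_lc; [apply: simple_del|apply: pc].
  - have wX : w \notin X by apply: contra wU; apply: subsetP.
    have wY : w \notin Y by apply: contra wU; apply: subsetP.
    split; [|exact: robust_del|exact: robust_del] => k km.
    by rewrite del_del; apply/cutle1_del/pc.
  by split=> // k km; case: (xcrit k km).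
exists f, Q0, Y, x; split=> //; [|exact: robust_rconn rX|exact: robust_rconn rY].
split=> // [k km|u w /alv]; last by rewrite in_setU.
apply: (@cutle1_alive _ _ (Qc (i k))); [exact: simple_del| |exact: cf'].
(* Only vertices of [U] are alive in [f], and on these, [x k] excepted, the two cuts agree. *)
suff main u : u \in U -> u != x k -> (u \in Qc (i k)) = (u \in Tk Q0 x k).
  by move=> u w /and3P[/alv uU ux _]; apply: main.
move=> uU ux; case: (boolP (u \in Q0)) => uQ.
  by rewrite Q0i //; apply/esym/TkP; left.
have TkE a : (u \in Tk Q0 x a) -> exists2 b, b < a & u = x b.
  by move/TkP=> -[]; rewrite ?(negbTE uQ).
have [[j jm uj]|[uY um]] : (exists2 j, j <= m.+1 & u = x j) \/ (u \in Y /\ u != x m.+1).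
  move: uU; rewrite in_setU; case: (eqVneq u (x m.+1)) => [->|um]; first by left; exists m.+1.
  by case/orP => [/TkE[j jm ->]|uY]; [left; exists j => //; apply: ltnW|right].
  rewrite uj xQ //; last by apply: contraNneq ux => <-; rewrite uj.
  apply/idP/idP => [jk|]; first by apply/TkP; right; exists j.
  by rewrite -uj => /TkE[b bk]; rewrite uj => /xinj -> //; alia.
rewrite (negbTE (YQ k u uY um km)); apply/esym/negbTE/negP => /TkE[b bk ub].
by move: uY um; rewrite ub; case: (ltnP m b) => bm; [alia|rewrite (negbTE (xY b bm))].
Qed.

Lemma short_path : l < (256 * n).+1 * step + 3.
Proof.
rewrite ltnNge; apply/negP => /strip_exists[f [Q0 [Y [x [S hf cX cY]]]]].
have [||k kn [f' [v [q [ff' fanv]]]]] := strip_cycle S cX cY (n := n); [by alia|by []|].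
apply: (nf kn); exists f', v, q; split=> //.
exact: reach_trans (reach_trans gh hf) ff'.
Qed.

End Minimal.

(** * The bound and the conclusion *)

Lemma path_bound_large n : 4 <= n -> (256 * n).+1 * step n + 3 <= path_bound n.
Proof.
move=> n4; rewrite /path_bound leq_divRL // /step /width.
(* In terms of t both sides are polynomials with nonnegative coefficients, and the cubic left side
   is dominated coefficient by coefficient. *)
have [t ->] : exists t, n = t + 4 by exists (n - 4); lia.
have -> : t + 4 - 3 = t + 1 by lia.
rewrite !expnS expn0; nia.
Qed.

Lemma fan_of_path (T : finType) (g : rel T) n : 4 <= n -> simple_graph g -> prime_graph g ->
  has_induced_path g (path_bound n) ->
  exists2 k, n <= k + 3 & fan g (true :: nseq k false ++ [:: true]).
Proof.
move=> n4 sg pg ip; apply: NNPP => nf; have L3 := path_bound_large n4.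
have Lb : 3 <= path_bound n by lia.
have [p0 c0] := init_config sg pg Lb ip.
have [h [p [l [cf hmin]]]] := min_config c0.
have Ll : path_bound n <= l by case: cf.
have nf' k : n <= k + 3 -> ~ fan g (true :: nseq k false ++ [:: true]).
  by move=> kn fk; apply: nf; exists k.
have l3 := leq_trans Lb Ll.
have [lf [rg lrP]] := ext_bounds sg cf hmin l3 n4.
have := short_path sg cf hmin l3 n4 nf' lrP; lia.
Qed.

(** Complementing at the middle of three path vertices makes a triangle, with this vertex as the
    hub. *)
Lemma fan_of_short_path (T : finType) (g : rel T) L : simple_graph g ->
  has_induced_path g L -> 2 <= L -> fan g [:: true; true].
Proof.
move=> [gs gi] [f [finj fadj]] L2; pose q i := f (inord i).
have qi i j : i <= 2 -> j <= 2 -> q i = q j -> i = j.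
  move=> i2 j2 /finj/(congr1 (@nat_of_ord _)); rewrite !inordK //; lia.
have qa i j : i <= 2 -> j <= 2 -> g (q i) (q j) = (i.+1 == j) || (j.+1 == i).
  by move=> i2 j2; rewrite fadj !inordK //; lia.
have qe i j : i <= 2 -> j <= 2 -> (q i == q j) = (i == j).
  by move=> i2 j2; apply/eqP/eqP => [/qi|->] //; apply.
exists (local_comp g (q 1)), (q 1), (fun i => q i.*2); split.
  exact/reach_lc/reach_refl.
split=> /= [i j|i j|i|i].
- by move=> i2 j2 /qi; lia.
- by move=> i2 j2; rewrite lcE !qa ?qe //; lia.
- by move=> i2; rewrite qe //; lia.
by move=> i2; rewrite lcE gi /= addbF qa //; case: i i2 => [|[|]].
Qed.

Theorem theorem6p1 (n : nat) (T : finType) (g : rel T) :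
  3 <= n ->
  simple_graph g ->
  prime_graph g ->
  has_induced_path g (path_bound n) ->
  has_vertex_minor g (@cycle_graph n).
Proof.
move=> n3 sg pg ip; case: (ltnP 3 n) => n4.
  have [k nk fk] := fan_of_path n4 sg pg ip.
  by apply: (@fan_cycle _ g k) => //; rewrite n3.
have -> : n = 3 by lia.
apply: (@fan_cycle _ g 0) => //; apply: fan_of_short_path ip _ => //.
by have -> : n = 3 by lia.
Qed.
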